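(* (a) The lamplighter group $G$ satisfies uniform coupling $\mathrm{UC}(K)$ for $K>4$. (b) $G$ fails to satisfy the oscillation inequality $\mathrm{OI}(K)$ for $K<3$, and in particular does not satisfy the elliptic Harnack inequality (EHI).
   Context: Weighted graphs. A weighted graph $(\Gamma,\nu)$ is a locally finite connected graph $\Gamma=(G,E)$ (write $x\sim y$ if $\{x,y\}\in E$) with a conductance matrix $\nu=(\nu_{xy})_{x,y\in G}$ such that $\nu_{xy}\ge0$, $\nu_{xy}=\nu_{yx}$, and $\nu_{xy}>0$ if and only if $x\sim y$. The natural weight is $\nu_{xy}=1$ if $x\sim y$ and $0$ otherwise. Put $\mu(x)=\sum_y\nu_{xy}$. Let $d$ be the graph distance and $B(x,r)=\{y\in G:d(x,y)\le r\}$. For $A\subset G$ let $\partial A=\{y\in A^c:d(x,y)=1\text{ for some }x\in A\}$, $\overline A=A\cup\partial A$, and $\overline B(x,r)=B(x,r)\cup\partial B(x,r)$. The Laplacian is $\Delta f(x)=\frac1{\mu(x)}\sum_y\nu_{xy}(f(y)-f(x))$. A function $h$ is harmonic on $A$ if it is defined (at least) on $\overline A$, real valued, and $\Delta h(x)=0$ for all $x\in A$. The continuous time simple random walk (CTSRW) on $(\Gamma,\nu)$ is the Markov process with generator $\Delta$: it waits an exponential time with mean 1 at each vertex $x$, and then moves to each $y\sim x$ with probability $\nu_{xy}/\mu(x)$. Uniform (co-adapted) coupling $\mathrm{UC}(K)$, where $K>1$: for all $x_0\in G$, $R\ge1$, and $y_1,y_2\in B(x_0,R)$ there exist CTSRWs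 $Y^1,Y^2$, defined on the same filtered probability space, with $Y^i_0=y_i$, satisfying the following. Let $\tau_C=\min\{t\ge0:Y^1_t=Y^2_t\}$ and $\tau_E=\min\{t\ge0:Y^1_t\notin B(x_0,KR)\text{ or }Y^2_t\notin B(x_0,KR)\}$. Then there exists $p_1>0$, independent of $x_0$ and $R$, such that $\mathbb P(\tau_C<\tau_E)>p_1$. Oscillation inequality $\mathrm{OI}(K)$, where $K>1$: writing $\mathrm{Osc}(h,A)=\max_Ah-\min_Ah$, there exists $\rho<1$ such that, for all $x\in G$ and $R\ge1$, if $h$ is harmonic in $B(x,KR)$ then $\mathrm{Osc}(h,B(x,R))\le\rho\,\mathrm{Osc}(h,\overline B(x,KR))$. (EHI): there exists $C_1>0$ such that for any $x\in G$, $R\ge1$, and non-negative $h:G\to\mathbb R$ harmonic in $B(x,2R)$, one has $\sup_{B(x,R)}h\le C_1\inf_{B(x,R)}h$. The lamplighter group. Let $\mathcal A=\{\xi\in\{0,1\}^{\mathbb Z}:\sum_k\xi_k<\infty\}$ and $G=\mathbb Z\times\mathcal A$. For $\xi\in\mathcal A$, $n\in\mathbb Z$, $k\in\{0,1\}$ let $T_{n,k}(\xi)$ be the sequence $\eta$ with $\eta_i=\xi_i$ for $i\ne n$ and $\eta_n=k$. Edges on $G$ are defined by taking the four neighbours of $(n,\xi)$ to be the points $(n\pm1,T_{n,k}(\xi))$, $k=0,1$, and $G$ carries the natural weight. One thinks of the $\xi_i$ as lamps (off or on) and of $n$ as the location of the lamplighter; at each move the lamplighter may switch the status of the current lamp,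 and then moves to a neighbouring point (the `switch then walk' random walk). Writing the CTSRW as $(U_t,\Xi(t))$, $U$ is a CTSRW on $\mathbb Z$, and after $U$ leaves any site $n$ the state of the lamp $\Xi_n$ has been randomized.
   Formalization: The stated four-neighbour rule is not symmetric, contrary to ν_xy=ν_yx; the formal version keeps the rule, drops the symmetry requirement, and reads distance, balls and boundaries along directed paths starting at the centre. *)

(* Defs.v *)
From HB Require Import structures.
From mathcomp Require Import all_boot all_order all_algebra finmap.
From mathcomp Require Import all_classical all_reals all_analysis.

Set Implicit Arguments.
Unset Strict Implicit.
Unset Printing Implicit Defensive.

Import Order.TTheory GRing.Theory Num.Theory.
Import numFieldNormedType.Exports.

Local Open Scope classical_set_scope.
Local Open Scope ring_scope.

(* Locally finite connected weighted graphs.  Symmetry of the conductances is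
   deliberately not a field: the neighbour relation of the lamplighter graph
   below is oriented, and none of the notions defined here needs symmetry
   (steps, paths, balls and boundaries are always read from x outwards, which
   for a symmetric graph gives the usual notions). *)
Record wgraph (R : realType) := WGraph {
  vertex :> choiceType;
  adj : rel vertex;
  nu : vertex -> vertex -> R;
  nu_ge0 : forall x y, 0 <= nu x y;
  nu_gt0 : forall x y, (0 < nu x y) = adj x y;
  adj_finite : forall x, finite_set [set y | adj x y];
  adj_connected : forall x y,
    exists n, `[< exists p, [/\ path adj x p, last x p = y & size p = n] >]
}.

Section WeightedGraph.
Context {R : realType} {Gam : wgraph R}.
Implicit Types (x y : Gam) (r K : R) (A : set Gam) (h : Gam -> R).

Definition gdist x y : nat := ex_minn (adj_connected x y).

Definition gball x r : set Gam := [set y | (gdist x y)%:R <= r].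

Definition boundary A : set Gam :=
  [set y | ~ A y /\ exists2 x, A x & gdist x y = 1%N].

Definition gclosure A : set Gam := A `|` boundary A.

Definition mu x : R := \sum_(y \in setT) nu x y.

Definition lap h x : R := (mu x)^-1 * \sum_(y \in setT) nu x y * (h y - h x).

(* [lap h] on A only involves the values of h on [gclosure A], so a function
   defined on the closure is represented by any extension to all vertices. *)
Definition harmonic_on h A : Prop := forall x, A x -> lap h x = 0.

(* [sup] and [inf] are attained on the finite nonempty sets (balls and their
   closures) to which this is applied. *)
Definition osc h A : R := sup (h @` A) - inf (h @` A).

(* Transition function of the semigroup exp(t lap):
   p_t(x, y) = \sum_k t^k / k! (lap^k 1_{y})(x). *)
Definition heat (t : R) x y : R :=
  limn (series (fun k : nat => t ^+ k / k`!%:R * iter k lap \1_[set y] x)).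

End WeightedGraph.

Section RandomWalk.
Context {R : realType} (Gam : wgraph R).

Definition is_filtration d (Om : measurableType d)
    (F : R -> set_system Om) : Prop :=
  [/\ forall t, 0 <= t -> sigma_algebra setT (F t),
      forall t, 0 <= t -> F t `<=` measurable
    & forall s t, 0 <= s -> s <= t -> F s `<=` F t].

(* Continuous time simple random walk with respect to a filtration, started at
   y: an adapted process with cadlag paths for the discrete topology, which is
   Markov relative to F, i.e. P(Y_{s+t} = w | F_s) = p_t(Y_s, w); as the state
   space is countable this is expressed on the events {Y_s = z} of A in F_s. *)
Definition ctsrw d (Om : measurableType d) (P : probability Om R)
    (F : R -> set_system Om) (Y : R -> Om -> Gam) (y : Gam) : Prop :=
  [/\ forall om, Y 0 om = y,
      forall t (B : set Gam), 0 <= t -> F t (Y t @^-1` B),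
      forall om t, 0 <= t -> \forall s \near t^'+, Y s om = Y t om,
      forall om t, 0 < t -> exists z, \forall s \near t^'-, Y s om = z
    & forall s t (A : set Om) (z w : Gam), 0 <= s -> 0 <= t -> F s A ->
        P (A `&` Y s @^-1` [set z] `&` Y (s + t) @^-1` [set w]) =
        (P (A `&` Y s @^-1` [set z]) * (heat t z w)%:E)%E].

(* The value is +oo if the event never happens; for right-continuous paths in
   a discrete space the infimum is otherwise attained. *)
Definition first_time Om (E : R -> set Om) (om : Om) : \bar R :=
  ereal_inf [set t%:E | t in [set t | 0 <= t /\ E t om]].

Definition coupling_time Om (Y1 Y2 : R -> Om -> Gam) : Om -> \bar R :=
  first_time (fun t => [set om | Y1 t om = Y2 t om]).

Definition exit_time Om (Y1 Y2 : R -> Om -> Gam) (B : set Gam) : Om -> \bar R :=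
  first_time (fun t => [set om | ~ B (Y1 t om) \/ ~ B (Y2 t om)]).

Definition uniform_coupling (K : R) : Prop :=
  exists2 p1 : R, 0 < p1 &
  forall (x0 : Gam) (r : R), 1 <= r ->
  forall y1 y2, gball x0 r y1 -> gball x0 r y2 ->
  exists (d : measure_display) (Om : measurableType d) (P : probability Om R)
    (F : R -> set_system Om) (Y1 Y2 : R -> Om -> Gam),
    [/\ is_filtration F, ctsrw P F Y1 y1, ctsrw P F Y2 y2
      & (p1%:E < P [set om | coupling_time Y1 Y2 om <
                             exit_time Y1 Y2 (gball x0 (K * r)) om])%E].

Definition oscillation_inequality (K : R) : Prop :=
  exists2 rho : R, rho < 1 &
  forall (x : Gam) (r : R), 1 <= r ->
  forall h : Gam -> R, harmonic_on h (gball x (K * r)) ->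
    osc h (gball x r) <= rho * osc h (gclosure (gball x (K * r))).

Definition elliptic_harnack : Prop :=
  exists2 C1 : R, 0 < C1 &
  forall (x : Gam) (r : R), 1 <= r ->
  forall h : Gam -> R, (forall y, 0 <= h y) ->
    harmonic_on h (gball x (2 * r)) ->
    sup (h @` gball x r) <= C1 * inf (h @` gball x r).

End RandomWalk.

Section Lamplighter.

(* Finitely supported elements of {0,1}^Z. *)
Definition lamps : choiceType := {fsfun int -> bool for fun=> false}.

Definition set_lamp (n : int) (k : bool) (xi : lamps) : lamps :=
  [fsfun xi with n |-> k].

(* Switch, then walk: the lamp at the current site is set, then the lamplighter
   moves.  This relation is oriented: after the step from (n, xi) to
   (n + 1, set_lamp n k xi), a step back to n cannot modify the lamp at n. *)
Definition lamp_nbrs (x : int * lamps) : seq (int * lamps) :=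
  [seq (x.1 + e, set_lamp x.1 k x.2) | e <- [:: 1; -1], k <- [:: false; true]].

Definition lamp_adj : rel (int * lamps)%type := fun x y => y \in lamp_nbrs x.

Definition natural_weight (R : realType) (V : choiceType) (e : rel V) :
  V -> V -> R := fun x y => (e x y)%:R.

Lemma natural_weight_ge0 (R : realType) (V : choiceType) (e : rel V) x y :
  0 <= natural_weight R e x y.
Proof. exact: ler0n. Qed.

Lemma natural_weight_gt0 (R : realType) (V : choiceType) (e : rel V) x y :
  (0 < natural_weight R e x y) = e x y.
Proof. by rewrite /natural_weight ltr0n lt0b. Qed.

Lemma lamp_adj_finite x : finite_set [set y | lamp_adj x y].
Proof. exact: finite_seq. Qed.

Let reach x y := exists p, path lamp_adj x p /\ last x p = y.

Let reach_refl x : reach x x.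
Proof. by exists [::]. Qed.

Let reach_trans y x z : reach x y -> reach y z -> reach x z.
Proof.
move=> [p [xp <-]] [q [yq <-]]; exists (p ++ q).
by rewrite cat_path xp yq last_cat.
Qed.

Let reach_step n xi e k : e \in [:: 1; -1] ->
  reach (n, xi) (n + e, set_lamp n k xi).
Proof.
move=> he; exists [:: (n + e, set_lamp n k xi)]; split=> //=; rewrite andbT.
by apply/allpairsP; exists (e, k); split=> //; case: k.
Qed.

Let set_lamp_id n (xi : lamps) : set_lamp n (xi n) xi = xi.
Proof. by apply/fsfunP => i; rewrite fsfun_withE; case: eqP => [->|]. Qed.

Let reach_move n (m : int) xi : reach (n, xi) (m, xi).
Proof.
rewrite -(subrK n m) addrC; elim/int_rec: (m - n) => [|k IH|k IH].
- by rewrite addr0; exact: reach_refl.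
- apply: (reach_trans IH); rewrite intS [1 + _]addrC addrA.
  by have := @reach_step (n + k) xi 1 (xi (n + k)); rewrite set_lamp_id; apply.
- apply: (reach_trans IH); rewrite intS opprD [-1 + _]addrC addrA.
  have := @reach_step (n - k%:Z) xi (-1) (xi (n - k%:Z)).
  by rewrite set_lamp_id; apply.
Qed.

Let reach_lamps (s : seq int) n (m : int) (xi eta : lamps) :
  (forall i, i \notin s -> xi i = eta i) -> reach (n, xi) (m, eta).
Proof.
elim: s n xi => [|j s IH] n xi h.
  have -> : eta = xi by apply/fsfunP => i; rewrite h.
  exact: reach_move.
apply: reach_trans (reach_move n j xi) _.
apply: (reach_trans (@reach_step j xi 1 (eta j) (mem_head _ _))).
apply: IH => i his; rewrite fsfun_withE; case: eqP => [->//|/eqP ij].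
by apply: h; rewrite inE negb_or ij.
Qed.

Lemma lamp_adj_connected x y : exists n,
  `[< exists p, [/\ path lamp_adj x p, last x p = y & size p = n] >].
Proof.
have [p [xp pl]] : reach x y.
  case: x y => [n xi] [m eta].
  apply: (@reach_lamps (enum_fset (finsupp xi) ++ enum_fset (finsupp eta))).
  by move=> i; rewrite mem_cat negb_or => /andP[h1 h2]; rewrite !fsfun_dflt.
by exists (size p); apply/asboolP; exists p.
Qed.

Definition lamplighter (R : realType) : wgraph R :=
  @WGraph R (int * lamps)%type lamp_adj (natural_weight R lamp_adj)
    (@natural_weight_ge0 R _ lamp_adj) (@natural_weight_gt0 R _ lamp_adj)
    lamp_adj_finite lamp_adj_connected.

End Lamplighter.

(* Main.v *)
(* (a) Two lamplighters move independently until their positions agree, and from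
   then on make the same moves and give the same state to the lamps which they
   visit; they meet as soon as they have swept all the lamps at which they
   differ.  Started in a ball of radius r, this happens before either position
   is further than (1 + 2 e) r from the centre, e > 0 small, with a probability
   bounded below, and all the vertices reached meanwhile are within distance
   4 (1 + 2 e) r <= K r.  The probability is estimated by comparison with
   explicit subharmonic functions of the two positions.  All the walks live on
   the space of fair coin sequences: one half of the coins gives an exponential
   waiting time of rate 2, the next three coins a mark, and the rest is recycled.
   (b) Crossing a block of l lamps leaves all of them off with probability 2^-l.
   So, with N = t + l, there are harmonic functions which are, up to bounded
   errors, the positive parts of t + n and of t - n when the block [- N, - t),
   respectively (t, N], is off, and 0 otherwise.  For |n| <= t, their difference
   minus n is n if neither block has been altered, - n if both have, and t or - t
   if only one has.
   A value larger than t in modulus requires that |n| > t and that the block on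
   the other side has been altered, that is, a path of length about 3 t from the
   origin; but the values t and - t are nearly attained at distance N from the
   origin, and l is negligible with respect to t. *)
From HB Require Import structures.
Require Import Defs.
From mathcomp Require Import all_boot all_order all_algebra finmap.
From mathcomp Require Import all_classical all_reals all_analysis.
From mathcomp Require Import measurable_realfun lra zify ring.
Import Order.TTheory GRing.Theory Num.Theory.
Import numFieldNormedType.Exports.
Set Implicit Arguments.
Unset Strict Implicit.
Unset Printing Implicit Defensive.
Local Open Scope classical_set_scope.
Local Open Scope ring_scope.

(** The analytic difficulty of (a) is that [ctsrw] refers to [heat], a power series in [lap] whose
    non-negativity is not evident, while the walks are built from coins. Probabilities and [heat]
    are identified through the equation obtained by conditioning on the first jump, which both
    satisfy: inserting a bound on their difference into this equation multiplies it by [q], the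
    probability of a jump before the horizon. As [q < 1], the difference is 0. Non-explosion and the
    Markov property follow the same pattern. One clock of rate 2 drives both walkers, and each of
    them moves at half of its ticks, so that the averaging operator of either one is [1 + lap / 2].
    The comparison functions of (a) are built from squares rather than linear functions: their
    averages grow by at least a fixed positive amount at each step, so that finitely many steps
    settle the comparison, in place of optional stopping. There are three of them, one for each
    stage (meeting, sweep to the right, sweep to the left), and each stage is scaled by the worst
    value of the next one. *)

Section Laplacian.
Variable R : realType.
Implicit Types (h : lamplighter R -> R) (x y : int * lamps).

Lemma set_lampE (n : int) k (xi : lamps) i :
  set_lamp n k xi i = if i == n then k else xi i.
Proof. by rewrite fsfun_withE. Qed.

Lemma set_lamp_inj (n : int) (xi : lamps) : injective (set_lamp n ^~ xi).
Proof.
move=> k k' /(congr1 (fun f : lamps => f n)).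
by rewrite !set_lampE eqxx.
Qed.

Lemma uniq_lamp_nbrs x : uniq (lamp_nbrs x).
Proof.
rewrite /lamp_nbrs /= !inE !xpair_eqE !eqxx !(inj_eq (@set_lamp_inj _ _)) /=.
by rewrite !(inj_eq (addrI _)).
Qed.

Lemma muE x : mu (Gam := lamplighter R) x = 4.
Proof.
rewrite /mu (@fsbigE _ _ _ _ _ (lamp_nbrs x)) ?uniq_lamp_nbrs//.
- rewrite big_mkcond/= big_seq (eq_bigr (fun=> 1)); last first.
    by move=> y yx; rewrite in_setT /= /natural_weight /lamp_adj yx.
  by rewrite -big_seq /lamp_nbrs /= !big_cons big_nil; lra.
- by move=> y _ /negbTE yx; rewrite /= /natural_weight /lamp_adj yx.
Qed.

Lemma lapE h x : lap h x =
  4^-1 * (h (x.1 + 1, set_lamp x.1 false x.2) + h (x.1 + 1, set_lamp x.1 true x.2)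
        + h (x.1 - 1, set_lamp x.1 false x.2) + h (x.1 - 1, set_lamp x.1 true x.2))
  - h x.
Proof.
rewrite /lap muE (@fsbigE _ _ _ _ _ (lamp_nbrs x)) ?uniq_lamp_nbrs//.
- rewrite big_mkcond/= big_seq (eq_bigr (fun y => h y - h x)); last first.
    by move=> y yx; rewrite in_setT /= /natural_weight /lamp_adj yx mul1r.
  by rewrite -big_seq /lamp_nbrs /= !big_cons big_nil; lra.
- by move=> y _ /negbTE yx; rewrite /= /natural_weight /lamp_adj yx mul0r.
Qed.


Lemma lap0P h x :
  (h (x.1 + 1, set_lamp x.1 false x.2) + h (x.1 + 1, set_lamp x.1 true x.2)
   + h (x.1 - 1, set_lamp x.1 false x.2) + h (x.1 - 1, set_lamp x.1 true x.2)
   = 4 * h x) -> lap h x = 0.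
Proof. by move=> hx; rewrite lapE hx; lra. Qed.

End Laplacian.

(** * Harmonic functions detecting altered blocks of lamps *)

Section Barrier.
Variable R : realType.
Implicit Types (x : int * lamps) (xi : lamps) (s a : int).

(** The sign [s] reflects the line, so that one construction serves the block on the left of the
    origin and its mirror image. *)
Fixpoint block_off s a (j : nat) xi : bool :=
  if j is j'.+1 then block_off s a j' xi && ~~ xi (s * (a + j'%:Z)) else true.

Definition pospart (m : int) : R := (Num.max m 0)%:~R.

(* For [s = 1], and up to bounded errors and a factor [2 ^- j] on the left, this is
   the positive part of [n - a] if the lamps of [a, a + j) are off, and 0
   otherwise.  Each signed summand is harmonic because it vanishes at the site of
   its lamp and changes sign with it. *)
Fixpoint barrier s a (j : nat) x : R :=
  if j is j'.+1 then
    2^-1 * (barrier s a j' x + pospart (s * x.1 - (a + j'%:Z))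
      * (-1) ^+ x.2 (s * (a + j'%:Z)) * (block_off s a j' x.2)%:R)
  else (s * x.1 - a)%:~R.

Lemma block_off_set_lamp s a j n k xi : (s = 1 \/ s = -1) ->
  a + j%:Z <= s * n -> block_off s a j (set_lamp n k xi) = block_off s a j xi.
Proof.
move=> s1; elim: j => //= j IH jn; rewrite IH; last by lia.
rewrite set_lampE; case: eqP => // sn; exfalso.
by case: s1 => s1; rewrite s1 in jn sn; lia.
Qed.

Lemma pospart_ge0 m : 0 <= m -> pospart m = m%:~R.
Proof. by move=> m0; rewrite /pospart; congr (_%:~R); lia. Qed.

Lemma pospart_le0 m : m <= 0 -> pospart m = 0.
Proof.
move=> m0; rewrite /pospart (_ : Num.max m 0 = 0) //; lia.
Qed.

Lemma barrier_harmonic s a j x : (s = 1 \/ s = -1) ->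
  barrier s a j (x.1 + 1, set_lamp x.1 false x.2) +
  barrier s a j (x.1 + 1, set_lamp x.1 true x.2) +
  barrier s a j (x.1 - 1, set_lamp x.1 false x.2) +
  barrier s a j (x.1 - 1, set_lamp x.1 true x.2) = 4 * barrier s a j x.
Proof.
move=> s1; case: x => n xi /=; elim: j => [|j IH] /=.
  rewrite !mulrDr !rmorphB !rmorphD/= mulrN1 mulr1 rmorphN/=; lra.
(* In the direction of [s]: before the new lamp, the added summand is zero at the site and at its
   neighbours. Beyond it, neither the block nor the new lamp can be touched and the positive part is
   linear. At its site, the two states of the lamp contribute opposite signs, which cancel. *)
have [lt|gt|eq] := ltgtP (s * n) (a + j%:Z).
- rewrite !pospart_le0 ?mul0r; try by case: s1 => s1; rewrite s1 in lt *; lia.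
  lra.
- rewrite !block_off_set_lamp//; try by lia.
  rewrite !set_lampE; case: eqP => sn.
    by exfalso; case: s1 => s1; rewrite s1 in gt sn; lia.
  rewrite !pospart_ge0; try by case: s1 => s1; rewrite s1 in gt *; lia.
  rewrite !mulrDr !rmorphB !rmorphD/= mulrN1 mulr1 rmorphN/=.
  move: IH; move: (barrier s a j (n + 1, set_lamp n false xi))
    (barrier s a j (n + 1, set_lamp n true xi))
    (barrier s a j (n - 1, set_lamp n false xi))
    (barrier s a j (n - 1, set_lamp n true xi)) (barrier s a j (n, xi))
    => b1 b2 b3 b4 b IH.
  move: ((block_off s a j xi)%:R : R) => o.
  move: ((-1) ^+ _ : R) ((s * n)%:~R : R) (s%:~R : R) (a%:~R : R) (j%:~R : R).
  move=> e u v w t; lra.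
- rewrite !set_lampE -eq (_ : s * (s * n) = n); last first.
    by rewrite mulrA (_ : s * s = 1) ?mul1r//; case: s1 => ->.
  rewrite eqxx subrr (pospart_le0 (lexx 0)) !mul0r addr0.
  rewrite !block_off_set_lamp ?eq//.
  move: IH; move: (barrier s a j (n + 1, set_lamp n false xi))
    (barrier s a j (n + 1, set_lamp n true xi))
    (barrier s a j (n - 1, set_lamp n false xi))
    (barrier s a j (n - 1, set_lamp n true xi)) (barrier s a j (n, xi))
    => b1 b2 b3 b4 b IH.
  move: ((block_off s a j xi)%:R : R) => o.
  rewrite /= expr0 expr1 !mulrDr.
  move: (pospart _ : R) (pospart _ : R) => p q; lra.
Qed.

(** Each further lamp halves the error, since its summand either doubles the main term or cancels
    it, and moving the kink by one site costs at most 1. The constant 2 is the fixed point of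
    [c |-> c / 2 + 1], and the initial error is the negative part of [s * x.1 - a]. *)
Lemma barrier_approx s a j x :
  `|barrier s a j x - (block_off s a j x.2)%:R * pospart (s * x.1 - (a + j%:Z))|
  <= 2^-1 ^+ j * `|(s * x.1 - a)%:~R| + 2.
Proof.
elim: j => [|j IH] /=.
  rewrite addr0 expr0 !mul1r; set m := s * _ - a.
  have [m0|m0] := leP 0 m.
    by rewrite pospart_ge0// subrr normr0 addr_ge0.
  rewrite pospart_le0 1?ltW// subr0; lra.
set u := 2^-1 ^+ j * _ in IH *.
have -> : 2^-1 ^+ j.+1 * `|(s * x.1 - a)%:~R| = 2^-1 * u by rewrite exprS mulrA.
set p := pospart (s * x.1 - (a + j%:Z)) in IH *.
have [q [q0 q1 ->]] : exists q, [/\ 0 <= q, q <= 1 &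
    pospart (s * x.1 - (a + j.+1%:Z)) = p - q].
  exists (p - pospart (s * x.1 - (a + j.+1%:Z))).
  rewrite /p; set m := s * x.1 - _.
  have -> : s * x.1 - (a + j.+1%:Z) = m - 1 by lia.
  have [m0|m0] := leP 1 m.
    by rewrite !pospart_ge0 ?rmorphB/=; [split; lra|lia|lia].
  rewrite !pospart_le0; [split; lra|lia|lia].
set B := barrier s a j x in IH *.
case: (block_off _ _ _ _) IH; case: (x.2 _) => /=;
  rewrite !ler_norml ?expr0 ?expr1 => /andP[H1 H2]; apply/andP; split; lra.
Qed.

End Barrier.

(** * Distances in the lamplighter graph *)

Section Distance.
Variable R : realType.

Lemma gdistP (Gam : wgraph R) (x y : Gam) :
  exists p, [/\ path (@adj R Gam) x p, last x p = y & size p = gdist x y].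
Proof.
by rewrite /gdist; case: ex_minnP => m /asboolP.
Qed.

Lemma gdist_le (Gam : wgraph R) (x : Gam) p :
  path (@adj R Gam) x p -> (gdist x (last x p) <= size p)%N.
Proof.
move=> xp; rewrite /gdist; case: ex_minnP => m _; apply.
by apply/asboolP; exists p.
Qed.

Lemma gclosure_ball_gdist (Gam : wgraph R) (x y : Gam) r :
  gclosure (gball x r) y -> (gdist x y)%:R <= r + 1.
Proof.
case=> [yr|[_ [z zr zy]]]; first by rewrite /gball/= in yr; lra.
have [p [xp pz sp]] := gdistP x z; have [q [zq qy sq]] := gdistP z y.
have := @gdist_le Gam x (p ++ q).
rewrite cat_path xp pz zq last_cat pz qy => /(_ isT).
rewrite size_cat sp sq zy -(ler_nat R) natrD /gball/= in zr *; lra.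
Qed.

Lemma gclosure_adj (Gam : wgraph R) (A : set Gam) x y :
  A x -> adj x y -> gclosure A y.
Proof.
move=> Ax xy; have [Ay|nAy] := pselect (A y); [by left|right; split=> //].
exists x => //; have := @gdist_le Gam x [:: y]; rewrite /= xy => /(_ isT).
have [[|z p] [//= _ + <-]] := gdistP x y; first by move=> xy'; rewrite xy' in Ax.
by case: (size p).
Qed.

(** An altered lamp at [i] has been visited, so the length is at least [|i - x.1| + |i - y.1|]; the
    inequalities together express this. The last one is strict because a lamp is switched by a step
    that leaves its site. *)
Lemma lamp_path_invariant (x : int * lamps) p : path lamp_adj x p ->
  let y := last x p in
  (`|y.1 - x.1| <= (size p)%:Z) /\
  forall i, y.2 i <> x.2 i ->
    [/\ x.1 + y.1 - 2 * i <= (size p)%:Z, 2 * i - x.1 - y.1 <= (size p)%:Z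
      & `|i - x.1| < (size p)%:Z].
Proof.
elim/last_ind: p => [|p z IH]; first by split=> //=; rewrite subrr.
rewrite rcons_path last_rcons size_rcons => /andP[/IH].
move: (last x p) => [n eta] {IH} /= [nx H] zadj.
have [k [e [e1 ->]]] : exists k e, (e = 1 \/ e = -1) /\
    z = (n + e, set_lamp n k eta).
  move: zadj; rewrite /lamp_adj /lamp_nbrs /= !inE => /or4P[]/eqP->;
    [exists false, 1|exists true, 1|exists false, (-1)|exists true, (-1)];
    by split; auto.
split=> /= [|i]; first by lia.
by rewrite set_lampE; case: eqP => [->_|_ /H[]]; split; lia.
Qed.

Lemma lamp_adj_step n xi e k : e = 1 \/ e = -1 ->
  lamp_adj (n, xi) (n + e, set_lamp n k xi).
Proof.
move=> e1; apply/allpairsP; exists (e, k).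
by split=> //=; rewrite !inE; [case: e1 => ->|case: k].
Qed.

(** The building block of all upper bounds on distances. The lamp at the final site keeps its state,
    since only the sites that are left are set to [eta]. *)
Lemma lamp_walk (e : int) (k : nat) n xi (eta : lamps) : e = 1 \/ e = -1 ->
  exists p xi', [/\ path lamp_adj (n, xi) p, last (n, xi) p = (n + e * k%:Z, xi'),
    size p = k & forall i,
      xi' i = if 0 <= e * (i - n) < k%:Z then eta i else xi i].
Proof.
move=> e1; elim: k => [|k [p [xi' [xp lp sp H]]]].
  exists [::], xi; split=> //=; first by rewrite mulr0 addr0.
  by move=> i; case: ifP => //; lia.
pose m := n + e * k%:Z.
exists (rcons p (m + e, set_lamp m (eta m) xi')), (set_lamp m (eta m) xi').
rewrite rcons_path last_rcons size_rcons xp lp sp; split=> //.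
- exact: lamp_adj_step.
- by congr pair; rewrite /m; case: e1 => ->; lia.
move=> i; rewrite set_lampE H /m.
case: eqP => [->|im]; first by rewrite ifT//; case: e1 => ->; lia.
case: ifP => h1; case: ifP => h2 //; case: e1 => e1; rewrite e1 in im h1 h2; lia.
Qed.

End Distance.

(** * Failure of the oscillation and Harnack inequalities *)

Section SeparatingHarmonic.
Variable R : realType.
Local Notation G := (lamplighter R).

Definition lamps_off : lamps := [fsfun].
Definition lamp_origin : int * lamps := (0, lamps_off).

Lemma lamps_offE i : lamps_off i = false.
Proof. by rewrite fsfun0E. Qed.

Lemma block_off_lamps_off s a j : block_off s a j lamps_off.
Proof. by elim: j => //= j ->; rewrite lamps_offE. Qed.

Lemma block_offPn s a j xi : ~~ block_off s a j xi ->
  exists2 i : nat, (i < j)%N & xi (s * (a + i%:Z)).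
Proof.
elim: j => //= j IH; rewrite negb_and negbK => /orP[/IH[i ij]|]; last by exists j.
by exists i => //; exact: ltnW.
Qed.

(* On the right of the block around [-N] the first barrier is close to
   [n + t] if that block is off and to [0] otherwise, and symmetrically for
   the second one; so [separator] is close to [n], [t], [-t] or [- n]
   according to which of the two blocks have been altered. *)
Definition separator (N l : nat) (x : int * lamps) : R :=
  barrier R 1 (- N%:Z) l x - barrier R (-1) (- N%:Z) l x - x.1%:~R.

Lemma separator_harmonic N l x : lap (Gam := G) (separator N l) x = 0.
Proof.
apply: lap0P; rewrite /separator /=.
have := barrier_harmonic R (- N%:Z) l x (or_introl (erefl 1)).
have := barrier_harmonic R (- N%:Z) l x (or_intror (erefl (-1))).
rewrite rmorphB rmorphD /=; case: x => n xi /=.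
set u := n%:~R; lra.
Qed.

Lemma separator_approx (t l : nat) D x :
  2^-1 ^+ l * (`|x.1|%:~R + (t + l)%:R) <= D ->
  `|separator (t + l) l x -
    ((block_off 1 (- (t + l)%:Z) l x.2)%:R * pospart R (x.1 + t%:Z) -
     (block_off (-1) (- (t + l)%:Z) l x.2)%:R * pospart R (t%:Z - x.1) -
     x.1%:~R)| <= 2 * (D + 2).
Proof.
move=> hD; rewrite /separator.
have H1 := barrier_approx R 1 (- (t + l)%:Z) l x.
have H2 := barrier_approx R (-1) (- (t + l)%:Z) l x.
rewrite (_ : 1 * x.1 - (- (t + l)%:Z + l%:Z) = x.1 + t%:Z) in H1; last by lia.
rewrite (_ : -1 * x.1 - (- (t + l)%:Z + l%:Z) = t%:Z - x.1) in H2; last by lia.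
have hle s : (s = 1 \/ s = -1) ->
    2^-1 ^+ l * `|(s * x.1 - - (t + l)%:Z)%:~R| <= D.
  move=> s1; apply: le_trans hD; rewrite ler_wpM2l ?exprn_ge0//.
  rewrite -intr_norm [(t + l)%:R]pmulrn -intrD ler_int; lia.
have {H1} := le_trans H1 (lerD (hle 1 (or_introl erefl)) (lexx 2)).
have {H2} := le_trans H2 (lerD (hle (-1) (or_intror erefl)) (lexx 2)).
move: (barrier R 1 _ _ _) (barrier R (-1) _ _ _) (_ * pospart _ _)
  (_ * pospart _ _) (x.1%:~R : R) => u v w z n.
rewrite !ler_norml => /andP[? ?] /andP[? ?]; apply/andP; split; lra.
Qed.

Lemma separator_bound (t l : nat) D p : path lamp_adj lamp_origin p ->
  let x := last lamp_origin p in
  (size p < 3 * t + 3)%N ->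
  2^-1 ^+ l * (`|x.1|%:~R + (t + l)%:R) <= D ->
  `|separator (t + l) l x| <= t%:R + 2 * (D + 2).
Proof.
move=> /lamp_path_invariant /= []; move: (last _ _) (size p) => x k.
rewrite subr0 => xk alt kt hD.
(* An altered lamp of this block lies at [- t - 1] or further left. Walking there from 0 and then
   beyond [t] takes at least [(t + 1) + (2 * t + 2)] steps, whence the bound [3 * t + 3]. *)
have off1 : t%:Z < x.1 -> block_off 1 (- (t + l)%:Z) l x.2.
  move=> tx; apply/negPn/negP => /block_offPn[i il xi].
  have [|] := alt (1 * (- (t + l)%:Z + i%:Z)); first by rewrite xi lamps_offE.
  by lia.
have off2 : x.1 < - t%:Z -> block_off (-1) (- (t + l)%:Z) l x.2.
  move=> tx; apply/negPn/negP => /block_offPn[i il xi].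
  have [|] := alt (-1 * (- (t + l)%:Z + i%:Z)); first by rewrite xi lamps_offE.
  by lia.
have := separator_approx hD.
move: (block_off 1 _ _ _) (block_off (-1) _ _ _) off1 off2 => b1 b2 off1 off2.
suff : `|b1%:R * pospart R (x.1 + t%:Z) - b2%:R * pospart R (t%:Z - x.1) -
         x.1%:~R| <= t%:R.
  move: (_ - _ - x.1%:~R) (separator _ _ _) => u v.
  rewrite !ler_norml => /andP[? ?] /andP[? ?]; apply/andP; split; lra.
have [tx|xt] := ltP t%:Z x.1.
  rewrite off1// mul1r pospart_ge0; last by lia.
  rewrite pospart_le0; last by lia.
  by rewrite mulr0 subr0 -intrB (_ : x.1 + t%:Z - x.1 = t%:Z)
    -?pmulrn ?ger0_norm//; lia.
have [tx|xt'] := ltP x.1 (- t%:Z).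
  rewrite off2// mul1r (pospart_ge0 _ (_ : 0 <= t%:Z - x.1)); last by lia.
  rewrite pospart_le0; last by lia.
  rewrite mulr0 sub0r -intrN -intrB (_ : - (t%:Z - x.1) - x.1 = - t%:Z).
    by rewrite intrN normrN -?pmulrn ?ger0_norm.
  by lia.
rewrite !pospart_ge0; try by lia.
have : x.1%:~R <= t%:R :> R by rewrite [t%:R]pmulrn ler_int.
have : - t%:R <= x.1%:~R :> R by rewrite [t%:R]pmulrn -intrN ler_int.
rewrite ler_norml intrD intrB -!pmulrn; move: (x.1%:~R) (t%:R) => u v ? ?.
by case: b1 {off1}; case: b2 {off2} => /=; lra.
Qed.

Lemma separator_far (t l : nat) D (e : int) : e = 1 \/ e = -1 ->
  2^-1 ^+ l * ((t + l)%:R + (t + l)%:R) <= D ->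
  t%:R - 2 * (D + 2) <= e%:~R * separator (t + l) l (e * (t + l)%:Z, lamps_off).
Proof.
move=> e1 hD; set n := e * _.
have := @separator_approx t l D (n, lamps_off).
rewrite /= !block_off_lamps_off !mul1r => H.
have {}H := H _.
rewrite (_ : `|n| = (t + l)%:Z) in H; last by case: e1 => e1; rewrite /n e1; lia.
move/(_ hD) : H; move: (separator _ _ _) => u.
case: e1 => e1; rewrite /n e1 ?mul1r ?mulN1r ?(intrN, mulr1z) ?mulN1r ?mul1r.
  rewrite pospart_ge0; last by lia.
  rewrite pospart_le0; last by lia.
  by rewrite intrD -!pmulrn natrD ler_norml => /andP[? ?]; lra.
rewrite pospart_le0; last by lia.
rewrite pospart_ge0; last by lia.
by rewrite intrB intrN -!pmulrn natrD ler_norml => /andP[? ?]; lra.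
Qed.

(** Since [C] does not depend on [M], the oscillations of [h] on the small ball and on the closure
    of the large one are both [2 m] up to a bounded error, with [m] as large as desired. *)
Lemma separating_harmonic (K : R) : 1 <= K -> K < 3 ->
  exists C : R, forall M : R, exists m r h,
  [/\ M <= m, 1 <= r, forall x : G, lap h x = 0,
      forall x : G, gclosure (gball (lamp_origin : G) (K * r)) x ->
        `|h x| <= m + C
    & exists y1 y2 : G, [/\ gball (lamp_origin : G) r y1,
        gball (lamp_origin : G) r y2, m - C <= h y1 & h y2 <= C - m]].
Proof.
move=> K1 K3.
(* With [t = (c - 1) * l] and [t + l = c * l], the closure of the large ball has radius at most
   [K * c * l + 1], and [3 <= (3 - K) * c] puts this below [3 * t + 3]. *)
pose c := (Num.truncn (3 / (3 - K))).+2.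
have hc : 3 <= (3 - K) * c%:R.
  rewrite mulrC -ler_pdivrMr ?subr_gt0//; apply: ltW.
  by apply: lt_le_trans (truncnS_gt _) _; rewrite ler_nat.
(* The approximation error is [2 ^- l] times a length of at most [4 * c * l + 1]. As
   [2 ^- l * l <= 1], it stays below [D] for every [l]. *)
pose D : R := 4 * c%:R + 1; exists (2 * (D + 2)) => M.
pose l := (Num.truncn M).+1; pose t := (c.-1 * l)%N.
have tl : (t + l = c * l)%N by rewrite /t /c /=; lia.
have ltl : (l <= t)%N by rewrite /t /c /=; lia.
have l2 : 2^-1 ^+ l * l%:R <= 1 :> R.
  rewrite exprVn mulrC ler_pdivrMr ?exprn_gt0// mul1r -natrX ler_nat.
  exact/ltnW/ltn_expl.
have l2' : 2^-1 ^+ l <= 1 :> R by rewrite exprn_ile1 //; lra.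
have l20 : 0 <= 2^-1 ^+ l :> R by rewrite exprn_ge0.
have tlc : (t + l)%:R = c%:R * l%:R :> R by rewrite tl natrM.
have hD (n : int) : (`|n| <= 3 * (t + l)%:Z + 1) ->
    2^-1 ^+ l * (`|n|%:~R + (t + l)%:R) <= D.
  move=> hn; apply: (@le_trans _ _ (2^-1 ^+ l * (4 * (c%:R * l%:R) + 1))).
    rewrite ler_wpM2l// -tlc; apply: (@le_trans _ _ ((3 * (t + l)%:Z + 1)%:~R + (t + l)%:R)).
      by rewrite lerD2r ler_int.
    by rewrite intrD intrM -pmulrn; lra.
  rewrite /D; have c0 : 0 <= c%:R :> R by [].
  move: (2^-1 ^+ l) (l%:R : R) (c%:R : R) l2 l2' c0 => a b d ? ? ?; nra.
have l0 : 1 <= l%:R :> R by rewrite ler1n.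
have c1 : 1 <= c%:R :> R by rewrite ler1n.
exists t%:R, (t + l)%:R, (separator (t + l) l); split.
- apply: ltW; apply: lt_le_trans (truncnS_gt M) _; rewrite ler_nat; exact: ltl.
- by rewrite ler1n; lia.
- by move=> x; exact: separator_harmonic.
- move=> x /gclosure_ball_gdist; have [p [xp xl <-]] := gdistP (lamp_origin : G) x.
  move=> hp; rewrite -xl; apply: separator_bound => //.
    rewrite -(ltr_nat R) natrD natrM.
    have -> : t%:R = c%:R * l%:R - l%:R :> R by rewrite -tlc natrD; lra.
    rewrite tlc in hp; apply: le_lt_trans hp _.
    move: hc c1 l0; move: (c%:R : R) (l%:R : R) => u v ? ? ?; nra.
  apply: hD; have [+ _] := lamp_path_invariant xp.
  rewrite subr0 => /le_trans; apply.
  rewrite -(ler_int R) intrD intrM -!pmulrn; apply: le_trans hp _.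
  rewrite lerD2r ler_wpM2r//; lra.
- exists (1 * (t + l)%:Z, lamps_off), (-1 * (t + l)%:Z, lamps_off).
  have near e : e = 1 \/ e = -1 ->
      gball (lamp_origin : G) (t + l)%:R (e * (t + l)%:Z, lamps_off).
    move=> e1; have [p [xi [xp lp sp H]]] := lamp_walk (t + l) 0 lamps_off lamps_off e1.
    rewrite /gball /= ler_nat -(_ : last lamp_origin p = (e * (t + l)%:Z, lamps_off)).
      by rewrite -sp; exact: (@gdist_le R G).
    rewrite lp add0r (_ : xi = lamps_off)//; apply/fsfunP => i.
    by rewrite H; case: ifP; rewrite lamps_offE.
  have hD' : 2^-1 ^+ l * ((t + l)%:R + (t + l)%:R) <= D.
    by have := hD (t + l)%:Z; rewrite ger0_norm// -pmulrn; apply; lia.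
  split; [exact: near (or_introl erefl)|exact: near (or_intror erefl)| |].
  - by have := separator_far (or_introl erefl) hD'; rewrite mulr1z mul1r.
  - by have := separator_far (or_intror erefl) hD'; rewrite mulrN1z mulN1r; lra.
Qed.

Lemma le_osc (A : set G) (h : G -> R) a b x y : (forall z, A z -> a <= h z <= b) ->
  A x -> A y -> h x - h y <= osc h A.
Proof.
move=> hA Ax Ay; rewrite /osc lerB//.
  apply: ub_le_sup; last by exists x.
  by exists b => _ [z /hA/andP[_ ?] <-].
apply: ge_inf; last by exists y.
by exists a => _ [z /hA/andP[? _] <-].
Qed.

Lemma osc_le (A : set G) (h : G -> R) a b x : (forall z, A z -> a <= h z <= b) ->
  A x -> osc h A <= b - a.
Proof.
move=> hA Ax; rewrite /osc lerB//.
  apply: ge_sup; first by exists (h x), x.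
  by move=> _ [z /hA/andP[_ ?] <-].
apply: lb_le_inf; first by exists (h x), x.
by move=> _ [z /hA/andP[? _] <-].
Qed.

Lemma gball_sub_closure (x : G) (r s : R) : r <= s ->
  gball x r `<=` gclosure (gball x s).
Proof. by move=> rs y xy; left; exact: le_trans rs. Qed.

Lemma not_oscillation_inequality (K : R) : 1 < K -> K < 3 ->
  ~ oscillation_inequality G K.
Proof.
move=> K1 K3 [rho rho1 H].
have [C HC] := separating_harmonic (ltW K1) K3.
(* The inequality would give [2 (m - C) <= rho * 2 (m + C)], hence a bound on [m (1 - rho)] by twice
   the modulus of [C], which the second entry of the maximum excludes. The first entry makes the
   oscillation positive, so that [rho] cannot be negative. *)
have [m [r [h [Mm r1 hh hb [y1 [y2 [By1 By2 hy1 hy2]]]]]]] :=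
  HC (Num.max (`|C| + 1) (2 * `|C| / (1 - rho) + 1)).
have {H} := H _ r r1 h (fun x _ => hh x).
move: Mm; rewrite ge_max => /andP[mC mrho] /(_ lamp_origin).
have hb' z : gclosure (gball (lamp_origin : G) (K * r)) z ->
    - (m + C) <= h z <= m + C.
  by move=> /hb; rewrite ler_norml.
have rKr : r <= K * r by rewrite ler_peMl//; lra.
have := osc_le hb' (gball_sub_closure rKr By1).
have := le_osc (fun z Bz => hb' z (gball_sub_closure rKr Bz)) By1 By2.
have := le_osc hb' (gball_sub_closure rKr By1) (gball_sub_closure rKr By2).
move: (osc _ _) (osc _ _) => u v Hv Hu vle uv.
have C0 := ler_norm C; have C0' := normr_ge0 C.
have rho0 : 0 < 1 - rho by rewrite subr_gt0.
have : 2 * `|C| / (1 - rho) < m by lra.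
rewrite ltr_pdivrMr// => mr.
have hv : 0 < v by lra.
have {}uv : 2 * (m - C) <= rho * v by lra.
have r0 : 0 <= rho.
  rewrite leNgt; apply/negP => r0; have : rho * v < 0 by rewrite nmulr_rlt0.
  lra.
have : rho * v <= rho * (2 * (m + C)) by rewrite ler_wpM2l//; lra.
nra.
Qed.

(** For [K = 2], the separating function shifted by [m + C] is non-negative on the closure of the
    large ball, and in the small one it takes a value of at least [2 m] and another of at most
    [2 C]. *)
Lemma not_elliptic_harnack : ~ elliptic_harnack G.
Proof.
move=> [C1 C10 H].
have [||C HC] := @separating_harmonic 2; [lra|lra|].
have [m [r [h [Mm r1 hh hb [y1 [y2 [By1 By2 hy1 hy2]]]]]]] :=
  HC (C1 * (2 * `|C|) + 1).
pose A := gclosure (gball (lamp_origin : G) (2 * r)).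
(* Non-negativity is demanded on the whole graph, whereas [h] is controlled on [A] only. The value 0
   outside [A] does not affect [lap g] on the ball. *)
pose g (y : G) := if `[< A y >] then h y + m + C else 0.
have gA y : A y -> g y = h y + m + C by move=> Ay; rewrite /g asboolT.
have g0 y : 0 <= g y.
  by rewrite /g; case: asboolP => // /hb; rewrite ler_norml => /andP[]; lra.
have step y e k : gball (lamp_origin : G) (2 * r) y -> e = 1 \/ e = -1 ->
    g (y.1 + e, set_lamp y.1 k y.2) = h (y.1 + e, set_lamp y.1 k y.2) + m + C.
  move=> By e1; apply: gA; apply: gclosure_adj By _.
  by case: y => n xi; exact: lamp_adj_step.
have harm_g : harmonic_on g (gball (lamp_origin : G) (2 * r)).
  move=> y By; rewrite lapE !(step y)//; try by [left|right].
  by rewrite gA; [have := hh y; rewrite lapE; lra|left].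
have r2 : r <= 2 * r by lra.
have hb' z : gball (lamp_origin : G) r z -> 0 <= g z <= 2 * (m + C).
  move=> /(gball_sub_closure r2) Az; rewrite g0 gA//.
  by have := hb z Az; rewrite ler_norml => /andP[]; lra.
have := H lamp_origin r r1 g g0 harm_g.
have : g y1 <= sup (g @` gball (lamp_origin : G) r).
  apply: ub_le_sup; last by exists y1.
  by exists (2 * (m + C)) => _ [z /hb'/andP[_ ?] <-].
have : inf (g @` gball (lamp_origin : G) r) <= g y2.
  by apply: ge_inf; [exists 0 => _ [z _ <-]|exists y2].
rewrite !gA; [|exact: (gball_sub_closure r2 By1)|exact: (gball_sub_closure r2 By2)].
move: (sup _) (inf _) => u v vle uge uv.
have C0 := ler_norm C; have C0' := normr_ge0 C.
have : C1 * v <= C1 * (2 * `|C|) by rewrite ler_wpM2l//; lra.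
have : 0 <= C1 * (2 * `|C|) by rewrite !mulr_ge0//; lra.
lra.
Qed.

End SeparatingHarmonic.

(** * Fair coins and exponential waiting times *)

Definition cylinder (s : seq bool) : set (nat -> bool) :=
  [set w | forall i, (i < size s)%N -> w i = nth false s i].

(** The empty set is included to make the family closed under intersections, as uniqueness of
    measures requires. *)
Definition cylinders : set (set (nat -> bool)) :=
  [set A | A = set0 \/ exists s, A = cylinder s].

Definition coins := g_sigma_algebraType cylinders.

Lemma cylinder_nil : cylinder [::] = setT.
Proof. by apply/seteqP; split. Qed.

Lemma cylinder_cons b s w :
  cylinder (b :: s) w <-> w 0 = b /\ cylinder s (w \o succn).
Proof.
split=> [H|[H0 H] [|i]//]; last exact: H.
by split=> [|i]; [exact: (H 0)|exact: (H i.+1)].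
Qed.

Lemma cylinders_setI : setI_closed cylinders.
Proof.
move=> A B [->|[s ->]]; first by rewrite set0I; left.
case=> [->|[t ->]]; first by rewrite setI0; left.
wlog st : s t / (size s <= size t)%N => [H|].
  by have [/H//|/ltnW/H] := leqP (size s) (size t); rewrite setIC.
have [e|ne] := pselect (forall i, (i < size s)%N -> nth false s i = nth false t i).
  right; exists t; apply/seteqP; split=> w; first by case.
  by move=> H; split=> // i si; rewrite e// H// (leq_trans si).
left; apply/seteqP; split=> // w [ws wt]; apply: ne => i si.
by rewrite -ws// -wt// (leq_trans si).
Qed.

Lemma measurable_cylinder s : measurable (cylinder s : set coins).
Proof. by apply: sub_sigma_algebra; right; exists s. Qed.

(** A countable union of cylinders: finite sequences are enumerated by decoding integers, and those
    too short or with the wrong letter contribute the empty set. *)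
Lemma measurable_coin i b : measurable [set w : coins | w i = b].
Proof.
rewrite (_ : [set _ | _] = \bigcup_n (if choice.pickle_inv n is Some s then
    if nth false s i == b then (if (i < size s)%N then cylinder s else set0) else set0
    else set0) :> set coins).
  apply: bigcupT_measurable => n; case: choice.pickle_inv => // s.
  by do 2 (case: ifP => _ //); exact: measurable_cylinder.
apply/seteqP; split=> [w <-|w [n _]].
  pose s := mkseq w i.+1; exists (choice.pickle s) => //.
  rewrite choice.pickleK_inv nth_mkseq// eqxx size_mkseq ltnSn => j.
  by rewrite size_mkseq => ji; rewrite nth_mkseq.
case: choice.pickle_inv => // s; case: eqP => // <-; case: ifP => // si; exact.
Qed.

Lemma measurable_fun_coins d (T : measurableType d) (f : T -> coins) :
  (forall i b, measurable [set x | f x i = b]) -> measurable_fun setT f.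
Proof.
move=> mf; apply: (@measurability _ _ T coins setT f cylinders) => //.
move=> _ [A [->|[s ->]] <-]; rewrite setTI ?preimage_set0//.
rewrite (_ : _ @^-1` _ = \big[setI/setT]_(i < size s) [set x | f x i = nth false s i]).
  exact: bigsetI_measurable.
by rewrite -(bigcap_mkord (size s) (fun i => [set x | f x i = nth false s i])); apply/seteqP; split=> x H i /= si; exact: H.
Qed.

Section FairCoins.
Variable R : realType.
Local Notation mu := (@lebesgue_measure R).
Local Notation unif := (uniform_prob (@ltr01 R)).

Lemma integral_unif (f : measurableTypeR R -> \bar R) : measurable_fun setT f ->
  (forall x, 0 <= f x)%E -> (\int[unif]_x f x = \int[mu]_(x in `]0%R, 1%R[) f x)%E.
Proof.
move=> mf f0; rewrite integral_uniform// subr0 invr1 mul1e.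
by rewrite integral_itv_bndoo//; exact: measurable_funTS.
Qed.

Lemma unifE (B : set (measurableTypeR R)) : measurable B -> unif B = mu (B `&` `]0%R, 1%R[).
Proof.
move=> mB; have := @integral_unif (fun x => (\1_B x)%:E).
rewrite !integral_indic// setIT; apply; last by move=> x; rewrite lee_fin.
by apply/measurable_EFinP; exact: measurable_indic.
Qed.

(** Binary digits are read along the orbit of the doubling map, and the law of the fair coins is the
    image of the uniform law under them. *)
Definition doubling (x : R) : R := if x < 2^-1 then 2 * x else 2 * x - 1.
Definition digit (n : nat) (x : R) : bool := 2^-1 <= iter n doubling x.
Definition digits (x : measurableTypeR R) : coins := fun n => digit n x.

Lemma measurable_digits : measurable_fun setT digits.
Proof.
have mdoubling : measurable_fun setT doubling.
  apply: measurable_fun_ifT.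
  - by apply: measurable_fun_ltr.
  - exact: mulrl_measurable.
  - by apply: measurable_funB => //; exact: mulrl_measurable.
have miter n : measurable_fun setT (iter n doubling).
  elim: n => [|n IH]; first exact: measurable_id.
  exact: (measurableT_comp mdoubling IH).
apply: measurable_fun_coins => n b.
have := @measurable_fun_ler _ _ _ setT (cst 2^-1) (iter n doubling).
move=> /(_ (measurable_cst _) (miter n)) /(_ measurableT [set b]).
by rewrite setTI; apply.
Qed.

HB.instance Definition _ := isMeasurableFun.Build _ _ _ _ digits measurable_digits.

Definition fair : probability coins R := distribution unif digits.

Fixpoint dyadic (s : seq bool) : R :=
  if s is b :: s' then 2^-1 * (b%:R + dyadic s') else 0.

Lemma dyadic_bound s : 0 <= dyadic s /\ dyadic s + 2^-1 ^+ size s <= 1.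
Proof.
elim: s => [|[] s [IH1 IH2]] /=; rewrite ?expr0 ?exprS; first lra.
  by split; lra.
by split; lra.
Qed.

Lemma cylinder_digits s x : 0 <= x < 1 ->
  cylinder s (digits x) <-> dyadic s <= x < dyadic s + 2^-1 ^+ size s.
Proof.
elim: s x => [|b s IH] x x01; first by rewrite cylinder_nil /= add0r expr0.
rewrite cylinder_cons /= exprS.
have -> : digits x \o succn = digits (doubling x).
  by apply/funext => i; rewrite /digits /digit /= -iterSr.
have [d1 d2] := dyadic_bound s.
have d3 : 0 < 2^-1 ^+ size s :> R by rewrite exprn_gt0.
move: x01 => /andP[x0 x1].
rewrite IH /doubling; last by case: ltP => ?; apply/andP; split; lra.
rewrite /digits /digit /=.
case: b; case: leP => hx /=; split=> [[e /andP[h1 h2]]|/andP[h1 h2]] //;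
  first [by apply/andP; split; lra | by split=> //; apply/andP; split; lra
        | by exfalso; lra].
Qed.

Lemma fair_cylinder s : fair (cylinder s) = (2^-1 ^+ size s)%:E.
Proof.
have [d1 d2] := dyadic_bound s; set e := 2^-1 ^+ size s in d2 *.
have e0 : 0 < e by rewrite exprn_gt0.
rewrite /fair/= /distribution /pushforward unifE; last first.
  by rewrite -[X in measurable X]setTI; apply: measurable_digits => //;
    exact: measurable_cylinder.
have E x : (digits @^-1` cylinder s `&` `]0, 1[) x <->
    0 < x /\ dyadic s <= x < dyadic s + e.
  rewrite /= in_itv /=; split=> [[+ /andP[x0 x1]]|[x0 /andP[h1 h2]]].
    by move/cylinder_digits => ->//; rewrite ?ltW// x0 x1.
  have x1 : x < 1 by lra.
  by rewrite x0 x1; split=> //; apply/cylinder_digits; rewrite ?h1 ?ltW//= x1.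
(* The uniform law has been restricted to the open interval, so a dyadic interval that starts at 0
   loses its left end. *)
have [s0|s0] := eqVneq (dyadic s) 0.
  rewrite (_ : _ `&` _ = `]0, e[%classic); last first.
    apply/seteqP; split=> x; rewrite E s0 add0r /= in_itv/=.
      by case=> -> /andP[].
    by move=> /andP[x0 xe]; rewrite x0 ltW.
  by rewrite lebesgue_measure_itv/= lte_fin e0 sube0.
rewrite (_ : _ `&` _ = `[dyadic s, dyadic s + e[%classic); last first.
  apply/seteqP; split=> x; rewrite E /= in_itv/=; first by case.
  by move=> /andP[h1 h2]; rewrite h1 h2; split=> //; rewrite (lt_le_trans _ h1)// lt0r s0.
rewrite lebesgue_measure_itv/= lte_fin ltrDl e0 -EFinB; congr (_%:E); lra.
Qed.

(** Serves to prove the two self-similarities of the coins: prepending one fair coin, and separating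
    even from odd ranks. *)
Lemma fair_unique (nu : {measure set coins -> \bar R}) :
  (forall s, nu (cylinder s) = (2^-1 ^+ size s)%:E) ->
  forall A, measurable A -> fair A = nu A.
Proof.
move=> H A; apply: (@measure_unique _ R coins cylinders (fun=> setT) _ _ _ _ fair nu) => //.
- exact: cylinders_setI.
- by move=> _; right; exists [::]; rewrite cylinder_nil.
- by rewrite bigcup_const//; exists 0.
- by move=> _ [->|[s ->]]; [rewrite !measure0|rewrite H; exact: fair_cylinder].
- by move=> _; apply: (le_lt_trans (probability_le1 fair measurableT)); exact: ltry.
Qed.

Definition coin_cons (b : bool) (w : coins) : coins :=
  fun n => if n is n'.+1 then w n' else b.

Lemma measurable_coin_cons b : measurable_fun setT (coin_cons b).
Proof.
apply: measurable_fun_coins => -[|i] c /=; last exact: measurable_coin.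
by case: (eqVneq b c) => [->|/eqP bc]; [rewrite (_ : [set _ | _] = setT)|
  rewrite (_ : [set _ | _] = set0)] => //; apply/seteqP; split.
Qed.

Lemma fair_coin_cons A : measurable A ->
  fair A = (2^-1%:E * (fair (coin_cons false @^-1` A) + fair (coin_cons true @^-1` A)))%E.
Proof.
pose cons b := coin_cons b.
pose mcons b := isMeasurableFun.Build _ _ _ _ _ (@measurable_coin_cons b).
pose f b : {mfun coins >-> coins} := HB.pack (coin_cons b) (mcons b).
have h0 : 0 <= 2^-1 :> R by [].
pose nu := mscale (NngNum h0) (measure_add (distribution fair (f false)) (distribution fair (f true))).
have nuE B : nu B = (2^-1%:E *
    (fair (coin_cons false @^-1` B) + fair (coin_cons true @^-1` B)))%E.
  by rewrite /nu /mscale; congr (_ * _)%E; exact: measure_addE.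
move=> mA; rewrite -nuE; apply: (@fair_unique nu) => // -[|b s]; rewrite [LHS]nuE.
  rewrite cylinder_nil !preimage_setT !probability_setT expr0 -EFinD -EFinM.
  by congr (_%:E); lra.
have E1 : coin_cons b @^-1` cylinder (b :: s) = cylinder s.
  apply/seteqP; split=> w; rewrite /preimage/= cylinder_cons; first by case.
  by move=> ws; split.
have E2 : coin_cons (~~ b) @^-1` cylinder (b :: s) = set0.
  apply/seteqP; split=> w //; rewrite /preimage/= cylinder_cons => -[].
  by case: (b).
have -> : (fair (coin_cons false @^-1` cylinder (b :: s)) +
    fair (coin_cons true @^-1` cylinder (b :: s)) = fair (cylinder s))%E.
  have fair0 : fair set0 = 0%E by exact: measure0.
  by case: b E1 E2 => E1 E2; rewrite E1 E2 fair0 ?add0e ?adde0.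
by rewrite fair_cylinder -EFinM -exprS.
Qed.

Definition interleave (u v : coins) : coins :=
  fun n => if odd n then v n./2 else u n./2.

Lemma measurable_interleave :
  measurable_fun setT (fun uv : coins * coins => interleave uv.1 uv.2).
Proof.
apply: measurable_fun_coins => i b; rewrite /interleave; case: (odd i).
  rewrite (_ : [set _ | _] = snd @^-1` [set w : coins | w i./2 = b])//.
  by rewrite -[X in measurable X]setTI; apply: measurable_snd => //; exact: measurable_coin.
rewrite (_ : [set _ | _] = fst @^-1` [set w : coins | w i./2 = b])//.
by rewrite -[X in measurable X]setTI; apply: measurable_fst => //; exact: measurable_coin.
Qed.

(** Even and odd ranks carry independent fair sequences, because a cylinder is the product of a
    cylinder on the even ranks and one on the odd ranks. *)
Lemma fair_interleave A : measurable A ->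
  fair A = (\int[fair]_u fair (interleave u @^-1` A))%E.
Proof.
pose mI := isMeasurableFun.Build _ _ _ _ _ measurable_interleave.
pose f : {mfun (coins * coins)%type >-> coins} :=
  HB.pack (fun uv : coins * coins => interleave uv.1 uv.2) mI.
pose nu := distribution (fair \x fair)%E f.
move=> mA; transitivity (nu A); last first.
  rewrite /nu /distribution /pushforward /product_measure1.
  by apply: eq_integral => u _; rewrite /= xsectionE.
apply: (@fair_unique nu _ A mA) => s.
pose ev := mkseq (fun i => nth false s i.*2) (uphalf (size s)).
pose od := mkseq (fun i => nth false s i.*2.+1) (size s)./2.
have E : (fun uv : coins * coins => interleave uv.1 uv.2) @^-1` cylinder s =
    cylinder ev `*` cylinder od.
  apply/seteqP; split=> -[u v] /=.
    move=> H; split=> i; rewrite size_mkseq => hi; rewrite nth_mkseq//.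
      have := H i.*2; rewrite /interleave odd_double doubleK; apply; lia.
    by have := H i.*2.+1; rewrite /interleave /= odd_double /= uphalf_double; apply; lia.
  move=> [Hu Hv] i si; rewrite /interleave.
  case: ifP => oi.
    rewrite Hv ?size_mkseq ?nth_mkseq; try lia.
    by congr (nth _ _ _); have := odd_double_half i; rewrite oi.
  rewrite Hu ?size_mkseq ?nth_mkseq; try lia.
  by congr (nth _ _ _); have := odd_double_half i; rewrite oi.
transitivity ((fair \x fair)%E (cylinder ev `*` cylinder od)); first by rewrite -E.
rewrite product_measure1E; try exact: measurable_cylinder.
rewrite [X in (X * _)%E]fair_cylinder [X in (_ * X)%E]fair_cylinder -EFinM.
by rewrite !size_mkseq -exprD; congr (_ ^+ _)%:E; lia.
Qed.

End FairCoins.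

(** * The exponential clock *)

Section Clock.
Variable R : realType.
Local Notation mu := (@lebesgue_measure R).
Local Notation fair := (fair R).

Definition coins_real (w : coins) : R := limn (fun n => dyadic R (mkseq w n)).

Lemma dyadic_rcons s b :
  dyadic R (rcons s b) = dyadic R s + 2^-1 ^+ (size s).+1 * b%:R.
Proof. by elim: s => [|c s IH] /=; rewrite ?IH ?exprS; lra. Qed.

Lemma cvg_coins_real w :
  (fun n => dyadic R (mkseq w n)) @ \oo --> coins_real w.
Proof.
apply: nondecreasing_is_cvgn.
  apply/nondecreasing_seqP => n; rewrite mkseqS dyadic_rcons lerDl.
  by rewrite mulr_ge0// exprn_ge0.
exists 1 => _ [n _ <-]; have [_] := dyadic_bound R (mkseq w n).
by apply: le_trans; rewrite lerDl exprn_ge0.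
Qed.

Lemma measurable_coins_real : measurable_fun setT coins_real.
Proof.
apply: (@measurable_fun_cvg _ _ _ _ (fun n (w : coins) => dyadic R (mkseq w n))).
  elim=> [|n IH]; first exact: measurable_cst.
  rewrite (_ : (fun w : coins => _) = (fun w : coins => dyadic R (mkseq w n)) \+
     (fun w : coins => if w n then 2^-1 ^+ n.+1 else 0)); last first.
    apply/funext => w; rewrite mkseqS dyadic_rcons size_mkseq /=.
    by case: (w n); rewrite ?mulr1 ?mulr0.
  apply: measurable_funD => //; apply: measurable_fun_ifT => //.
  by apply: (measurable_fun_bool true); rewrite setTI; exact: measurable_coin.
by move=> w _; exact: cvg_coins_real.
Qed.

Lemma digitsK x : 0 < x < 1 -> coins_real (digits x) = x.
Proof.
move=> /andP[x0 x1]; apply/cvg_lim => //.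
have H n : dyadic R (mkseq (digits x) n) <= x <
    dyadic R (mkseq (digits x) n) + 2^-1 ^+ n.
  rewrite -[X in _ ^+ X](size_mkseq (digits x) n); apply/cylinder_digits.
    by rewrite ltW.
  by move=> i; rewrite size_mkseq => ni; rewrite nth_mkseq.
apply: (@squeeze_cvgr _ _ _ _ (fun n => x - 2^-1 ^+ n) (cst x)).
- by near=> n; have /andP[] := H n => h1 h2; apply/andP; split=> //=; lra.
- rewrite -[X in _ --> X]subr0; apply: cvgB; first exact: cvg_cst.
  by apply: cvg_expr; rewrite ger0_norm//; lra.
- exact: cvg_cst.
Unshelve. all: by end_near. Qed.

(** [coins_real] is uniform on the unit interval, since [fair] is the image of the uniform law under
    [digits] and [coins_real] inverts [digits]. *)
Lemma integral_coins_real (f : measurableTypeR R -> \bar R) :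
  measurable_fun setT f -> (forall x, 0 <= f x)%E ->
  (\int[fair]_w f (coins_real w) = \int[mu]_(x in `]0%R, 1%R[) f x)%E.
Proof.
move=> mf f0.
have mfU : measurable_fun setT (f \o coins_real).
  exact: (measurableT_comp mf measurable_coins_real).
rewrite /fair /distribution.
rewrite (ge0_integral_pushforward (@measurable_digits R)) => [|//|//|w _]; last exact: f0.
rewrite preimage_setT integral_unif => [|//|x]; last first.
- exact: f0.
- exact: (measurableT_comp mfU (@measurable_digits R)).
by apply: eq_integral => x; rewrite inE/= in_itv/= => x01; rewrite digitsK.
Qed.

(** The inverse transform of the exponential law of rate 2. The default 1 keeps every waiting time
    positive, for all outcomes. *)
Definition clock (u : R) : R := if 0 < u < 1 then - ln u / 2 else 1.

Lemma clock_gt0 u : 0 < clock u.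
Proof.
rewrite /clock; case: ifP => // /andP[u0 u1].
by rewrite divr_gt0// oppr_gt0 ln_lt0// u0.
Qed.

Lemma measurable_clock : measurable_fun setT clock.
Proof.
apply: measurable_fun_ifT.
- by apply: measurable_and; apply: measurable_fun_ltr.
- apply: measurable_funM; last exact: measurable_cst.
  by apply: measurableT_comp; [exact: oppr_measurable|exact: measurable_ln].
- exact: measurable_cst.
Qed.

Definition gap0 (w : coins) : R := clock (coins_real w).

Lemma measurable_gap0 : measurable_fun setT gap0.
Proof. exact: (measurableT_comp measurable_clock measurable_coins_real). Qed.

(* The substitution [u = exp (-2 tau)] turns the law of an exponential time of
   rate 2 into Lebesgue measure, and [u |-> u * h (T + ln u / 2)] is an
   antiderivative of the integrand. *)
Lemma integral_gap0 (h h' : R -> R) (s r T : R) :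
  (forall t : R, is_derive t (1 : R) h (h' t)) -> continuous h' ->
  0 <= s -> s <= r -> r <= T ->
  (forall t : R, 0 <= t <= T - s -> 0 <= h t + h' t / 2) ->
  (\int[fair]_(w in [set w | s < gap0 w <= r]%R)
     (h (T - gap0 w) + h' (T - gap0 w) / 2)%R%:E =
   (expR (- 2 * s) * h (T - s) - expR (- 2 * r) * h (T - r))%R%:E)%E.
Proof.
move=> dh ch' s0 sT rT hge0.
pose phi t := h t + h' t / 2.
have ch : continuous h.
  by move=> t; apply/differentiable_continuous/derivable1_diffP; have [] := dh t.
have cphi : continuous phi.
  by move=> t; apply: cvgD; [exact: ch|apply: cvgM; [exact: ch'|exact: cvg_cst]].
pose f (u : R) := if s < clock u <= r then phi (T - clock u) else 0.
have mf : measurable_fun setT f.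
  apply: measurable_fun_ifT => //.
    apply: measurable_and.
      by apply: measurable_fun_ltr => //; exact: measurable_clock.
    by apply: measurable_fun_ler => //; exact: measurable_clock.
  apply: (@measurableT_comp _ _ _ _ _ _ phi).
    exact: continuous_measurable_fun.
  by apply: measurable_funB => //; exact: measurable_clock.
have f0 u : 0 <= f u.
  by rewrite /f; case: ifP => // /andP[h1 h2]; apply: hge0; apply/andP; split; lra.
transitivity (\int[fair]_w (f (coins_real w))%:E)%E.
  rewrite [LHS]integral_mkcond; apply: eq_integral => w _.
  rewrite /patch /f /phi /gap0; case: ifPn; first by rewrite inE/= => ->.
  by rewrite notin_setE/= => /negP/negbTE ->.
rewrite (@integral_coins_real (EFin \o f)); [|exact/measurable_EFinP|by []].
set a := expR (- 2 * r); set b := expR (- 2 * s).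
have a0 : 0 < a := expR_gt0 _.
have b1 : b <= 1 by rewrite -expR0 ler_expR; lra.
have ab : a <= b by rewrite ler_expR; lra.
have clockE (u : R) : 0 < u < 1 -> (s < clock u <= r) = (a <= u < b).
  move=> u01; rewrite /clock u01; move: u01 => /andP[u0 u1].
  rewrite -[in RHS](lnK (x := u))// ler_expR ltr_expR.
  by rewrite andbC; congr (_ && _); apply/idP/idP; lra.
transitivity (\int[mu]_(u in `[a, b[) (phi (T + ln u / 2))%:E)%E.
  rewrite [LHS]integral_mkcond [RHS]integral_mkcond; apply: eq_integral => u _.
  rewrite /patch !mem_setE/= !in_itv/=; case: ifPn => u01.
    rewrite /f clockE//; case: ifP => // _.
    by rewrite /clock u01; congr (phi _)%:E; lra.
  by rewrite ifF//; apply/negbTE; apply: contra u01 => /andP[? ?]; apply/andP; split; lra.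
have [sT'|] := eqVneq s r.
  by rewrite /a /b sT' set_itv_ge ?bnd_simp ?ltxx// integral_set0 !subrr.
move=> sT'.
have {}ab : a < b by rewrite ltr_expR; move: sT'; rewrite neq_lt; lra.
pose G (u : R) := u * h (T + ln u / 2).
have d1 (u : R) : 0 < u -> is_derive u (1 : R) (fun u : R => T + ln u / 2) (u^-1 / 2).
  move=> u0; have := is_deriveD (is_derive_cst T u 1) (is_deriveZ 2^-1 (is_derive1_ln u0)).
  rewrite add0r (_ : _ *: _ = u^-1 / 2); last by rewrite mulrC.
  by congr is_derive; apply/funext => x; rewrite !fctE /= mulrC.
have dG (u : R) : 0 < u -> is_derive u (1 : R) G (phi (T + ln u / 2)).
  move=> u0; have d2 := @is_derive1_comp _ h (fun u : R => T + ln u / 2) u _ _ (dh _) (d1 u u0).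
  have H : is_derive u (1 : R) G _ := is_deriveM (is_derive_id u 1) d2.
  apply: is_derive_eq H _.
  rewrite /phi /= /GRing.scale /= mulr1; field.
  by rewrite gt_eqF.
have cG (u : R) : 0 < u -> {for u, continuous G}.
  by move=> u0; apply/differentiable_continuous/derivable1_diffP; have [] := dG u u0.
have cphi' (u : R) : 0 < u -> {for u, continuous (fun u => phi (T + ln u / 2))}.
  move=> u0; apply: (@continuous_comp _ _ _ (fun u : R => T + ln u / 2) phi).
    by apply/differentiable_continuous/derivable1_diffP; have [] := d1 u u0.
  exact: cphi.
have cW : {within `[a, b], continuous (fun u => phi (T + ln u / 2))}.
  apply: continuous_in_subspaceT => u; rewrite inE/= in_itv/= => /andP[au _].
  by apply: cphi'; exact: lt_le_trans au.
rewrite integral_itv_bndo_bndc; last first.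
  apply/measurable_funTS/measurable_EFinP.
  apply: (@measurableT_comp _ _ _ _ _ _ phi).
    exact: continuous_measurable_fun.
  apply: measurable_funD; first exact: measurable_cst.
  by apply: measurable_funM; [exact: measurable_ln|exact: measurable_cst].
rewrite (@continuous_FTC2 _ _ G)//.
- rewrite /G /a /b !expRK -EFinB; congr (_%:E).
  by congr (_ * h _ - _ * h _); lra.
- split.
  + by move=> u; rewrite in_itv/= => /andP[au ub]; have [] := dG u (lt_trans a0 au).
  + by apply: cvg_at_right_filter; exact: cG.
  + by apply: cvg_at_left_filter; apply: cG; lra.
- move=> u; rewrite in_itv/= => /andP[au ub]; rewrite derive1E.
  by have [_ ->] := dG u (lt_trans a0 au).
Qed.

Lemma gap0_gt0 w : 0 < gap0 w.
Proof. exact: clock_gt0. Qed.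

Lemma fair_gap0_gt (T : R) : 0 <= T ->
  fair [set w | T < gap0 w] = (expR (- 2 * T))%:E.
Proof.
move=> T0; have mT : measurable [set w | gap0 w <= T].
  rewrite (_ : [set _ | _] = gap0 @^-1` `]-oo, T]%classic).
    by rewrite -[X in measurable X]setTI; exact: measurable_gap0.
  by apply/seteqP; split=> w /=; rewrite in_itv.
rewrite (_ : [set _ | _] = ~` [set w | gap0 w <= T]); last first.
  by apply/seteqP; split=> w /=; rewrite ltNge => /negP.
rewrite probability_setC//.
(* With [h = 1] and [h' = 0] the integrand is 1, and the formula is the distribution function of the
   waiting time. *)
have := @integral_gap0 (cst (1 : R)) (cst (0 : R)) 0 T T.
rewrite subr0 mulr0 expR0 => /(_ (fun t => is_derive_cst _ _ _)) H.
have {}H := H (@cst_continuous _ _ _) (lexx 0) T0 (lexx T).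
have {}H : (\int[fair]_(w in [set w | 0 < gap0 w <= T]%R) (1 : R)%:E =
    (1 - expR (- 2 * T))%:E)%E.
  rewrite -[RHS](_ : (1 * 1 - expR (-2 * T) * 1)%:E = _); last by rewrite !mulr1.
  rewrite -H => [|t _]; last by rewrite mul0r addr0.
  by apply: eq_integral => w _ /=; rewrite mul0r addr0.
rewrite (_ : [set w | 0 < gap0 w <= T] = [set w | gap0 w <= T]) in H; last first.
  by apply/seteqP; split=> w /=; rewrite gap0_gt0.
rewrite integral_cst// mul1e in H; rewrite H -EFinB; congr (_%:E); lra.
Qed.


End Clock.

#[global] Opaque fair.

(** * The heat semigroup and the jump process *)

Section ExponentialGeneratingFunction.
Variable R : realType.
Implicit Types (b : nat -> R) (t C : R).

Definition egf_coeff b : nat -> R := fun k => b k / k`!%:R.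

Lemma pseries_diffs_egf b :
  pseries_diffs (egf_coeff b) = egf_coeff (fun k => b k.+1).
Proof.
apply/funext => k; rewrite /pseries_diffs /egf_coeff factS natrM.
by rewrite invfM mulrCA mulVKf// pnatr_eq0.
Qed.

Lemma egf_normed_le b C t k : (forall k, `|b k| <= C * 2 ^+ k) ->
  `|egf_coeff b k * t ^+ k| <= C * exp_coeff (2 * `|t|) k.
Proof.
move=> hb; rewrite /egf_coeff /exp_coeff/= normrM normrM normfV normr_nat normrX exprMn.
rewrite [leRHS](_ : _ = C * 2 ^+ k / k`!%:R * `|t| ^+ k); last by ring.
by rewrite ler_wpM2r ?exprn_ge0// ler_wpM2r// invr_ge0.
Qed.

Lemma is_cvg_egf b C t : (forall k, `|b k| <= C * 2 ^+ k) ->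
  cvgn (pseries (egf_coeff b) t).
Proof.
move=> hb; have C0 : 0 <= C by have := le_trans (normr_ge0 _) (hb 0); rewrite expr0 mulr1.
apply: normed_cvg; apply: (@series_le_cvg _ _ (fun k => C * exp_coeff (2 * `|t|) k)) => [k|k|k|].
- exact: normr_ge0.
- by rewrite mulr_ge0// exp_coeff_ge0// mulr_ge0.
- exact: egf_normed_le.
- by rewrite (_ : (fun k => _) = C *: exp_coeff (2 * `|t|))//; apply: is_cvg_seriesZ; exact: is_cvg_series_exp_coeff.
Qed.

(** Differentiating an exponential generating function shifts its sequence. The growth [2 ^+ k],
    which is that of the powers of [lap], makes the radius of convergence infinite. *)
Lemma is_derive_egf b C t : (forall k, `|b k| <= C * 2 ^+ k) ->
  is_derive t (1 : R) (fun t => limn (pseries (egf_coeff b) t))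
    (limn (pseries (egf_coeff (fun k => b k.+1)) t)).
Proof.
move=> hb; rewrite -pseries_diffs_egf.
have shift b' C' : (forall k, `|b' k| <= C' * 2 ^+ k) ->
    forall k, `|b' k.+1| <= (C' * 2) * 2 ^+ k.
  by move=> hb' k; apply: le_trans (hb' _) _; rewrite exprS mulrA.
apply: (@pseries_snd_diffs _ _ (`|t| + 1)).
- exact: is_cvg_egf hb.
- by rewrite pseries_diffs_egf; exact: is_cvg_egf (shift _ _ hb).
- by rewrite !pseries_diffs_egf; exact: is_cvg_egf (shift _ _ (shift _ _ hb)).
- by rewrite [ltRHS]ger0_norm ?addr_ge0// ltrDl.
Qed.

Lemma egf_bound b C t : (forall k, `|b k| <= C * 2 ^+ k) ->
  `|limn (pseries (egf_coeff b) t)| <= C * expR (2 * `|t|).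
Proof.
move=> hb; have cv : cvgn (pseries (egf_coeff b) t) := is_cvg_egf hb.
have H n : `|pseries (egf_coeff b) t n| <= C * series (exp_coeff (2 * `|t|)) n.
  rewrite /pseries /series /= mulr_sumr; apply: le_trans (ler_norm_sum _ _ _) _.
  by apply: ler_sum => k _; exact: egf_normed_le.
have cvE : (fun n => C * series (exp_coeff (2 * `|t|)) n) @ \oo --> C * expR (2 * `|t|).
  by apply: cvgM; [exact: cvg_cst|exact: is_cvg_series_exp_coeff].
rewrite ler_norml; apply/andP; split.
  apply: (ler_cvg_to (cvgN cvE) cv).
  by apply: nearW => n; have := H n; rewrite ler_norml => /andP[].
apply: (ler_cvg_to cv cvE).
by apply: nearW => n; have := H n; rewrite ler_norml => /andP[].
Qed.

Lemma egf0 b : limn (pseries (egf_coeff b) 0) = b 0.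
Proof.
apply/cvg_lim => //; apply: cvg_near_cst; near=> n.
have -> : n = n.-1.+1 by rewrite prednK//; near: n; exists 1.
rewrite /pseries /series /= big_nat_recl// big1 => [|k _].
  by rewrite /egf_coeff fact0 divr1 expr0 mulr1 addr0.
by rewrite expr0n mulr0.
Unshelve. all: by end_near. Qed.

End ExponentialGeneratingFunction.

Section Heat.
Variable R : realType.
Local Notation G := (lamplighter R).
Implicit Types z w : G.

Definition heat_coeff w (k : nat) z : R := iter k (@lap R G) \1_[set w] z.

(** [lap] is an average minus the identity, so it at most doubles a uniform bound. *)
Lemma heat_coeff_bound w k z : `|heat_coeff w k z| <= 1 * 2 ^+ k.
Proof.
elim: k z => [|k IH] z; rewrite mul1r.
  by rewrite expr0 /heat_coeff /= indicE ger0_norm// lern1 leq_b1.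
rewrite /heat_coeff iterS lapE.
have h y : - 2 ^+ k <= iter k (@lap R G) \1_[set w] y <= 2 ^+ k.
  by rewrite -ler_norml -[leRHS]mul1r; exact: IH.
have /andP[? ?] := h (z.1 + 1, set_lamp z.1 false z.2).
have /andP[? ?] := h (z.1 + 1, set_lamp z.1 true z.2).
have /andP[? ?] := h (z.1 - 1, set_lamp z.1 false z.2).
have /andP[? ?] := h (z.1 - 1, set_lamp z.1 true z.2).
have /andP[? ?] := h z.
by rewrite ler_norml exprS; apply/andP; split; lra.
Qed.

Lemma heatE t z w :
  heat t z w = limn (pseries (egf_coeff (heat_coeff w ^~ z)) t).
Proof.
rewrite /heat; congr (limn _); apply/funext => n.
rewrite /pseries /series /=; apply: eq_bigr => k _.
by rewrite /egf_coeff /heat_coeff mulrC mulrA mulrAC.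
Qed.

Lemma heat0 z w : heat 0 z w = (z == w)%:R.
Proof.
by rewrite heatE egf0 /heat_coeff /= indicE; congr (nat_of_bool _)%:R;
  apply/idP/eqP; rewrite inE.
Qed.

Lemma heat_bound (t : R) z w : 0 <= t -> `|heat t z w| <= expR (2 * t).
Proof.
move=> t0; rewrite heatE -[leRHS]mul1r -[X in 2 * X]ger0_norm//.
by apply: egf_bound => k; exact: heat_coeff_bound.
Qed.

(** The backward equation: the shifted coefficients are [lap] of the coefficients in the starting
    vertex, and [lap], a finite combination of values, commutes with the sum of the series. *)
Lemma is_derive_heat (t : R) z w :
  is_derive t (1 : R) (fun t => heat t z w) (lap (fun z => heat t z w) z).
Proof.
have -> : (fun t => heat t z w) = fun t => limn (pseries (egf_coeff (heat_coeff w ^~ z)) t).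
  by apply/funext => s; exact: heatE.
apply: is_derive_eq (@is_derive_egf _ _ _ t (fun k => heat_coeff_bound w k z)) _.
apply/cvg_lim => //.
have cvh y : pseries (egf_coeff (heat_coeff w ^~ y)) t @ \oo --> heat t y w.
  by rewrite heatE; apply: is_cvg_egf => k; exact: heat_coeff_bound.
rewrite lapE.
set f := (X in X @ \oo --> _).
pose g y := pseries (egf_coeff (heat_coeff w ^~ y)) t.
have -> : f = fun n => 4^-1 * (g (z.1 + 1, set_lamp z.1 false z.2) n +
    g (z.1 + 1, set_lamp z.1 true z.2) n + g (z.1 - 1, set_lamp z.1 false z.2) n +
    g (z.1 - 1, set_lamp z.1 true z.2) n) - g z n.
  apply/funext => n; rewrite /f /g /pseries /series /= -!big_split /= mulr_sumr -sumrB.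
  apply: eq_bigr => k _; rewrite /egf_coeff.
  rewrite lapE; ring.
apply: cvgB; last exact: cvh.
apply: cvgM; first exact: cvg_cst.
by do 3 (apply: cvgD; last exact: cvh); exact: cvh.
Qed.

Lemma continuous_heat z w : continuous (fun t => heat t z w).
Proof.
move=> t; apply/differentiable_continuous/derivable1_diffP.
by have [] := is_derive_heat t z w.
Qed.

Lemma continuous_lap_heat z w : continuous (fun t => lap (fun y => heat t y w) z).
Proof.
pose g (y : G) (t : R) := heat t y w.
rewrite (_ : (fun t => _) = fun t => 4^-1 * (g (z.1 + 1, set_lamp z.1 false z.2) t +
    g (z.1 + 1, set_lamp z.1 true z.2) t + g (z.1 - 1, set_lamp z.1 false z.2) t +
    g (z.1 - 1, set_lamp z.1 true z.2) t) - g z t); last first.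
  by apply/funext => t; rewrite lapE.
move=> t; apply: cvgB; last exact: continuous_heat.
apply: cvgM; first exact: cvg_cst.
by do 3 (apply: cvgD; last exact: continuous_heat); exact: continuous_heat.
Qed.

End Heat.

(** * Conditioning on the first jump *)

Section FirstStep.
Variable R : realType.
Local Notation fair := (fair R).

Definition Pr (A : set coins) : R := fine (fair A).

Lemma PrE A : measurable A -> (Pr A)%:E = fair A.
Proof. by move=> mA; rewrite /Pr fineK// fin_num_measure. Qed.

Lemma Pr_ge0 A : 0 <= Pr A.
Proof. by rewrite /Pr fine_ge0. Qed.

Lemma Pr_le1 A : measurable A -> Pr A <= 1.
Proof. by move=> mA; rewrite -lee_fin PrE// probability_le1. Qed.

Lemma Pr_le A B : measurable A -> measurable B -> A `<=` B -> Pr A <= Pr B.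
Proof. by move=> mA mB AB; rewrite -lee_fin !PrE// le_measure// inE. Qed.

Lemma Pr0 : Pr set0 = 0.
Proof. by rewrite /Pr measure0. Qed.

Lemma Pr_split A B : measurable A -> measurable B ->
  Pr A = Pr (A `&` B) + Pr (A `&` ~` B).
Proof.
move=> mA mB; have mAB : measurable (A `&` B) by exact: measurableI.
have mABC : measurable (A `&` ~` B) by apply: measurableI => //; exact: measurableC.
apply: EFin_inj; rewrite EFinD !PrE//.
rewrite -[in LHS](setIT A) -(setUv B) setIUr measureU//.
by rewrite setIACA setICr setI0.
Qed.

(* The coins of even rank make the first waiting time, the first three of odd rank
   the mark of the first jump, and the other ones the rest of the path. *)
Definition pack (c e k : bool) (x w : coins) : coins :=
  interleave x (coin_cons c (coin_cons e (coin_cons k w))).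

Definition clock_part (w : coins) : coins := fun n => w n.*2.
Definition mark (i : nat) (w : coins) : bool := w i.*2.+1.
Definition tail (w : coins) : coins := fun n => w n.+3.*2.+1.

Lemma clock_part_pack c e k x w : clock_part (pack c e k x w) = x.
Proof.
by apply/funext => n; rewrite /clock_part /pack /interleave odd_double doubleK.
Qed.

Lemma tail_pack c e k x w : tail (pack c e k x w) = w.
Proof.
apply/funext => n; rewrite /tail /pack /interleave /= odd_double /=.
by rewrite uphalf_double.
Qed.

Lemma measurable_pack c e k :
  measurable_fun setT (fun u : coins * coins => pack c e k u.1 u.2).
Proof.
apply: (measurableT_comp measurable_interleave (g := fun u : coins * coins =>
  (u.1, coin_cons c (coin_cons e (coin_cons k u.2))))).
apply/measurable_fun_pairP; split=> /=; first exact: measurable_fst.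
do 3 apply: (measurableT_comp (@measurable_coin_cons _)).
exact: measurable_snd.
Qed.

Lemma measurable_pack2 c e k x : measurable_fun setT (pack c e k x).
Proof.
apply: (measurableT_comp (@measurable_pack c e k) (g := fun w => (x, w))).
exact: pair1_measurable.
Qed.

Lemma measurable_pack_preimage c e k x A : measurable A ->
  measurable (pack c e k x @^-1` A).
Proof.
by move=> mA; rewrite -[X in measurable X]setTI; exact: measurable_pack2.
Qed.

Lemma measurable_Pr_pack c e k A : measurable A ->
  measurable_fun setT (fun x => Pr (pack c e k x @^-1` A)).
Proof.
move=> mA; apply/measurable_EFinP.
pose B := (fun u : coins * coins => pack c e k u.1 u.2) @^-1` A.
have mB : measurable B.
  by rewrite -[X in measurable X]setTI; exact: measurable_pack.
have := measurable_fun_xsection fair mB; congr measurable_fun.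
apply/funext => x /=; rewrite PrE; last exact: measurable_pack_preimage.
by congr (fair _); apply/seteqP; split=> w; rewrite /B xsectionE.
Qed.

Definition avg (f : bool -> bool -> bool -> R) : R :=
  8^-1 * (f false false false + f false false true + f false true false +
  f false true true + f true false false + f true false true +
  f true true false + f true true true).

Lemma avg_le f g : (forall c e k, f c e k <= g c e k) -> avg f <= avg g.
Proof.
by move=> fg; rewrite /avg ler_wpM2l ?invr_ge0// !lerD.
Qed.

Lemma avg_ge0 f : (forall c e k, 0 <= f c e k) -> 0 <= avg f.
Proof. by move=> f0; rewrite mulr_ge0 ?invr_ge0// !addr_ge0. Qed.

Lemma avg_affine a b f : avg (fun c e k => a * f c e k + b) = a * avg f + b.
Proof. by rewrite /avg; lra. Qed.

Lemma measurable_avg (f : coins -> bool -> bool -> bool -> R) :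
  (forall c e k, measurable_fun setT (fun x => f x c e k)) ->
  measurable_fun setT (fun x => avg (f x)).
Proof.
move=> mf; apply: measurable_funM; first exact: measurable_cst.
by do 7 (apply: measurable_funD => //).
Qed.

Lemma Pr_cons A : measurable A ->
  Pr A = 2^-1 * (Pr (coin_cons false @^-1` A) + Pr (coin_cons true @^-1` A)).
Proof.
move=> mA; have mc b : measurable (coin_cons b @^-1` A).
  by rewrite -[X in measurable X]setTI; exact: measurable_coin_cons.
by apply: EFin_inj; rewrite EFinM EFinD !PrE// fair_coin_cons.
Qed.

(** Odd ranks are integrated out first: three of their coins are averaged over their eight values,
    and the remaining ones are again a fair sequence. *)
Lemma Pr_first_step A : measurable A ->
  (Pr A)%:E = (\int[fair]_x (avg (fun c e k => Pr (pack c e k x @^-1` A)))%:E)%E.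
Proof.
move=> mA; rewrite PrE// fair_interleave//; apply: eq_integral => x _.
have mx : measurable (interleave x @^-1` A).
  rewrite -[X in measurable X]setTI.
  apply: (measurableT_comp measurable_interleave (g := fun w => (x, w))) => //.
  exact: pair1_measurable.
have mc b B : measurable B -> measurable (coin_cons b @^-1` B).
  by move=> mB; rewrite -[X in measurable X]setTI; exact: measurable_coin_cons.
have Ep c e k : Pr (pack c e k x @^-1` A) = Pr (coin_cons k @^-1`
  (coin_cons e @^-1` (coin_cons c @^-1` (interleave x @^-1` A)))) by [].
rewrite -PrE// (Pr_cons mx) (Pr_cons (mc false _ mx)) (Pr_cons (mc true _ mx)).
rewrite (Pr_cons (mc false _ (mc false _ mx))) (Pr_cons (mc true _ (mc false _ mx))).
rewrite (Pr_cons (mc false _ (mc true _ mx))) (Pr_cons (mc true _ (mc true _ mx))).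
rewrite /avg !Ep; congr (_%:E).
do 8 (move: (Pr (coin_cons _ @^-1` _)) => ?); lra.
Qed.

Definition gap (w : coins) : R := gap0 R (clock_part w).

Lemma gap_pack c e k x w : gap (pack c e k x w) = gap0 R x.
Proof. by rewrite /gap clock_part_pack. Qed.

Lemma measurable_gap : measurable_fun setT gap.
Proof.
apply: (measurableT_comp (@measurable_gap0 R)); apply: measurable_fun_coins.
by move=> i b; exact: measurable_coin.
Qed.

Lemma measurable_tail : measurable_fun setT tail.
Proof.
by apply: measurable_fun_coins => i b; exact: measurable_coin.
Qed.

Lemma measurable_gap0_le s : measurable [set x | gap0 R x <= s].
Proof.
rewrite (_ : [set _ | _] = gap0 R @^-1` `]-oo, s]%classic).
  by rewrite -[X in measurable X]setTI; exact: measurable_gap0.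
by apply/seteqP; split=> w /=; rewrite in_itv.
Qed.

Lemma measurable_gap_le s : measurable [set w | gap w <= s].
Proof.
rewrite (_ : [set _ | _] = gap @^-1` `]-oo, s]%classic).
  by rewrite -[X in measurable X]setTI; exact: measurable_gap.
by apply/seteqP; split=> w /=; rewrite in_itv.
Qed.

Lemma Pr_gap0_le s : 0 <= s -> Pr [set x | gap0 R x <= s] = 1 - expR (- 2 * s).
Proof.
move=> s0; apply: EFin_inj; rewrite PrE; last exact: measurable_gap0_le.
rewrite -[X in fair X]setCK probability_setC; last first.
  by apply: measurableC; exact: measurable_gap0_le.
rewrite (_ : ~` _ = [set x | s < gap0 R x]) ?fair_gap0_gt//.
by apply/seteqP; split=> w /=; rewrite ltNge => /negP.
Qed.

Lemma Pr_first_step_le s A : measurable A ->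
  (Pr (A `&` [set w | gap w <= s]))%:E =
  (\int[fair]_(x in [set x | gap0 R x <= s]%R)
    (avg (fun c e k => Pr (pack c e k x @^-1` A)))%:E)%E.
Proof.
move=> mA; rewrite Pr_first_step; last first.
  by apply: measurableI => //; exact: measurable_gap_le.
rewrite [RHS]integral_mkcond; apply: eq_integral => x _; rewrite /patch.
have E c e k : pack c e k x @^-1` (A `&` [set w | gap w <= s]) =
    if gap0 R x <= s then pack c e k x @^-1` A else set0.
  by apply/seteqP; split=> w; rewrite /preimage /= gap_pack; case: ifP => // _ [].
case: ifPn; first by rewrite inE/= => h; congr (avg _)%:E; do 3 apply/funext => ?; rewrite E h.
rewrite notin_setE/= => /negP/negbTE h.
by rewrite /avg !E h Pr0; congr (_%:E); lra.
Qed.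

(** The engine of the contraction arguments: an error [c] in the comparison after the first jump
    comes back multiplied by the probability that this jump occurs by time [s]. *)
Lemma first_step_compare s A B (a b c : R) : measurable A -> measurable B ->
  0 <= a -> 0 <= b -> 0 <= c ->
  (forall i e k x, gap0 R x <= s ->
    a * Pr (pack i e k x @^-1` A) <= b * Pr (pack i e k x @^-1` B) + c) ->
  a * Pr (A `&` [set w | gap w <= s]) <=
  b * Pr (B `&` [set w | gap w <= s]) + c * Pr [set x | gap0 R x <= s].
Proof.
move=> mA mB a0 b0 c0 H; have mD := measurable_gap0_le s.
have mavg C : measurable C -> measurable_fun setT (fun x => avg (fun c e k => Pr (pack c e k x @^-1` C))).
  by move=> mC; apply: measurable_avg => i e k; exact: measurable_Pr_pack.
have avg0 C x : 0 <= avg (fun c e k => Pr (pack c e k x @^-1` C)).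
  by apply: avg_ge0 => *; exact: Pr_ge0.
rewrite -lee_fin EFinD !EFinM !Pr_first_step_le// PrE//.
have icst : (\int[fair]_(x in [set x | gap0 R x <= s]%R) c%:E =
    c%:E * fair [set x | gap0 R x <= s]%R)%E by exact: (integral_cst fair mD c%:E).
rewrite -icst -!ge0_integralZl//; try by [move=> x _; rewrite lee_fin |
  apply: measurable_funTS; apply/measurable_EFinP; exact: mavg].
rewrite -ge0_integralD//; last 2 first.
- by move=> x _; rewrite -EFinM lee_fin mulr_ge0.
- apply: measurable_funTS; apply/measurable_EFinP.
  by apply: measurable_funM; [exact: measurable_cst|exact: mavg].
apply: ge0_le_integral => //.
- by move=> x _; rewrite -EFinM lee_fin mulr_ge0.
- apply: measurable_funTS; apply/measurable_EFinP.
  by apply: measurable_funM; [exact: measurable_cst|exact: mavg].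
- apply: measurable_funTS; apply/measurable_EFinP.
  apply: measurable_funD; last exact: measurable_cst.
  by apply: measurable_funM; [exact: measurable_cst|exact: mavg].
- move=> x /= xs; rewrite -!EFinM -EFinD lee_fin -(avg_affine b c).
  rewrite -[X in X <= _]addr0 -(avg_affine a 0).
  by apply: avg_le => *; rewrite addr0; exact: H.
Qed.

End FirstStep.

Lemma geometric_le0 (R : realType) (a C q : R) : 0 <= q -> q < 1 ->
  (forall n, a <= C * q ^+ n) -> a <= 0.
Proof.
move=> q0 q1 H.
have cvq : (fun n => C * q ^+ n) @ \oo --> C * 0.
  by apply: cvgM; [exact: cvg_cst|apply: cvg_expr; rewrite ger0_norm].
rewrite -(mulr0 C); apply: (ler_cvg_to (cvg_cst a) cvq).
exact: nearW.
Qed.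

(** * The marked jump chain and its non-explosion *)

Section JumpProcess.
Variables (R : realType) (S : Type) (step : bool -> bool -> bool -> S -> S).
Local Notation Pr := (@Pr R).
Local Notation gap := (gap R).
Local Notation gap0 := (gap0 R).

Fixpoint jump (n : nat) (w : coins) : R :=
  if n is m.+1 then gap w + jump m (tail w) else 0.

Fixpoint chain (n : nat) (z : S) (w : coins) : S :=
  if n is m.+1 then chain m (step (mark 0 w) (mark 1 w) (mark 2 w) z) (tail w)
  else z.

(** A relation rather than a function of time: after an explosion no [n] qualifies, so that such
    paths belong to none of these events. *)
Definition at_time (t : R) (z : S) (p : S -> Prop) : set coins :=
  [set w | exists n, jump n w <= t < jump n.+1 w /\ p (chain n z w)].

Lemma gap_gt0 w : 0 < gap w.
Proof. exact: gap0_gt0. Qed.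

Lemma jump_ge0 n w : 0 <= jump n w.
Proof. by elim: n w => //= n IH w; rewrite addr_ge0// ltW// gap_gt0. Qed.

Lemma jump_lt n w : jump n w < jump n.+1 w.
Proof.
elim: n w => [|n IH] w; first by rewrite /= addr0 gap_gt0.
by rewrite [ltLHS]/= [ltRHS]/= ltrD2l; exact: IH.
Qed.

Lemma jump_le m n w : (m <= n)%N -> jump m w <= jump n w.
Proof.
move=> /subnK <-; elim: (n - m)%N => // k IH.
by rewrite (le_trans IH)// ltW// jump_lt.
Qed.

Lemma at_time_uniq t m n w : jump m w <= t < jump m.+1 w ->
  jump n w <= t < jump n.+1 w -> m = n.
Proof.
move=> /andP[h1 h2] /andP[h3 h4]; case: (ltngtP m n) => // mn.
  by have := jump_le w mn; rewrite leNgt (le_lt_trans h3 h2).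
by have := jump_le w mn; rewrite leNgt (le_lt_trans h1 h4).
Qed.

Lemma jump_pack n c e k x w : jump n.+1 (pack c e k x w) = gap0 x + jump n w.
Proof. by rewrite /= gap_pack tail_pack. Qed.

Lemma chain_pack n c e k x w z :
  chain n.+1 z (pack c e k x w) = chain n (step c e k z) w.
Proof. by rewrite /= tail_pack. Qed.

Lemma at_time_pack_ge t z p c e k x w : gap0 x <= t ->
  at_time t z p (pack c e k x w) <-> at_time (t - gap0 x) (step c e k z) p w.
Proof.
move=> tx; split=> [[[|n] []]|[n [h pz]]].
- by rewrite jump_pack /= addr0; lra.
- rewrite chain_pack !jump_pack => /andP[h1 h2] pz; exists n; split=> //.
  by apply/andP; split; lra.
- exists n.+1; rewrite chain_pack !jump_pack; split=> //.
  by move: h => /andP[h1 h2]; apply/andP; split; lra.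
Qed.

Lemma measurable_jump n : measurable_fun setT (jump n).
Proof.
elim: n => [|n IH]; first exact: measurable_cst.
by apply: measurable_funD; [exact: measurable_gap|
  apply: measurableT_comp IH _; exact: measurable_tail].
Qed.

Lemma measurable_mark i b : measurable [set w | mark i w = b].
Proof. exact: measurable_coin. Qed.

(** The state space carries no sigma-algebra. The chain depends on finitely many coins, and an
    arbitrary predicate is split along the eight values of the first mark. *)
Lemma measurable_chain n z (p : S -> Prop) : measurable [set w | p (chain n z w)].
Proof.
elim: n z => [|n IH] z /=.
  by have [pz|npz] := pselect (p z); [rewrite (_ : [set _ | _] = setT)|
    rewrite (_ : [set _ | _] = set0)] => //; apply/seteqP; split.
pose B c e k := [set w | mark 0 w = c] `&` [set w | mark 1 w = e] `&`
  [set w | mark 2 w = k] `&` (tail @^-1` [set w | p (chain n (step c e k z) w)]).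
have mB c e k : measurable (B c e k).
  apply: measurableI; first by do 2 (apply: measurableI; last exact: measurable_mark);
    exact: measurable_mark.
  by rewrite -[X in measurable X]setTI; apply: measurable_tail => //; exact: IH.
rewrite (_ : [set _ | _] = B false false false `|` B false false true `|`
  B false true false `|` B false true true `|` B true false false `|`
  B true false true `|` B true true false `|` B true true true).
  by do 7 apply: measurableU => //.
apply/seteqP; split=> w /=.
  rewrite /B /preimage /=.
  by case: (mark 0 w); case: (mark 1 w); case: (mark 2 w) => H; tauto.
rewrite /B /preimage /=.
by do 7 (case; last by move=> [[[-> ->] ->]]); move=> [[[-> ->] ->]].
Qed.

Lemma measurable_at_time t z p : measurable (at_time t z p).
Proof.
rewrite (_ : at_time t z p = \bigcup_n
    (jump n @^-1` `]-oo, t] `&` jump n.+1 @^-1` `]t, +oo[ `&` [set w | p (chain n z w)])).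
  apply: bigcupT_measurable => n; apply: measurableI; last exact: measurable_chain.
  by apply: measurableI; rewrite -[X in measurable X]setTI; exact: measurable_jump.
apply/seteqP; split=> w.
  move=> [n [/andP[h1 h2] h3]]; exists n => //; split=> //; split.
    by rewrite /preimage/= in_itv/=.
  by rewrite /preimage/= in_itv/= h2.
move=> [n _ [[]]]; rewrite /preimage/= !in_itv/= andbT => h1 h2 h3.
by exists n; split=> //; rewrite h1.
Qed.

Definition explosive (t : R) : set coins := [set w | forall n, jump n w <= t].

Definition good : set coins := [set w | forall t, exists n, t < jump n w].

Lemma measurable_explosive t : measurable (explosive t).
Proof.
rewrite (_ : explosive t = \bigcap_n jump n @^-1` `]-oo, t]).
  apply: bigcapT_measurable => n.
  by rewrite -[X in measurable X]setTI; exact: measurable_jump.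
apply/seteqP; split=> w; first by move=> H n _; rewrite /preimage/= in_itv/=.
by move=> H n; have := H n I; rewrite /preimage/= in_itv/=.
Qed.

Lemma goodE : good = ~` \bigcup_n explosive n%:R.
Proof.
apply/seteqP; split=> w.
  by move=> H [n _ En]; have [m] := H n%:R; rewrite ltNge En.
move=> H t; apply: contrapT => nt; apply: H.
exists (Num.truncn t).+1 => // n; apply: ltW; apply: le_lt_trans (truncnS_gt t).
by rewrite leNgt; apply/negP => h; apply: nt; exists n.
Qed.

Lemma measurable_good : measurable good.
Proof.
rewrite goodE; apply: measurableC; apply: bigcupT_measurable => n.
exact: measurable_explosive.
Qed.

Lemma explosive_pack t c e k x w :
  explosive t (pack c e k x w) <-> explosive (t - gap0 x) w.
Proof.
split=> H n; first by have := H n.+1; rewrite jump_pack; lra.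
case: n => [|n]; last by have := H n; rewrite jump_pack; lra.
by have := H 0; have := gap0_gt0 R x; rewrite /=; lra.
Qed.

Lemma gap_explosive t : explosive t `<=` [set w | gap w <= t].
Proof. by move=> w H; have := H 1; rewrite /= addr0. Qed.

Lemma Pr_gap_lt1 (T : R) : 0 <= T -> 0 <= Pr [set x | gap0 x <= T] < 1.
Proof.
move=> T0; rewrite Pr_ge0 Pr_gap0_le//=.
by have := expR_gt0 (- 2 * T); lra.
Qed.

(** Exploding by time [s] requires a first jump by time [s], and then an explosion of the remaining
    path within the remaining time. *)
Lemma Pr_explosive t : Pr (explosive t) = 0.
Proof.
have [t0|t0] := ltP t 0.
  rewrite (_ : explosive t = set0) ?Pr0//.
  by apply/seteqP; split=> // w /(_ 0); rewrite /=; lra.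
apply/eqP; rewrite eq_le Pr_ge0 andbT.
have /andP[q0 q1] := Pr_gap_lt1 t0; set q := Pr _ in q0 q1.
apply: (@geometric_le0 _ _ 1 q) => // n; rewrite mul1r.
(* The remaining time decreases at each jump, so the bound is proved for all horizons up to [t] with
   the same [q]. *)
suff H s : s <= t -> Pr (explosive s) <= q ^+ n by exact: H.
elim: n s => [|n IH] s st; first by rewrite expr0 Pr_le1//; exact: measurable_explosive.
rewrite -(setIidl (@gap_explosive s)).
have := @first_step_compare R s (explosive s) set0 1 0 (q ^+ n).
rewrite !mul1r !mul0r !add0r => H; apply: le_trans (H _ _ _ _ _ _) _ => //.
- exact: measurable_explosive.
- by rewrite exprn_ge0.
- move=> i e k x xs; rewrite mul1r mul0r add0r.
  rewrite (_ : _ @^-1` _ = explosive (s - gap0 x)).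
    by apply: IH; have := gap0_gt0 R x; lra.
  by apply/seteqP; split=> w; rewrite /preimage/= explosive_pack.
rewrite exprSr ler_wpM2l ?exprn_ge0//; apply: Pr_le.
- exact: measurable_gap0_le.
- exact: measurable_gap0_le.
- by move=> x /= /le_trans; apply.
Qed.

Lemma Pr_good A : measurable A -> Pr A = Pr (A `&` good).
Proof.
move=> mA; rewrite (Pr_split R mA measurable_good).
suff -> : Pr (A `&` ~` good) = 0 by rewrite addr0.
apply/eqP; rewrite eq_le Pr_ge0 andbT.
have mg : measurable (~` good) by apply: measurableC; exact: measurable_good.
apply: (@le_trans _ _ (Pr (~` good))); first by apply: Pr_le => //; exact: measurableI.
rewrite -lee_fin PrE// goodE setCK.
suff : (fair R).-negligible (\bigcup_n explosive n%:R).
  move/measure_negligible => -> //; apply: bigcupT_measurable => n.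
  exact: measurable_explosive.
apply: negligible_bigcup => n; apply/negligibleP; first exact: measurable_explosive.
exact: etrans (esym (PrE R (measurable_explosive n%:R))) (congr1 EFin (Pr_explosive n%:R)).
Qed.

End JumpProcess.

(** * The transition probabilities of the jump process *)

Section Semigroup.
Variables (R : realType) (S : Type) (step : bool -> bool -> bool -> S -> S).
Local Notation G := (lamplighter R).
Local Notation Pr := (@Pr R).
Local Notation gap := (gap R).
Local Notation gap0 := (gap0 R).
Local Notation fair := (fair R).
Local Notation at_time := (at_time step).
Variable proj : S -> G.
(* The projected chain is the lazy walk [(1 + P) / 2], so that at the events of
   a Poisson process of rate 2 it performs a walk with generator [lap]. *)
Hypothesis avg_proj : forall (h : G -> R) z,
  avg (fun c e k => h (proj (step c e k z))) = h (proj z) + lap h (proj z) / 2.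

Local Notation at_vertex t z w := (at_time t z (fun st => proj st = w)).

Lemma Pr_at_time_early (t : R) z p : 0 <= t ->
  Pr (at_time t z p `&` ~` [set w | gap w <= t]) =
  (`[< p z >])%:R * expR (- 2 * t).
Proof.
move=> t0; rewrite (_ : _ `&` _ = if `[< p z >] then [set w | t < gap w] else set0).
  case: ifP => _; rewrite ?Pr0 ?mul0r// mul1r.
  have -> : [set w | t < gap w] = setT `&` ~` [set w | gap w <= t].
    by apply/seteqP; split=> w /=; rewrite ltNge; [move=> /negP|case=> _ /negP].
  have := Pr_split R measurableT (measurable_gap_le t).
  have -> : Pr setT = 1 by rewrite /Pr probability_setT.
  suff -> : Pr (setT `&` [set w | gap w <= t]) = 1 - expR (-2 * t) by lra.
  apply: EFin_inj; rewrite Pr_first_step_le//.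
  have E c e k x : pack c e k x @^-1` setT = setT by [].
  rewrite (eq_integral (cst 1%E)) => [|x _]; last first.
    by rewrite /avg !E /= /Pr probability_setT; congr (_%:E); rewrite /=; lra.
  rewrite integral_cst; last exact: measurable_gap0_le.
  rewrite mul1e; apply: etrans (esym (PrE R (measurable_gap0_le t))) _.
  by rewrite Pr_gap0_le.
apply/seteqP; split=> w.
  move=> [[[|n]] [/andP[h1 h2]]] pz.
    by move=> /= /negP; rewrite -ltNge => h; rewrite asboolT.
  by move=> /=; have := jump_ge0 R n (tail w); rewrite /= in h1; lra.
case: asboolP => // pz /= tw; split; last by apply/negP; rewrite -ltNge.
by exists 0; split=> //=; rewrite t0 addr0.
Qed.

Lemma Pr_at_time_late (t s : R) z p : s <= t ->
  (Pr (at_time t z p `&` [set w | gap w <= s]))%:E =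
  (\int[fair]_(x in [set x | gap0 x <= s]%R)
    (avg (fun c e k => Pr (at_time (t - gap0 x) (step c e k z) p)))%:E)%E.
Proof.
move=> st; rewrite Pr_first_step_le; last exact: measurable_at_time.
apply: eq_integral => x; rewrite inE/= => xs; congr (avg _)%:E.
do 3 (apply/funext => ?); congr (Pr _); apply/seteqP; split=> w;
  by rewrite /preimage/= at_time_pack_ge// (le_trans xs).
Qed.

(** By the hypothesis [avg_proj], averaging [heat] over one step gives [h + h' / 2] with [h = heat]
    and [h'] its time derivative, so [integral_gap0] applies. The constant [C] makes the integrand
    non-negative while the sign of [heat] is still unknown. *)
Lemma integral_heat (t s : R) z w C : 0 <= s -> s <= t ->
  (forall r y, 0 <= r <= t -> 0 <= heat r (proj y) w + C) ->
  (\int[fair]_(x in [set x | gap0 x <= s]%R)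
    (avg (fun c e k => heat (t - gap0 x) (proj (step c e k z)) w) + C)%:E =
  (heat t (proj z) w - expR (- 2 * s) * heat (t - s) (proj z) w
    + C * (1 - expR (- 2 * s)))%:E)%E.
Proof.
move=> s0 st C0.
have := @integral_gap0 R (fun r => heat r (proj z) w + C)
  (fun r => lap (fun y => heat r y w) (proj z)) 0 s t.
rewrite subr0 mulr0 expR0 mul1r => H.
rewrite (_ : heat t (proj z) w - _ + _ = heat t (proj z) w + C -
    expR (- 2 * s) * (heat (t - s) (proj z) w + C)); last by ring.
have dh r : is_derive r (1 : R) (fun r => heat r (proj z) w + C)
    (lap (fun y => heat r y w) (proj z)).
  have := is_deriveD (is_derive_heat r (proj z) w) (is_derive_cst C r 1).
  by rewrite addr0.
have ch := @continuous_lap_heat R (proj z) w.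
rewrite -(H dh ch (lexx 0) s0 st).
  rewrite (_ : [set w | 0 < gap0 w <= s] = [set w | gap0 w <= s]); last first.
    by apply/seteqP; split=> x /=; rewrite gap0_gt0.
  apply: eq_integral => x _; congr (_%:E).
  rewrite (avg_proj (fun y => heat (t - gap0 x) y w)); lra.
move=> r rt; have := avg_affine 1 C (fun c e k => heat r (proj (step c e k z)) w).
rewrite mul1r (avg_proj (fun y => heat r y w)) => E.
rewrite addrAC -E; apply: avg_ge0 => c e k; rewrite mul1r; exact: C0.
Qed.

Lemma measurable_heat_gap (t : R) (y w : G) : measurable_fun setT (fun x => heat (t - gap0 x) y w).
Proof.
apply: (measurableT_comp (f := fun r : R => heat r y w) (g := fun x => t - gap0 x)).
  by apply: continuous_measurable_fun; exact: continuous_heat.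
by apply: measurable_funB; [exact: measurable_cst|exact: measurable_gap0].
Qed.

Lemma measurable_avg_at_time (t s : R) z p : s <= t ->
  measurable_fun [set x | gap0 x <= s] (fun x =>
    (avg (fun c e k => Pr (at_time (t - gap0 x) (step c e k z) p)))%:E).
Proof.
move=> st; apply: (@eq_measurable_fun _ _ _ _ _ (fun x =>
    (avg (fun c e k => Pr (pack c e k x @^-1` at_time t z p)))%:E)).
  move=> x; rewrite inE/= => xs; congr (avg _)%:E.
  do 3 (apply/funext => ?); congr (Pr _); apply/seteqP; split=> w;
    by rewrite /preimage/= at_time_pack_ge// (le_trans xs).
apply: measurable_funTS; apply/measurable_EFinP; apply: measurable_avg => c e k.
by apply: measurable_Pr_pack; exact: measurable_at_time.
Qed.

(** Both sides satisfy the same first-jump equation, and each use of it multiplies the bound on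
    their difference by [q < 1]. The initial bound is [1 + expR (2 * t)]. *)
Lemma Pr_at_vertex (t : R) z w : 0 <= t -> Pr (at_vertex t z w) = heat t (proj z) w.
Proof.
move=> t0; have /andP[q0 q1] := Pr_gap_lt1 t0; set q := Pr _ in q0 q1.
pose C := 1 + expR (2 * t).
suff H n s y : 0 <= s <= t -> `|Pr (at_vertex s y w) - heat s (proj y) w| <= C * q ^+ n.
  apply/eqP; rewrite -subr_eq0 -normr_le0.
  by apply: (@geometric_le0 _ _ C q) => // n; apply: H; rewrite t0 lexx.
elim: n s y => [|n IH] s y /andP[s0 st].
  rewrite expr0 mulr1 (le_trans (ler_normB _ _))// lerD//.
    by rewrite ger0_norm ?Pr_ge0// Pr_le1//; exact: measurable_at_time.
  by rewrite (le_trans (heat_bound _ _ s0))// ler_expR ler_wpM2l.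
set c := C * q ^+ n in IH.
have c0 : 0 <= c by rewrite mulr_ge0 ?exprn_ge0// addr_ge0// expR_ge0.
(* Probabilities are non-negative, so the induction hypothesis bounds [heat] below by [- c]; this
   supplies the constant for [integral_heat]. *)
have heat_c r y' : 0 <= r <= s -> 0 <= heat r (proj y') w + c.
  move=> /andP[r0 rs]; have := IH r y'; rewrite r0 (le_trans rs)// => /(_ isT).
  by have := Pr_ge0 R (at_vertex r y' w); rewrite ler_norml => ? /andP[? ?]; lra.
have mE : measurable (at_vertex s y w) := @measurable_at_time R S step s y _.
have mD := @measurable_gap0_le R s.
set D := [set x | gap0 x <= s] in mD.
have qs := Pr_gap0_le s0; rewrite -/D in qs.
have qsq : Pr D <= q.
  apply: Pr_le => //; first exact: measurable_gap0_le.
  by move=> x; rewrite /D /= => /le_trans; apply.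
have m1 : measurable_fun D (fun x =>
    (avg (fun i e k => Pr (at_vertex (s - gap0 x) (step i e k y) w)))%:E).
  exact: measurable_avg_at_time.
have m2 : measurable_fun D (fun x =>
    (avg (fun i e k => heat (s - gap0 x) (proj (step i e k y)) w) + c)%:E).
  apply: measurable_funTS; apply/measurable_EFinP.
  apply: measurable_funD; last exact: measurable_cst.
  by apply: measurable_avg => i e k; exact: measurable_heat_gap.
have h1 x : 0 <= avg (fun i e k => Pr (at_vertex (s - gap0 x) (step i e k y) w)).
  by apply: avg_ge0 => *; exact: Pr_ge0.
have sx x : D x -> 0 <= s - gap0 x <= s.
  by rewrite /D /= => xs; have := gap0_gt0 R x => ?; apply/andP; split; lra.
have hc x : D x -> forall i e k,
    `|Pr (at_vertex (s - gap0 x) (step i e k y) w)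
      - heat (s - gap0 x) (proj (step i e k y)) w| <= c.
  move=> Dx i e k; apply: IH; have /andP[-> /=] := sx x Dx.
  by move=> /le_trans; apply.
have late := Pr_at_time_late y (fun z => proj z = w) (lexx s).
have int_heat := @integral_heat s s y w c s0 (lexx s) heat_c.
have le1 : Pr (at_vertex s y w `&` [set w | gap w <= s]) <=
    heat s (proj y) w - expR (- 2 * s) * heat (s - s) (proj y) w + c * (1 - expR (- 2 * s)).
  rewrite -lee_fin -int_heat late; apply: ge0_le_integral => //.
  - by move=> x _; rewrite lee_fin.
  - move=> x Dx; rewrite lee_fin -[X in _ <= X + _]mul1r -avg_affine.
    apply: avg_le => i e k; rewrite mul1r.
    by have := hc x Dx i e k; rewrite ler_norml => /andP[_]; lra.
(* One [c] comes from the shift of the integrand and the other from the induction hypothesis. *)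
have le2 : heat s (proj y) w - expR (- 2 * s) * heat (s - s) (proj y) w
    + c * (1 - expR (- 2 * s)) <=
    Pr (at_vertex s y w `&` [set w | gap w <= s]) + 2 * c * Pr D.
  rewrite -lee_fin -int_heat EFinD late EFinM PrE//.
  have icst : (\int[fair]_(x in D) (2 * c)%:E = (2 * c)%:E * fair D)%E.
    exact: (integral_cst fair mD (2 * c)%:E).
  rewrite -icst -ge0_integralD//; last 2 first.
  - by move=> x _; rewrite lee_fin.
  - by move=> *; rewrite lee_fin mulr_ge0.
  apply: ge0_le_integral => //.
  - move=> x Dx; rewrite lee_fin -[X in 0 <= X + _]mul1r -avg_affine.
    apply: avg_ge0 => i e k; rewrite mul1r; exact: heat_c (sx x Dx).
  - by apply: emeasurable_funD => //; exact: measurable_cst.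
  - move=> x Dx; rewrite -EFinD lee_fin -[X in X + _ <= _]mul1r -avg_affine.
    rewrite -[X in _ <= X + _]mul1r -avg_affine.
    apply: avg_le => i e k; rewrite !mul1r.
    by have := hc x Dx i e k; rewrite ler_norml => /andP[]; lra.
have -> : Pr (at_vertex s y w) = _ := Pr_split R mE (measurable_gap_le s).
(* The contributions without jump cancel: the chain is still at [y], and [heat 0] is the indicator,
   both with weight [expR (- 2 * s)]. *)
rewrite Pr_at_time_early//.
rewrite subrr heat0 -qs in le1 le2.
rewrite (_ : (`[< proj y = w >])%:R = (proj y == w)%:R); last first.
  by congr (nat_of_bool _)%:R; apply/asboolP/eqP.
rewrite [leRHS](_ : _ = c * q); last by rewrite /c exprSr mulrA.
have : c * Pr D <= c * q by rewrite ler_wpM2l.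
move: le1 le2; move: (Pr (_ `&` _)) ((proj y == w)%:R) (expR _) (heat _ _ _) (Pr D).
move=> a b e h d ? ? ?; rewrite ler_norml; apply/andP; split; lra.
Qed.

End Semigroup.

(** * The Markov property *)

Section History.
Variables (R : realType) (S : Type) (step : bool -> bool -> bool -> S -> S).
Local Notation gap := (gap R).
Local Notation gap0 := (gap0 R).
Local Notation jump := (@jump R).
Local Notation good := (good R).
Implicit Types (s t : R) (w : coins).

(** Phrased through jumps because the set of coins revealed by time [s] is random. The disjunction
    makes the relation symmetric. *)
Definition same_past s w w' : Prop := forall n,
  jump n.+1 w <= s \/ jump n.+1 w' <= s ->
  gap (iter n tail w) = gap (iter n tail w') /\
  forall i, (i < 3)%N -> mark i (iter n tail w) = mark i (iter n tail w').

(* Saturation with respect to [same_past] is only required on [good], so that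
   the negligible set of explosive paths can be disposed of arbitrarily. *)
Definition history s : set_system coins := [set A | measurable A /\
  forall w w', good w -> good w' -> same_past s w w' -> A w -> A w'].

Lemma same_past_sym s w w' : same_past s w w' -> same_past s w' w.
Proof.
move=> H n h; have [|g m] := H n; first tauto.
by split=> // i i3; rewrite m.
Qed.

Lemma same_past_le s t w w' : s <= t -> same_past t w w' -> same_past s w w'.
Proof.
by move=> st H n [h|h]; apply: H; [left|right]; exact: le_trans h st.
Qed.

Lemma same_past_tail s w w' : same_past s w w' -> gap w <= s ->
  same_past (s - gap w) (tail w) (tail w').
Proof.
move=> H gs; have [|/= g0 _] := H 0; first by left; rewrite /= addr0.
by move=> n h; rewrite -!iterSr; apply: H; case: h => /= h; [left|right];
  rewrite /= -?g0; lra.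
Qed.

Lemma same_past_jump n s w w' z : same_past s w w' -> jump n w <= s ->
  jump n w' = jump n w /\ chain step n z w' = chain step n z w.
Proof.
elim: n s w w' z => [//|n IH] s w w' z H js.
have gs : gap w <= s.
  by move: js => /=; have := jump_ge0 R n (tail w); lra.
have [|/= g0 m0] := H 0; first by left; rewrite /= addr0.
rewrite /= !m0// g0.
have [|-> ->] := IH _ _ _ (step (mark 0 w') (mark 1 w') (mark 2 w') z) (same_past_tail H gs).
  by move: js => /=; lra.
by [].
Qed.

Lemma at_time_same_past s z p w w' : same_past s w w' ->
  at_time step s z p w -> at_time step s z p w'.
Proof.
move=> H [n [/andP[h1 h2] pz]]; have [e1 e2] := same_past_jump z H h1.
exists n; rewrite e1 e2 h1; split=> //; rewrite andTb ltNge; apply/negP => h.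
have [e3 _] := same_past_jump z (same_past_sym H) h.
by move: h2; rewrite e3 ltNge h.
Qed.

Lemma good_pack c e k x w : good (pack c e k x w) <-> good w.
Proof.
split=> H t.
  have [[|n]] := H (Num.max 0 (t + gap0 x)); first by rewrite /= gt_max ltxx.
  by rewrite jump_pack gt_max => /andP[_ h]; exists n; lra.
by have [n h] := H (t - gap0 x); exists n.+1; rewrite jump_pack; lra.
Qed.

Lemma same_past_pack s c e k x w w' : same_past (s - gap0 x) w w' ->
  same_past s (pack c e k x w) (pack c e k x w').
Proof.
move=> H [|n] h; first by split=> [|[|[|[|]]]] //=; rewrite !gap_pack.
rewrite !iterSr !tail_pack; apply: H.
by case: h => h; rewrite jump_pack in h; [left|right]; lra.
Qed.

(** Once the first jump is fixed, an event of the past of [s] is an event of the past of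
    [s - gap0 x] for the remaining coins; this drives the induction for the Markov property. *)
Lemma history_pack s A c e k x : history s A ->
  history (s - gap0 x) (pack c e k x @^-1` A).
Proof.
move=> [mA H]; split; first exact: measurable_pack_preimage.
move=> w w' gw gw' ww'; apply: H; last exact: same_past_pack.
  exact/good_pack.
exact/good_pack.
Qed.

Lemma history_filtration : is_filtration history.
Proof.
split.
- move=> t t0; split.
  + by split.
  + move=> A [mA H]; split; first exact: measurableD.
    move=> w w' gw gw' ww' [_ nA]; split=> // Aw'; apply: nA.
    by apply: H Aw' => //; exact: same_past_sym.
  + move=> F HF; split; first by apply: bigcupT_measurable => n; have [] := HF n.
    move=> w w' gw gw' ww' [n _ Fn]; exists n => //.
    by have [_ H] := HF n; exact: H Fn.
- by move=> t t0 A [].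
- move=> s t s0 st A [mA H]; split=> // w w' gw gw' ww'; apply: H => //.
  exact: same_past_le ww'.
Qed.

End History.

Section Markov.
Variables (R : realType) (S : Type) (step : bool -> bool -> bool -> S -> S).
Local Notation G := (lamplighter R).
Local Notation Pr := (@Pr R).
Local Notation gap := (gap R).
Local Notation gap0 := (gap0 R).
Local Notation good := (good R).
Local Notation at_time := (at_time step).
Variable proj : S -> G.
Hypothesis avg_proj : forall (h : G -> R) z,
  avg (fun c e k => h (proj (step c e k z))) = h (proj z) + lap h (proj z) / 2.

Local Notation at_vertex t z w := (at_time t z (fun st => proj st = w)).

Lemma heat_ge0 (t : R) y w : 0 <= t -> 0 <= heat t (proj y) w.
Proof. by move=> t0; rewrite -(Pr_at_vertex avg_proj)// Pr_ge0. Qed.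

Lemma heat_le1 (t : R) y w : 0 <= t -> heat t (proj y) w <= 1.
Proof.
by move=> t0; rewrite -(Pr_at_vertex avg_proj)// Pr_le1//; exact: measurable_at_time.
Qed.

(** Obtained by subtracting the contribution of an early first jump from the whole; [integral_heat]
    is now available with [C = 0], since [heat] is known to be a probability. *)
Lemma Pr_at_vertex_early (s t : R) z b : 0 <= s -> 0 <= t ->
  Pr (at_vertex (s + t) z b `&` ~` [set w | gap w <= s]) =
  expR (- 2 * s) * heat t (proj z) b.
Proof.
move=> s0 t0; have st : s <= s + t by lra.
have mE : measurable (at_vertex (s + t) z b) := @measurable_at_time R S step (s + t) z _.
have := Pr_split R mE (measurable_gap_le s).
rewrite (Pr_at_vertex avg_proj); last by lra.
have : (Pr (at_vertex (s + t) z b `&` [set w | gap w <= s]))%:E =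
    (heat (s + t) (proj z) b - expR (- 2 * s) * heat t (proj z) b)%:E.
  rewrite Pr_at_time_late//.
  have := @integral_heat R S step proj avg_proj (s + t) s z b 0 s0 st.
  rewrite mul0r addr0 (_ : s + t - s = t); last by lra.
  move=> <-; last by move=> r y /andP[r0 _]; rewrite addr0 heat_ge0.
  apply: eq_integral => x; rewrite inE/= => xs; rewrite addr0; congr (avg _)%:E.
  by do 3 (apply/funext => ?); rewrite (Pr_at_vertex avg_proj)//; lra.
move=> [e1] e2; rewrite e1 in e2; lra.
Qed.

(** Any two good paths without a jump up to time [s] have the same past, so [A] contains all of them
    or none. *)
Lemma markov_early (s t : R) A z a b : 0 <= s -> 0 <= t -> history s A ->
  Pr (A `&` at_vertex s z a `&` at_vertex (s + t) z b `&` ~` [set w | gap w <= s]) =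
  Pr (A `&` at_vertex s z a `&` ~` [set w | gap w <= s]) * heat t a b.
Proof.
move=> s0 t0 [mA hA]; set L := ~` [set w | gap w <= s].
have mE r y c : measurable (at_vertex r y c) := @measurable_at_time R S step r y _.
have mL : measurable L by apply: measurableC; exact: measurable_gap_le.
have gtL w : L w -> s < gap w by rewrite /L /= => /negP; rewrite ltNge.
have stay w : L w -> at_vertex s z a w <-> proj z = a.
  move=> /gtL sw; split=> [[[|n] [/andP[h1 h2]]] //=|za].
    by exfalso; move: h1 => /=; have := jump_ge0 R n (tail w); lra.
  by exists 0; split=> //=; rewrite s0 addr0.
have [za|nza] := pselect (proj z = a); last first.
  rewrite (_ : A `&` at_vertex s z a `&` L = set0) ?Pr0 ?mul0r; last first.
    by apply/seteqP; split=> // w [[_ Ew] Lw]; apply: nza; exact/(stay w).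
  rewrite (_ : _ `&` L = set0) ?Pr0//.
  by apply/seteqP; split=> // w [[[_ Ew] _] Lw]; apply: nza; exact/(stay w).
have mI : measurable (A `&` at_vertex s z a `&` L).
  by do 2 apply: measurableI => //.
have mI2 : measurable (A `&` at_vertex s z a `&` at_vertex (s + t) z b `&` L).
  by do 3 apply: measurableI => //.
have [[w0 [gw0 Lw0 Aw0]]|nw] := pselect (exists w, [/\ good w, L w & A w]).
  have Aall w : good w -> L w -> A w.
    move=> gw Lw; apply: hA Aw0 => // n [] /=.
      by have := gtL _ Lw0; have := jump_ge0 R n (tail w0); lra.
    by have := gtL _ Lw; have := jump_ge0 R n (tail w); lra.
  have e1 : Pr (A `&` at_vertex s z a `&` L) = expR (- 2 * s).
    have := @Pr_at_time_early R S step s z (fun _ => True) s0.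
    rewrite asboolT// mul1r => <-; rewrite (Pr_good R mI).
    rewrite [RHS]Pr_good; last by apply: measurableI => //; exact: measurable_at_time.
    congr (Pr _); apply/seteqP; split=> w.
      move=> [[[_ [n [h _]]] Lw] gw]; split=> //; split=> //; by exists n.
    by move=> [[_ Lw] gw]; split=> //; split=> //; split; [exact: Aall|exact/stay].
  have mES : measurable (at_vertex (s + t) z b `&` L) by exact: measurableI.
  rewrite e1; have := Pr_at_vertex_early z b s0 t0; rewrite za => <-.
  rewrite (Pr_good R mI2) (Pr_good R mES).
  congr (Pr _); apply/seteqP; split=> w.
    by move=> [[[_ Ew] Lw] gw].
  move=> [[Ew Lw] gw]; split=> //; split=> //; split=> //.
  by split; [exact: Aall|exact/stay].
rewrite (Pr_good R mI) (Pr_good R mI2).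
rewrite (_ : A `&` at_vertex s z a `&` L `&` good = set0) ?Pr0 ?mul0r; last first.
  by apply/seteqP; split=> // w [[[Aw _] Lw] gw]; apply: nw; exists w.
rewrite (_ : _ `&` good = set0) ?Pr0//.
by apply/seteqP; split=> // w [[[[Aw _] _] Lw] gw]; apply: nw; exists w.
Qed.

(** The contraction argument again: if the first jump comes by time [s], the identity is reduced to
    an earlier time and to the sections of [A]; otherwise it is [markov_early]. *)
Lemma walk_markov (s t : R) A z a b : 0 <= s -> 0 <= t -> history s A ->
  Pr (A `&` at_vertex s z a `&` at_vertex (s + t) z b) =
  Pr (A `&` at_vertex s z a) * heat t a b.
Proof.
move=> s0 t0 hA.
have mE r y c : measurable (at_vertex r y c) := @measurable_at_time R S step r y _.
(* The bounds on [heat] are known only at vertices in the image of [proj]; for the other ones both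
   sides vanish. *)
have [[y ya]|nya] := pselect (exists y, proj y = a); last first.
  rewrite (_ : A `&` at_vertex s z a = set0) ?set0I ?Pr0 ?mul0r//.
  by apply/seteqP; split=> // w [_ [n [_ h]]]; apply: nya; exists (chain step n z w).
have h0 : 0 <= heat t a b by rewrite -ya heat_ge0.
have h1 : heat t a b <= 1 by rewrite -ya heat_le1.
have /andP[q0 q1] := Pr_gap_lt1 s0; set q := Pr _ in q0 q1.
set hh := heat t a b in h0 h1 *.
have mI1 (r : R) (B : set coins) (x : S) : history r B -> measurable (B `&` at_vertex r x a).
  by move=> [mB _]; exact: (measurableI _ _ mB (mE _ _ _)).
have mI12 (r : R) (B : set coins) (x : S) : history r B ->
    measurable (B `&` at_vertex r x a `&` at_vertex (r + t) x b).
  by move=> hB; exact: (measurableI _ _ (mI1 _ _ _ hB) (mE _ _ _)).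
(* The time, the event and the starting state all change at a jump, hence the uniformity in all
   three. *)
suff H n (r : R) (B : set coins) (x : S) : 0 <= r <= s -> history r B ->
    `|Pr (B `&` at_vertex r x a `&` at_vertex (r + t) x b) -
      hh * Pr (B `&` at_vertex r x a)| <= 1 * q ^+ n.
  apply/eqP; rewrite mulrC -subr_eq0 -normr_le0.
  by apply: (@geometric_le0 _ _ 1 q) => // n; apply: H; rewrite ?s0 ?lexx.
elim: n r B x => [|n IH] r B x /andP[r0 rs] hB;
  have mI := mI1 _ _ x hB; have mI2 := mI12 _ _ x hB.
  have := Pr_ge0 R (B `&` at_vertex r x a); have := Pr_le1 R mI.
  have := Pr_ge0 R (B `&` at_vertex r x a `&` at_vertex (r + t) x b).
  have := Pr_le1 R mI2; rewrite expr0 mulr1.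
  move: (Pr _) (Pr _) => u v ? ? ? ?; rewrite ler_norml; apply/andP; split; nra.
have qr : Pr [set x | gap0 x <= r] <= q.
  apply: Pr_le; [exact: measurable_gap0_le|exact: measurable_gap0_le|].
  by move=> u /= /le_trans; apply.
have sec c e k u : gap0 u <= r ->
    `|Pr (pack c e k u @^-1` (B `&` at_vertex r x a `&` at_vertex (r + t) x b)) -
      hh * Pr (pack c e k u @^-1` (B `&` at_vertex r x a))| <= 1 * q ^+ n.
  move=> ur; have := IH (r - gap0 u) _ (step c e k x) _ (history_pack c e k u hB).
  rewrite subr_ge0 ur => /(_ _)/wrap[].
    by have := gap0_gt0 R u => ?; rewrite /=; lra.
  congr (`|Pr _ - hh * Pr _| <= _); apply/seteqP; split=> w.
  - move=> [[Bw E1] E2]; split; first split=> //.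
      by apply/(at_time_pack_ge _ _ _ _ _ _ _ ur).
    by apply/at_time_pack_ge; [lra|]; rewrite (_ : r + t - gap0 u = r - gap0 u + t)//; lra.
  - move=> [[Bw E1] E2]; split; first split=> //.
      by apply/(at_time_pack_ge _ _ _ _ _ _ _ ur).
    move/at_time_pack_ge : E2; rewrite (_ : r + t - gap0 u = r - gap0 u + t); last by lra.
    by apply; lra.
  - by move=> [Bw E1]; split=> //; apply/(at_time_pack_ge _ _ _ _ _ _ _ ur).
  - by move=> [Bw E1]; split=> //; apply/(at_time_pack_ge _ _ _ _ _ _ _ ur).
have q_n0 : 0 <= 1 * q ^+ n by rewrite mul1r exprn_ge0.
have c1 := @first_step_compare R r _ _ 1 hh _ mI2 mI ler01 h0 q_n0.
have c2 := @first_step_compare R r _ _ hh 1 _ mI mI2 h0 ler01 q_n0.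
have {}c1 : 1 * Pr (B `&` at_vertex r x a `&` at_vertex (r + t) x b `&` [set w | gap w <= r])
    <= hh * Pr (B `&` at_vertex r x a `&` [set w | gap w <= r])
      + 1 * q ^+ n * Pr [set x | gap0 x <= r].
  by apply: c1 => i e k u ur; have := sec i e k u ur;  rewrite ler_norml => /andP[? ?]; lra.
have {}c2 : hh * Pr (B `&` at_vertex r x a `&` [set w | gap w <= r])
    <= 1 * Pr (B `&` at_vertex r x a `&` at_vertex (r + t) x b `&` [set w | gap w <= r])
      + 1 * q ^+ n * Pr [set x | gap0 x <= r].
  by apply: c2 => i e k u ur; have := sec i e k u ur;  rewrite ler_norml => /andP[? ?]; lra.
have -> : Pr (B `&` at_vertex r x a `&` at_vertex (r + t) x b) = _ :=
  Pr_split R mI2 (measurable_gap_le r).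
have -> : Pr (B `&` at_vertex r x a) = _ := Pr_split R mI (measurable_gap_le r).
rewrite markov_early// -/hh exprSr.
have : q ^+ n * Pr [set x | gap0 x <= r] <= q ^+ n * q.
  by rewrite ler_wpM2l// exprn_ge0.
move: c1 c2; move: (Pr (B `&` at_vertex r x a `&` [set w | gap w <= r]))
  (Pr (B `&` at_vertex r x a `&` at_vertex (r + t) x b `&` [set w | gap w <= r]))
  (Pr (B `&` at_vertex r x a `&` ~` [set w | gap w <= r]))
  (Pr [set x | gap0 x <= r]) (q ^+ n) => u v e d p c1 c2 dp.
rewrite ler_norml; apply/andP; split; lra.
Qed.

End Markov.

(** * The walk as an adapted cadlag process *)

Section Process.
Variables (R : realType) (S : Type) (step : bool -> bool -> bool -> S -> S).
Local Notation G := (lamplighter R).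
Local Notation jump := (@jump R).
Local Notation good := (good R).
Local Notation chain := (chain step).
Local Notation at_time := (at_time step).
Variables (proj : S -> G) (z : S).

Definition njumps (t : R) (w : coins) : nat :=
  xget 0%N [set n | jump n w <= t < jump n.+1 w].

(** Explosive paths are frozen at the start, because [ctsrw] demands the initial value and the
    regularity of the paths for every outcome. Different projections of one chain give walks on the
    same filtered space. *)
Definition process (t : R) (w : coins) : G :=
  if `[< good w >] then proj (chain (njumps t w) z w) else proj z.

Lemma njumpsE t w n : jump n w <= t < jump n.+1 w -> njumps t w = n.
Proof.
move=> h; apply: (@at_time_uniq R t _ _ w _ h).
by apply: (@xgetPex _ 0%N [set n | jump n w <= t < jump n.+1 w]); exists n.
Qed.

Lemma njumpsP t w : good w -> 0 <= t ->
  jump (njumps t w) w <= t < jump (njumps t w).+1 w.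
Proof.
move=> gw t0; apply: (@xgetPex _ 0%N [set n | jump n w <= t < jump n.+1 w]).
have [m tm] := gw t; elim: m tm => [|m IH]; first by rewrite ltNge t0.
by have [jt tj|tj _] := leP (jump m w) t; [exists m; rewrite /= jt|exact: IH].
Qed.

Lemma process_jump n w : good w -> process (jump n w) w = proj (chain n z w).
Proof.
move=> gw; rewrite /process asboolT// (@njumpsE _ _ n)//.
by rewrite lexx jump_lt.
Qed.

Lemma process_at_time t w (B : set G) : good w -> 0 <= t ->
  B (process t w) <-> at_time t z (fun st => B (proj st)) w.
Proof.
move=> gw t0; rewrite /process asboolT//; split=> [Bw|[n [h Bn]]].
  by exists (njumps t w); split=> //; exact: njumpsP.
by rewrite (njumpsE h).
Qed.

Lemma process0 w : process 0 w = proj z.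
Proof.
rewrite /process; case: asboolP => // _; rewrite (@njumpsE _ _ 0)//.
by have := @jump_lt R 0 w; rewrite /= lexx => ->.
Qed.

Lemma process_adapted t (B : set G) : 0 <= t -> history t (process t @^-1` B).
Proof.
move=> t0; split.
  rewrite (_ : _ @^-1` _ = (good `&` at_time t z (fun st => B (proj st))) `|`
      (~` good `&` if `[< B (proj z) >] then setT else set0)).
    apply: measurableU; apply: measurableI.
    - exact: measurable_good.
    - exact: measurable_at_time.
    - by apply: measurableC; exact: measurable_good.
    - by case: asboolP.
  apply/seteqP; split=> w; rewrite /preimage /=.
    have [gw|ngw] := pselect (good w).
      by move=> Bw; left; split=> //; exact/(process_at_time B gw t0).
    by rewrite /process asboolF// => Bz; right; split=> //; rewrite asboolT.
  move=> [[gw]|[ngw]]; first by move=> h; exact/(process_at_time B gw t0).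
  by case: asboolP => // Bz _; rewrite /process asboolF.
move=> w w' gw gw' ww' Bw; apply/(process_at_time B gw' t0).
by apply: at_time_same_past ww' _; exact/(process_at_time B gw t0).
Qed.

Lemma process_right_continuous w t : 0 <= t ->
  \forall s \near t^'+, process s w = process t w.
Proof.
move=> t0; rewrite /process; case: asboolP => gw; last exact: nearW.
have /andP[h1 h2] := njumpsP gw t0.
near=> s; rewrite (@njumpsE s _ (njumps t w))//.
have ts : t < s by near: s; exact: nbhs_right_gt.
rewrite (le_trans h1 (ltW ts)) /=.
by near: s; exact: nbhs_right_lt.
Unshelve. all: by end_near. Qed.

Lemma process_left_limit w t : 0 < t ->
  exists y, \forall s \near t^'-, process s w = y.
Proof.
move=> t0; rewrite /process; case: asboolP => gw; last by exists (proj z); exact: nearW.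
have := njumpsP gw (ltW t0); move: (njumps t w) => n /andP[h1 h2].
(* If [t] is itself a jump time, the left limit is the state before that jump. *)
move: h1; rewrite le_eqVlt => /orP[/eqP h1|h1]; last first.
  exists (proj (chain n z w)); near=> s.
  have st : s < t by near: s; exact: nbhs_left_lt.
  rewrite (@njumpsE s _ n)//; apply/andP; split; last exact: lt_trans st h2.
  by apply: ltW; near: s; exact: nbhs_left_gt.
case: n h1 h2 => [|n] h1 h2; first by move: t0; rewrite -h1 ltxx.
exists (proj (chain n z w)); near=> s.
rewrite (@njumpsE s _ n)//; apply/andP; split.
  by apply: ltW; near: s; apply: nbhs_left_gt; rewrite -h1 jump_lt.
by rewrite h1; near: s; exact: nbhs_left_lt.
Unshelve. all: by end_near. Qed.

Hypothesis avg_proj : forall (h : G -> R) z,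
  avg (fun c e k => h (proj (step c e k z))) = h (proj z) + lap h (proj z) / 2.

Lemma ctsrw_process : ctsrw (fair R) (@history R) process (proj z).
Proof.
split.
- exact: process0.
- by move=> t B; exact: process_adapted.
- by move=> w t; exact: process_right_continuous.
- by move=> w t; exact: process_left_limit.
move=> s t A a b s0 t0 hA; have mA : measurable A by case: hA.
have ms r c : 0 <= r -> measurable (process r @^-1` [set c]).
  by move=> r0; have [] := process_adapted [set c] r0.
have mE r c : measurable (at_time r z (fun st => proj st = c)) :=
  @measurable_at_time R S step r z _.
have st0 : 0 <= s + t by rewrite addr_ge0.
have m1 := measurableI _ _ mA (ms s a s0).
have m2 := measurableI _ _ m1 (ms (s + t) b st0).
rewrite -(PrE R m2) -(PrE R m1) -EFinM; congr (_%:E).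
rewrite (Pr_good R m1) (Pr_good R m2).
have -> : A `&` process s @^-1` [set a] `&` good =
    A `&` at_time s z (fun st => proj st = a) `&` good.
  by apply/seteqP; split=> w [[Aw Pw] gw]; split=> //; split=> //;
    exact/(process_at_time [set a] gw s0).
have -> : A `&` process s @^-1` [set a] `&` process (s + t) @^-1` [set b] `&` good =
    A `&` at_time s z (fun st => proj st = a) `&`
      at_time (s + t) z (fun st => proj st = b) `&` good.
  apply/seteqP; split=> w [[[Aw Pw] Qw] gw]; split=> //; split.
  - by split=> //; exact/(process_at_time [set a] gw s0).
  - exact/(process_at_time [set b] gw st0).
  - by split=> //; exact/(process_at_time [set a] gw s0).
  - exact/(process_at_time [set b] gw st0).
have n1 := measurableI _ _ mA (mE s a).
have n2 := measurableI _ _ n1 (mE (s + t) b).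
by rewrite -(Pr_good R n1) -(Pr_good R n2) (walk_markov avg_proj).
Qed.

End Process.

(** * The coupling of two lamplighters *)

Section CouplingEvent.
Variable R : realType.
Local Notation G := (lamplighter R).
Variable step : bool -> bool -> bool -> G * G -> G * G.
Local Notation chain := (chain step).
Local Notation good := (good R).

Definition coupled_within (B : set G) (z : G * G) : set coins :=
  [set w | exists n, (chain n z w).1 = (chain n z w).2 /\
    forall i, (i <= n)%N -> B (chain i z w).1 /\ B (chain i z w).2].

Lemma measurable_coupled_within B z : measurable (coupled_within B z).
Proof.
rewrite (_ : coupled_within B z = \bigcup_n
   ([set w | (chain n z w).1 = (chain n z w).2] `&`
    \bigcap_(i in [set i | (i <= n)%N]) [set w | B (chain i z w).1 /\ B (chain i z w).2])).
  apply: bigcupT_measurable => n; apply: measurableI.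
    exact: (measurable_chain step n z (fun st => st.1 = st.2)).
  apply: bigcap_measurable => [|i _]; first by exists 0.
  exact: (measurable_chain step i z (fun st => B st.1 /\ B st.2)).
by apply/seteqP; split=> w [n]; [move=> [h1 h2]; exists n|move=> _ [h1 h2]; exists n].
Qed.

Variables (B : set G) (z : G * G).
Hypothesis Bz : B z.1 /\ B z.2.
Let Y1 := process step fst z.
Let Y2 := process step snd z.

(** The walks change only at jumps, so both times are read off the chain. If the pair agrees after
    the [n]th jump and has stayed in [B], the exit does not precede the next jump, which makes the
    inequality strict. *)
Lemma coupling_before_exit_good w : good w ->
  (coupling_time Y1 Y2 w < exit_time Y1 Y2 B w)%E <-> coupled_within B z w.
Proof.
move=> gw; split.
  move=> /ereal_inf_lt[_ [t [t0 tc] <-]] te.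
  have nP := njumpsP gw t0.
  exists (njumps t w); split.
    by move: tc; rewrite /= /Y1 /Y2 /process asboolT.
  move=> i ni; apply: contrapT => nB.
  suff : (exit_time Y1 Y2 B w <= (jump R i w)%:E)%E.
    rewrite leNgt => /negP; apply; apply: le_lt_trans te; rewrite lee_fin.
    by have /andP[h _] := nP; apply: le_trans h; exact: jump_le.
  apply: ereal_inf_lbound; exists (jump R i w) => //; split; first exact: jump_ge0.
  rewrite /= /Y1 /Y2 !process_jump//.
  by apply/not_andP.
move=> [n [nc nB]].
apply: (@le_lt_trans _ _ (jump R n w)%:E).
  apply: ereal_inf_lbound; exists (jump R n w) => //; split; first exact: jump_ge0.
  by rewrite /= /Y1 /Y2 !process_jump.
apply: (@lt_le_trans _ _ (jump R n.+1 w)%:E); first by rewrite lte_fin jump_lt.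
apply: le_ereal_inf_tmp => _ [t [t0 te] <-]; rewrite lee_fin leNgt; apply/negP => tn.
have /andP[h1 h2] := njumpsP gw t0.
have mn : (njumps t w <= n)%N.
  rewrite leqNgt; apply/negP => /(jump_le R w); rewrite leNgt => /negP; apply.
  exact: le_lt_trans h1 tn.
have [B1 B2] := nB _ mn.
by move: te => [] /=; rewrite /Y1 /Y2 /process asboolT.
Qed.

Lemma coupling_before_exit :
  fair R [set w | coupling_time Y1 Y2 w < exit_time Y1 Y2 B w]%E =
  (Pr R (coupled_within B z))%:E.
Proof.
set E := [set w | _].
(* On explosive paths both walks are frozen at [z], so the event is everything or nothing there; its
   measurability follows. *)
have EE : E = (good `&` coupled_within B z) `|`
    (~` good `&` if `[< z.1 = z.2 >] then setT else set0).
  apply/seteqP; split=> w.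
    rewrite /E /=; have [gw|ngw] := pselect (good w).
      by move=> /(coupling_before_exit_good gw) cw; left.
    move=> /ereal_inf_lt[_ [t [t0 tc] <-]] _; right; split=> //.
    by move: tc; rewrite /= /Y1 /Y2 /process asboolF// => ->; rewrite asboolT.
  move=> [[gw cw]|[ngw]]; first exact/coupling_before_exit_good.
  case: asboolP => // zz _; rewrite /E /=.
  rewrite (_ : exit_time _ _ _ _ = +oo%E); last first.
    rewrite /exit_time /first_time (_ : [set _ | _] = set0) ?image_set0 ?ereal_inf0//.
    apply/seteqP; split=> // t [_] /=; rewrite /Y1 /Y2 /process asboolF//=.
    by case: Bz; tauto.
  apply: (@le_lt_trans _ _ 0%E); last exact: ltry.
  apply: ereal_inf_lbound; exists 0 => //; split=> //=.
  by rewrite /Y1 /Y2 !process0.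
have mg := measurable_good R.
have mc := measurable_coupled_within B z.
have mE : measurable E.
  rewrite EE; apply: measurableU; apply: measurableI => //; first exact: measurableC.
  by case: asboolP.
rewrite -(PrE R mE) (Pr_good R mE) (Pr_good R mc); congr (Pr _ _)%:E.
rewrite EE; apply/seteqP; split=> w; first by case=> -[[]|[]].
by move=> [cw gw]; split=> //; left.
Qed.

End CouplingEvent.

Section Coupling.
Variable R : realType.
Local Notation G := (lamplighter R).
Implicit Types (x y : int * lamps) (z : (int * lamps) * (int * lamps)).

Definition move_to (e k : bool) x : int * lamps :=
  (x.1 + (if e then 1 else -1), set_lamp x.1 k x.2).

(* The lamplighters move independently until their positions agree, and then
   move together and set their lamps to the same state. *)
Definition coupled_step (c e k : bool) z : (int * lamps) * (int * lamps) :=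
  if z.1.1 == z.2.1 then (if c then (move_to e k z.1, move_to e k z.2) else z)
  else if c then (move_to e k z.1, z.2) else (z.1, move_to e k z.2).

(** Whether the walkers are apart or together, each of them moves at half of the ticks, which is the
    lazy walk required of a projection. *)
Lemma avg_coupled_step_fst (h : G -> R) z :
  avg (fun c e k => h (coupled_step c e k z).1) = h z.1 + lap h z.1 / 2.
Proof. by rewrite lapE /avg /coupled_step; case: eqP => _ /=; lra. Qed.

Lemma avg_coupled_step_snd (h : G -> R) z :
  avg (fun c e k => h (coupled_step c e k z).2) = h z.2 + lap h z.2 / 2.
Proof. by rewrite lapE /avg /coupled_step; case: eqP => _ /=; lra. Qed.

(** * Lower bounds on the probability of success *)

Section Value.
Variable B : set G.

Definition value z : R := Pr R (coupled_within coupled_step B z).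

Lemma value_ge0 z : 0 <= value z.
Proof. exact: Pr_ge0. Qed.

Lemma value_coupled x : B x -> value (x, x) = 1.
Proof.
move=> Bx; rewrite /value (_ : coupled_within _ _ _ = setT).
  by rewrite /Pr probability_setT.
by apply/seteqP; split=> // w _; exists 0; split=> // -[|].
Qed.

Lemma value_first_step z : B z.1 -> B z.2 ->
  avg (fun c e k => value (coupled_step c e k z)) <= value z.
Proof.
move=> B1 B2; have mW z' := measurable_coupled_within coupled_step B z'.
rewrite -lee_fin Pr_first_step//.
have -> : (avg (fun c e k => value (coupled_step c e k z)))%:E =
    (\int[fair R]_x (avg (fun c e k => value (coupled_step c e k z)))%:E)%E.
  rewrite (integral_cst (fair R) measurableT).
  have -> : (fair R : {measure set coins -> \bar R}) setT = 1%E.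
    exact: probability_setT.
  by rewrite mule1.
apply: ge0_le_integral => //.
- by move=> x _; rewrite lee_fin avg_ge0// => *; exact: value_ge0.
- by apply/measurable_EFinP; apply: measurable_avg => c e k; exact: measurable_Pr_pack.
- move=> x _; rewrite lee_fin; apply: avg_le => c e k; apply: Pr_le => //.
    exact: measurable_pack_preimage.
  move=> w [n [nc nB]]; exists n.+1; rewrite chain_pack; split=> // -[|i] ni //.
  by rewrite chain_pack; exact: nB.
Qed.

Lemma le_avg (f : bool -> bool -> bool -> R) c e k :
  (forall c e k, 0 <= f c e k) -> f c e k / 8 <= avg f.
Proof.
move=> f0; rewrite /avg.
have := f0 false false false; have := f0 false false true.
have := f0 false true false; have := f0 false true true.
have := f0 true false false; have := f0 true false true.
have := f0 true true false; have := f0 true true true.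
by case: c; case: e; case: k; lra.
Qed.

Lemma value_step c e k z : B z.1 -> B z.2 ->
  value (coupled_step c e k z) / 8 <= value z.
Proof.
move=> B1 B2; apply: le_trans (value_first_step B1 B2).
by apply: (le_avg (f := fun c e k => value (coupled_step c e k z))) => *; exact: value_ge0.
Qed.

(** A verification principle. Each further step lowers the possible excess of [f] over [value] by
    [delta], until it reaches 0; the excess is at most [C] at the beginning. *)
Lemma value_ge (Fam : set ((int * lamps) * (int * lamps))) (f : _ -> R) C delta :
  0 < delta -> (forall z, Fam z -> f z <= C) ->
  (forall z, Fam z -> f z <= value z \/
    [/\ B z.1, B z.2, forall c e k, Fam (coupled_step c e k z)
      & f z + delta <= avg (fun c e k => f (coupled_step c e k z))]) ->
  forall z, Fam z -> f z <= value z.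
Proof.
move=> d0 fC H.
have Hn n z : Fam z -> f z <= value z + Num.max 0 (C - n%:R * delta).
  elim: n z => [|n IH] z Fz.
    rewrite mul0r subr0; have := fC z Fz; have := value_ge0 z.
    by have : C <= Num.max 0 C; [rewrite le_max lexx orbT|]; lra.
  have [fv|[B1 B2 FS fd]] := H z Fz.
    by apply: le_trans fv _; rewrite lerDl le_max lexx.
  have := value_first_step B1 B2.
  have : avg (fun c e k => f (coupled_step c e k z)) <=
      1 * avg (fun c e k => value (coupled_step c e k z)) + Num.max 0 (C - n%:R * delta).
    by rewrite -avg_affine; apply: avg_le => c e k; rewrite mul1r; apply: IH; exact: FS.
  have : Num.max 0 (C - n%:R * delta) - delta <= Num.max 0 (C - n.+1%:R * delta).
    set m := Num.max 0 (C - n.+1%:R * delta).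
    have m0 : 0 <= m by rewrite le_max lexx.
    have m1 : C - n.+1%:R * delta <= m by rewrite le_max lexx orbT.
    by rewrite lerBlDr ge_max; apply/andP; split; rewrite -natr1 in m1; lra.
  by rewrite mul1r; lra.
move=> z Fz; apply: le_trans (Hn (Num.truncn (C / delta)).+1 z Fz) _.
rewrite gerDl ge_max lexx /= subr_le0 -ler_pdivrMr// ltW// truncnS_gt//.
Qed.

Lemma avg_coupled_step_eq (f : _ -> R) z : z.1.1 = z.2.1 ->
  avg (fun c e k => f (coupled_step c e k z)) = f z / 2 +
   (f (move_to false false z.1, move_to false false z.2) +
    f (move_to false true z.1, move_to false true z.2) +
    f (move_to true false z.1, move_to true false z.2) +
    f (move_to true true z.1, move_to true true z.2)) / 8.
Proof. by move=> zz; rewrite /avg /coupled_step zz eqxx; lra. Qed.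

Lemma avg_coupled_step_neq (f : _ -> R) z : z.1.1 != z.2.1 ->
  avg (fun c e k => f (coupled_step c e k z)) =
   (f (move_to false false z.1, z.2) + f (move_to false true z.1, z.2) +
    f (move_to true false z.1, z.2) + f (move_to true true z.1, z.2)) / 8 +
   (f (z.1, move_to false false z.2) + f (z.1, move_to false true z.2) +
    f (z.1, move_to true false z.2) + f (z.1, move_to true true z.2)) / 8.
Proof. by move=> zz; rewrite /avg /coupled_step (negbTE zz); lra. Qed.

(** * The three stages of the coupling, treated from the last to the first *)

Section Stages.
Variables (n0 : int) (xi0 : lamps) (L L' : nat).
Hypotheses (L'L : (L' <= L)%N) (L'0 : (0 < L')%N).

Definition altered_within (l : nat) x : Prop :=
  forall i, x.2 i <> xi0 i -> `|i - n0| <= l%:Z.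

Definition differ_within (a b : int) z : Prop :=
  forall i, z.1.2 i <> z.2.2 i -> a <= i - n0 <= b.

Hypothesis HB : forall x, `|x.1 - n0| <= L%:Z -> altered_within L x -> B x.

Lemma altered_move l e k x : altered_within l x -> `|x.1 - n0| <= l%:Z ->
  altered_within l (move_to e k x).
Proof.
move=> ax xl i; rewrite /move_to /= set_lampE; case: eqP => [->//|_]; exact: ax.
Qed.

Lemma lamps_eqP (xi eta : lamps) : (forall i, xi i = eta i) -> xi = eta.
Proof. by move=> h; apply/fsfunP. Qed.

(** [H] is the first position beyond the region, relative to [n0], and [W] is the length from
    [- L' - 1] to [H]. The second difference of [g] is [1 / W ^ 2]; its factor 1/2 reflects the
    chance of leaving [- L'] to the right. *)
Let H : int := L.+1%:Z.
Let W : int := (L + L' + 2)%:Z.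
Let u z : int := z.1.1 - n0.
Let g (m : int) : R := 2^-1 * ((H - m)%:~R / W%:~R) ^+ 2.

Let W0 : 0 < W%:~R :> R.
Proof. by rewrite /W -pmulrn ltr0n addn2. Qed.

Let g_step m : g (m - 1) + g (m + 1) = 2 * g m + (W%:~R ^+ 2)^-1.
Proof.
rewrite /g !intrD !intrN !intrD mulr1z.
move: (H%:~R : R) (m%:~R : R) (W%:~R : R) W0 => a b c c0.
by field; rewrite gt_eqF.
Qed.

Let g_le m : - L'%:Z - 1 <= m -> m <= H -> 0 <= g m <= 2^-1.
Proof.
move=> m1 m2; have h : 0 <= ((H - m)%:~R / W%:~R : R) <= 1.
  rewrite divr_ge0 ?ler0z ?subr_ge0 ?(ltW W0)//=.
  by rewrite ler_pdivrMr// mul1r ler_int /W /H; lia.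
rewrite /g; move: (_ / _ : R) h => a /andP[a0 a1]; apply/andP; split; nra.
Qed.

(* Once the differing lamps all lie between [- L'] and the common position, it
   is enough to travel leftwards to [- L']; [(H - u) ^ 2] is strictly convex
   and vanishes at the exit [H]. *)
Lemma value_sweep_left z : z.1.1 = z.2.1 ->
  altered_within L z.1 -> altered_within L z.2 ->
  - L'%:Z <= u z <= L%:Z -> differ_within (- L'%:Z) (u z) z ->
  g (u z) <= value z.
Proof.
move=> zz a1 a2 /andP[u1 u2] dz.
(* The position [- L' - 1] may be outside the region, when [L' = L], so it is counted as a failure;
   agreement of the lamps counts as success. *)
pose f z := if u z == - L'%:Z - 1 then 0 else
  if (z.1.2 == z.2.2) && (u z <= L%:Z) then 1 else g (u z).
pose Fam : set ((int * lamps) * (int * lamps)) := [set z | [/\ z.1.1 = z.2.1,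
  altered_within L z.1, altered_within L z.2, - L'%:Z - 1 <= u z <= H
  & differ_within (- L'%:Z) (u z) z]].
have gf z' : Fam z' -> u z' != - L'%:Z - 1 -> g (u z') <= f z'.
  move=> [_ _ _ /andP[h1 h2] _] h; rewrite /f (negbTE h); case: ifP => // _.
  by have /andP[_] := g_le h1 h2; lra.
have f_ge0 z' : Fam z' -> 0 <= f z'.
  move=> [_ _ _ /andP[h1 h2] _]; rewrite /f; case: ifP => // _; case: ifP => // _.
  by have /andP[] := g_le h1 h2.
apply: (@le_trans _ _ (f z)).
  by apply: gf; [split=> //; apply/andP; split; rewrite /H; lia|apply/eqP; lia].
apply: (@value_ge Fam f 1 ((W%:~R ^+ 2)^-1 / 4)); last 1 first.
- by split=> //; apply/andP; split; rewrite /H; lia.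
- by rewrite divr_gt0// invr_gt0 exprn_gt0.
- move=> z' [_ _ _ /andP[h1 h2] _]; rewrite /f; case: ifP => // _; case: ifP => // _.
  by have /andP[_] := g_le h1 h2; lra.
move=> {z zz a1 a2 u1 u2 dz} z Fz; have [zz a1 a2 /andP[u1 u2] dz] := Fz.
have [uL|uL] := eqVneq (u z) (- L'%:Z - 1).
  by left; rewrite /f uL eqxx value_ge0.
have [uH|uH] := eqVneq (u z) H.
  left; rewrite /f (negbTE uL) uH (_ : (H <= L%:Z) = false) ?andbF; last by rewrite /H; lia.
  by rewrite /g subrr mul0r expr0n mulr0 value_ge0.
have uL2 : u z <= L%:Z by move: u2 uH; rewrite /H; lia.
have B1 : B z.1 by apply: HB => //; rewrite -/(u z); lia.
have B2 : B z.2 by apply: HB => //; rewrite -zz -/(u z); lia.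
have [e12|ne12] := eqVneq z.1.2 z.2.2.
  left; rewrite /f (negbTE uL) e12 eqxx uL2 /=.
  rewrite (_ : z = (z.1, z.1)) ?value_coupled//.
  by case: (z) zz e12 => -[n xi] [m eta] /= -> ->.
right.
have um e k : u (move_to e k z.1, move_to e k z.2) = u z + (if e then 1 else -1).
  by rewrite /u /move_to /=; lia.
have FM e k : Fam (move_to e k z.1, move_to e k z.2).
  split.
  - by rewrite /= zz.
  - by apply: altered_move => //; rewrite -/(u z); lia.
  - by apply: altered_move => //; rewrite -zz -/(u z); lia.
  - by rewrite um; move: uL uH u1 u2; rewrite /H; case: e; lia.
  (* The lamp at the old position is made equal, so after a move to the left the differing lamps are
     still at or before the new position. *)
  - move=> i; rewrite um /move_to /= !set_lampE -zz; case: eqP => // ni /dz; move: ni.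
    case: e => ni; rewrite /u => /andP[h1 h2]; apply/andP; split=> //; move: ni h2; move: (z.1.1) => v; lia.
split=> // [c e k|].
  rewrite /coupled_step zz eqxx; case: c; last exact: Fz.
  exact: FM.
rewrite avg_coupled_step_eq//.
have gz : f z = g (u z) by rewrite /f (negbTE uL) (negbTE ne12).
(* Only the lamp at [- L'] can differ here, and any joint move repairs it. Moves to the right give
   [f = 1] and those to the left count as 0, so the average over moves is at least 1/2, slightly
   more than [g]. *)
have [uL'|uL'] := eqVneq (u z) (- L'%:Z).
  have f1 k : f (move_to true k z.1, move_to true k z.2) = 1.
    have [_ _ _ _ dm] := FM true k.
    rewrite /f um uL' ifF; last by lia.
    rewrite ifT//; apply/andP; split; last by lia.
    apply/eqP/lamps_eqP => i; apply: contrapT => di.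
    move: di; rewrite /= !set_lampE -zz; case: eqP => // ni di.
    have /andP[h1 h2] := dz _ di; apply: ni.
    by move: uL' h1 h2; rewrite /u; move: (z.1.1) => v; lia.
  have := f_ge0 _ (FM false false); have := f_ge0 _ (FM false true).
  rewrite !f1 gz uL'.
  have : g (- L'%:Z) <= 2^-1 - 2 * ((W%:~R ^+ 2)^-1 / 4).
    rewrite /g (_ : H - - L'%:Z = W - 1); last by rewrite /H /W; lia.
    have W1 : 1 <= W%:~R :> R by rewrite /W -pmulrn ler1n addn2.
    have i1 : W%:~R^-1 <= 1 :> R by rewrite invf_le1.
    have i0 : 0 <= W%:~R^-1 :> R by rewrite invr_ge0 ltW.
    rewrite intrB mulr1z mulrBl divff ?gt_eqF// mul1r -exprVn.
    move: (W%:~R^-1 : R) i0 i1 => i i0 i1; nra.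
  by lra.
have g1 k : g (u z + 1) <= f (move_to true k z.1, move_to true k z.2).
  by rewrite -(um true k); apply: gf => //; rewrite um; lia.
have g2 k : g (u z - 1) <= f (move_to false k z.1, move_to false k z.2).
  by rewrite -(um false k); apply: gf => //; rewrite um; lia.
have := g1 false; have := g1 true; have := g2 false; have := g2 true.
by have := g_step (u z); rewrite gz; lra.
Qed.

Let V : int := (L + L' + 1)%:Z.

Let V0 : 0 < V%:~R :> R.
Proof. by rewrite /V -pmulrn ltr0n addn1. Qed.

Let gL0 : 0 <= g L'%:Z.
Proof. by rewrite mulr_ge0 ?invr_ge0// sqr_ge0. Qed.

Let gL1 : g L'%:Z <= 1.
Proof. by have /andP[_] := @g_le L'%:Z ltac:(lia) ltac:(rewrite /H; lia); lra. Qed.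

Let b (m : int) : R := g L'%:Z * ((m + H)%:~R / V%:~R) ^+ 2.

Let b_step m : b (m - 1) + b (m + 1) = 2 * b m + 2 * (g L'%:Z / V%:~R ^+ 2).
Proof.
rewrite /b !intrD !intrN mulr1z.
move: (H%:~R : R) (m%:~R : R) (V%:~R : R) (g L'%:Z) V0 => x y v w v0.
by field; rewrite gt_eqF.
Qed.

Let b_le m : - H <= m -> m <= L'%:Z -> 0 <= b m <= 1.
Proof.
move=> m1 m2; have h : 0 <= ((m + H)%:~R / V%:~R : R) <= 1.
  rewrite divr_ge0 ?ler0z ?(ltW V0)//=; last by lia.
  by rewrite ler_pdivrMr// mul1r ler_int /V; move: m1 m2; rewrite /H; lia.
rewrite /b; move: (_ / _ : R) h gL0 gL1 => x /andP[x0 x1] h0 h1.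
by rewrite mulr_ge0 ?sqr_ge0//=; have : x ^+ 2 <= 1 by [rewrite exprn_ile1]; nra.
Qed.

(** [b] vanishes at the exit [- H] and equals [g L'] at [L'], where no differing lamp is on the
    right of the common position and [value_sweep_left] takes over. *)
Lemma value_sweep_right z : z.1.1 = z.2.1 ->
  altered_within L z.1 -> altered_within L z.2 ->
  - H <= u z <= L'%:Z -> differ_within (- L'%:Z) L'%:Z z ->
  b (u z) <= value z.
Proof.
move=> zz a1 a2 uz dz; have [gL|gL] := eqVneq (g L'%:Z) 0.
  by rewrite /b gL mul0r value_ge0.
pose Fam : set ((int * lamps) * (int * lamps)) := [set z | [/\ z.1.1 = z.2.1,
  altered_within L z.1, altered_within L z.2, - H <= u z <= L'%:Z
  & differ_within (- L'%:Z) L'%:Z z]].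
apply: (@value_ge Fam (fun z => b (u z)) 1 (g L'%:Z / V%:~R ^+ 2 / 2)) => //.
- by rewrite !divr_gt0 ?exprn_gt0// lt0r gL gL0.
- by move=> z' [_ _ _ /andP[h1 h2] _]; have /andP[] := b_le h1 h2.
move=> {z zz a1 a2 uz dz} z Fz; have [zz a1 a2 /andP[u1 u2] dz] := Fz.
have [uH|uH] := eqVneq (u z) (- H).
  by left; rewrite uH /b addNr mul0r expr0n mulr0 value_ge0.
have [uL|uL] := eqVneq (u z) L'%:Z.
  left; rewrite uL /b (_ : L'%:Z + H = V); last by rewrite /V /H; lia.
  rewrite divff ?gt_eqF// expr1n mulr1 -uL; apply: value_sweep_left => //.
    by rewrite uL; lia.
  by rewrite uL.
have B1 : B z.1 by apply: HB => //; rewrite -/(u z); move: u1 uH; rewrite /H; lia.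
have B2 : B z.2 by apply: HB => //; rewrite -zz -/(u z); move: u1 uH; rewrite /H; lia.
right.
have um e k : u (move_to e k z.1, move_to e k z.2) = u z + (if e then 1 else -1).
  by rewrite /u /move_to /=; lia.
have FM e k : Fam (move_to e k z.1, move_to e k z.2).
  split.
  - by rewrite /= zz.
  - by apply: altered_move => //; rewrite -/(u z); move: u1 uH; rewrite /H; lia.
  - by apply: altered_move => //; rewrite -zz -/(u z); move: u1 uH; rewrite /H; lia.
  - by rewrite um; move: uL uH u1 u2; rewrite /H; case: e; lia.
  - by move=> i; rewrite /move_to /= !set_lampE -zz; case: eqP => // ni /dz.
split=> // [c e k|].
  rewrite /coupled_step zz eqxx; case: c; last exact: Fz.
  exact: FM.
by rewrite (avg_coupled_step_eq (fun z => b (u z)))// !um; have := b_step (u z); lra.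
Qed.

Let Q : int := L'.+1%:Z.

Let bL0 : 0 <= b (- L'%:Z).
Proof. by have /andP[] := @b_le (- L'%:Z) ltac:(rewrite /H; lia) ltac:(lia). Qed.

Let bL1 : b (- L'%:Z) <= 1.
Proof. by have /andP[] := @b_le (- L'%:Z) ltac:(rewrite /H; lia) ltac:(lia). Qed.

Let b_mono m : - L'%:Z <= m -> b (- L'%:Z) <= b m.
Proof.
move=> m1; rewrite /b ler_wpM2l// !exprMn ler_wpM2r ?sqr_ge0//.
rewrite ler_pXn2r ?nnegrE ?ler_int ?ler0z; rewrite /H; lia.
Qed.

Let w z : int := z.2.1 - n0.

Let q (x y : int) : R := b (- L'%:Z) * ((x * y)%:~R / Q%:~R ^+ 2) ^+ 2.

(** Built from the distance of the left walker to [- Q] times that of the right one to [Q], so that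
    it vanishes once either walker is at an end. The scale [b (- L')] is the least value of [b] at a
    possible meeting point. *)
Definition meeting_bound z : R :=
  if u z <= w z then q (u z + Q) (Q - w z) else q (w z + Q) (Q - u z).

Let Q0 : 0 < Q%:~R :> R.
Proof. by rewrite /Q -pmulrn ltr0n. Qed.

Let q_le m l : 0 <= m -> 0 <= l -> m + l <= 2 * Q -> q m l <= b (- L'%:Z).
Proof.
move=> m0 l0 ml; rewrite /q -[leRHS]mulr1 ler_wpM2l//.
have h : 0 <= ((m * l)%:~R / Q%:~R ^+ 2 : R) <= 1.
  rewrite divr_ge0 ?ler0z ?mulr_ge0 ?sqr_ge0//=.
  rewrite ler_pdivrMr ?exprn_gt0// mul1r expr2 -intrM ler_int.
  have s1 : (m + l) * (m + l) <= (2 * Q) * (2 * Q) by apply: ler_pM; lia.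
  have := sqr_ge0 (m - l); rewrite expr2; move: (Q) s1 => Q' s1 s2; nia.
by case/andP: h => h0 h1; rewrite exprn_ile1.
Qed.

Let q_step m l : 1 <= m -> 1 <= l ->
  4 * q m l + 4 * (b (- L'%:Z) / Q%:~R ^+ 4) <=
  q (m - 1) l + q (m + 1) l + q m (l - 1) + q m (l + 1).
Proof.
move=> m1 l1; have {}m1 : 1 <= m%:~R :> R by rewrite ler1z.
have {}l1 : 1 <= l%:~R :> R by rewrite ler1z.
rewrite /q !intrM !intrD !intrN !mulr1z !expr_div_n -!exprM.
move: (m%:~R : R) (l%:~R : R) m1 l1 bL0 => x y x1 y1; move: (b _) => k k0.
have p0 : 0 <= (Q%:~R ^+ 4)^-1 :> R by rewrite invr_ge0 exprn_ge0// ltW.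
move: (_^-1) p0 => p p0; rewrite !mulrA.
have kp : 0 <= k * p by rewrite mulr_ge0.
have : 0 <= k * p * (2 * (x ^+ 2 - 1) + 2 * (y ^+ 2 - 1)).
  by rewrite mulr_ge0//; nra.
lra.
Qed.

(** While apart, the walkers only alter lamps in [[- L', L']]. When they meet, the product of the
    two distances is at most [Q ^ 2], so the bound is below the one from [value_sweep_right]. *)
Lemma value_meet z :
  altered_within L z.1 -> altered_within L z.2 ->
  `|u z| <= Q -> `|w z| <= Q -> differ_within (- L'%:Z) L'%:Z z ->
  meeting_bound z <= value z.
Proof.
move=> a1 a2 uz wz dz; have [bL|bL] := eqVneq (b (- L'%:Z)) 0.
  by rewrite /meeting_bound /q bL !mul0r if_same value_ge0.
pose Fam : set ((int * lamps) * (int * lamps)) := [set z | [/\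
  altered_within L z.1, altered_within L z.2, `|u z| <= Q, `|w z| <= Q
  & differ_within (- L'%:Z) L'%:Z z]].
have mbl z' : u z' <= w z' -> meeting_bound z' = q (u z' + Q) (Q - w z').
  by rewrite /meeting_bound => ->.
have mbr z' : w z' <= u z' -> meeting_bound z' = q (w z' + Q) (Q - u z').
  rewrite /meeting_bound; case: ifP => // h1 h2.
  by rewrite (_ : u z' = w z')//; apply/eqP; rewrite eq_le h1.
apply: (@value_ge Fam meeting_bound 1 (b (- L'%:Z) / Q%:~R ^+ 4)) => //.
- by rewrite !divr_gt0 ?exprn_gt0// lt0r bL bL0.
- move=> z' [_ _ uQ wQ _]; apply: (le_trans _ bL1); rewrite /meeting_bound.
  case: (leP (u z') (w z')) => uw; apply: q_le; move: uw uQ wQ;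
    by move: (u z') (w z') (Q); clear; lia.
move=> {z a1 a2 uz wz dz} z Fz; have [a1 a2 uz wz dz] := Fz.
have [uw|nuw] := eqVneq (u z) (w z).
  left; have zz : z.1.1 = z.2.1 by move: uw; rewrite /u /w; lia.
  have [uQ|uQ] := eqVneq `|u z| Q.
    have e : w z = Q \/ w z = - Q by move: uQ; rewrite uw; move: (w z) (Q); clear; lia.
    rewrite mbl; last by rewrite uw.
    rewrite uw /q (_ : (_ + _) * _ = 0) ?mul0r ?expr0n ?mulr0 ?value_ge0//.
    by case: e => ->; rewrite ?addNr ?subrr ?mul0r ?mulr0.
  have uL : `|u z| <= L'%:Z by move: uz uQ; rewrite /Q; lia.
  apply: (@le_trans _ _ (b (u z))); last first.
    by apply: value_sweep_right => //; rewrite /H; lia.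
  apply: (le_trans _ (@b_mono (u z) _)); last by lia.
  rewrite mbl; last by rewrite uw.
  by apply: q_le; move: uw uz wz; move: (u z) (w z) (Q); clear; lia.
have zz : z.1.1 != z.2.1.
  by apply: contra nuw => /eqP h; rewrite /u /w h.
have [B0|nB] := pselect (`|u z| = Q \/ `|w z| = Q).
  left; rewrite /meeting_bound /q; case: (leP (u z) (w z)) => uw.
    have e : u z = - Q \/ w z = Q.
      by move: B0 uw uz wz; move: (u z) (w z) (Q); clear; lia.
    rewrite (_ : (_ + _) * _ = 0) ?mul0r ?expr0n ?mulr0 ?value_ge0//.
    by case: e => ->; rewrite ?addNr ?mul0r ?subrr ?mulr0.
  have e : w z = - Q \/ u z = Q.
    by move: B0 uw uz wz; move: (u z) (w z) (Q); clear; lia.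
  rewrite (_ : (_ + _) * _ = 0) ?mul0r ?expr0n ?mulr0 ?value_ge0//.
  by case: e => ->; rewrite ?addNr ?mul0r ?subrr ?mulr0.
have uL : `|u z| <= L'%:Z by move: nB uz; rewrite /Q => /not_orP[]; lia.
have wL : `|w z| <= L'%:Z by move: nB wz; rewrite /Q => /not_orP[]; lia.
have B1 : B z.1 by apply: HB => //; rewrite -/(u z); lia.
have B2 : B z.2 by apply: HB => //; rewrite -/(w z); lia.
have u1 e k : u (move_to e k z.1, z.2) = u z + (if e then 1 else -1).
  by rewrite /u /move_to /=; lia.
have w1 e k : w (move_to e k z.1, z.2) = w z by [].
have u2 e k : u (z.1, move_to e k z.2) = u z by [].
have w2 e k : w (z.1, move_to e k z.2) = w z + (if e then 1 else -1).
  by rewrite /w /move_to /=; lia.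
right; split=> // [c e k|].
  rewrite /coupled_step (negbTE zz); case: c; split=> //.
  - by apply: altered_move => //; rewrite -/(u z); lia.
  - by rewrite u1 /Q; move: uL; move: (u z) (L'); clear; case: e; lia.
  - move=> i; rewrite /move_to /= set_lampE; case: eqP => [->_|_ /dz //].
    by rewrite -/(u z); lia.
  - by apply: altered_move => //; rewrite -/(w z); lia.
  - by rewrite w2 /Q; move: wL; move: (w z) (L'); clear; case: e; lia.
  - move=> i; rewrite /move_to /= set_lampE; case: eqP => [->_|_ /dz //].
    by rewrite -/(w z); lia.
have [x1 x2 y1 y2] : [/\ 1 <= u z + Q, 1 <= Q - u z, 1 <= w z + Q & 1 <= Q - w z].
  by move: uL wL; rewrite /Q; move: (u z) (w z) (L'); clear; split; lia.
(* One walker moves by one site, so the order cannot be reversed without a meeting, and the same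
   branch of [meeting_bound] applies to all successors. *)
rewrite avg_coupled_step_neq//; case: (ltgtP (u z) (w z)) nuw => // uw _.
  have E1 e k : meeting_bound (move_to e k z.1, z.2) =
      q (u z + Q + (if e then 1 else -1)) (Q - w z).
    rewrite mbl u1 w1; first by rewrite addrAC.
    by move: uw; move: (u z) (w z); clear; case: e; lia.
  have E2 e k : meeting_bound (z.1, move_to e k z.2) =
      q (u z + Q) (Q - w z + (if e then -1 else 1)).
    rewrite mbl u2 w2; last by move: uw; move: (u z) (w z); clear; case: e; lia.
    by congr q; move: (w z) (Q); clear; case: e; lia.
  have E1t k : _ = q (u z + Q + 1) (Q - w z) := E1 true k.
  have E1f k : _ = q (u z + Q - 1) (Q - w z) := E1 false k.
  have E2t k : _ = q (u z + Q) (Q - w z - 1) := E2 true k.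
  have E2f k : _ = q (u z + Q) (Q - w z + 1) := E2 false k.
  by rewrite !E1t !E1f !E2t !E2f (mbl _ (ltW uw)); have := q_step x1 y2;
    move: (q (u z + Q - 1) _) (q (u z + Q + 1) _) (q _ (Q - w z - 1))
      (q _ (Q - w z + 1)) (q _ _) (b _ / _) => *; lra.
have E1 e k : meeting_bound (z.1, move_to e k z.2) =
    q (w z + Q + (if e then 1 else -1)) (Q - u z).
  rewrite mbr u2 w2; first by rewrite addrAC.
  by move: uw; move: (u z) (w z); clear; case: e; lia.
have E2 e k : meeting_bound (move_to e k z.1, z.2) =
    q (w z + Q) (Q - u z + (if e then -1 else 1)).
  rewrite mbr u1 w1; last by move: uw; move: (u z) (w z); clear; case: e; lia.
  by congr q; move: (u z) (Q); clear; case: e; lia.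
have E1t k : _ = q (w z + Q + 1) (Q - u z) := E1 true k.
have E1f k : _ = q (w z + Q - 1) (Q - u z) := E1 false k.
have E2t k : _ = q (w z + Q) (Q - u z - 1) := E2 true k.
have E2f k : _ = q (w z + Q) (Q - u z + 1) := E2 false k.
by rewrite !E1t !E1f !E2t !E2f (mbr _ (ltW uw)); have := q_step y1 x2;
  move: (q (w z + Q - 1) _) (q (w z + Q + 1) _) (q _ (Q - u z - 1))
    (q _ (Q - u z + 1)) (q _ _) (b _ / _) => *; lra.
Qed.

(** Here [e] is below each of the ratios of distances. It enters squared in [g], squared again in
    [b], and to the fourth power in [q], which contains a squared product of two ratios; the factor
    1/2 is that of [g]. *)
Lemma value_ge_pow (N : nat) (e : R) z : 0 <= e ->
  e * (L + L' + 2)%:R <= (L.+1 - L')%:R -> e * L'.+1%:R <= (L'.+1 - N)%:R ->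
  (N <= L')%N -> `|z.1.1 - n0| <= N%:Z -> `|z.2.1 - n0| <= N%:Z ->
  altered_within L z.1 -> altered_within L z.2 ->
  differ_within (- L'%:Z) L'%:Z z -> 2^-1 * e ^+ 8 <= value z.
Proof.
move=> e0 eW eQ NL' z1 z2 a1 a2 dz.
have uQ : `|u z| <= Q.
  by move: z1 NL'; rewrite /u /Q; move: (z.1.1 - n0) (L') (N); clear; lia.
have wQ : `|w z| <= Q.
  by move: z2 NL'; rewrite /w /Q; move: (z.2.1 - n0) (L') (N); clear; lia.
apply: (le_trans _ (value_meet a1 a2 uQ wQ dz)).
have HL : (H - L'%:Z)%:~R = (L.+1 - L')%:R :> R.
  by rewrite pmulrn; congr (_%:~R); rewrite /H; move: (L) (L') L'L; clear; lia.
have gle : 2^-1 * e ^+ 2 <= g L'%:Z.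
  rewrite /g ler_wpM2l ?invr_ge0// ler_pXn2r ?nnegrE//; last first.
    by rewrite HL divr_ge0 ?(ltW W0).
  by rewrite ler_pdivlMr// HL /W -pmulrn.
have ble : 2^-1 * e ^+ 4 <= b (- L'%:Z).
  rewrite /b (_ : - L'%:Z + H = H - L'%:Z); last by rewrite addrC.
  rewrite (_ : 2^-1 * e ^+ 4 = (2^-1 * e ^+ 2) * e ^+ 2); last by ring.
  rewrite ler_pM ?mulr_ge0 ?invr_ge0 ?sqr_ge0// ler_pXn2r ?nnegrE//; last first.
    by rewrite HL divr_ge0 ?(ltW V0).
  rewrite ler_pdivlMr// HL; apply: le_trans eW.
  by rewrite ler_wpM2l// /V -pmulrn ler_nat leq_add2l.
have qle m l : (L'.+1 - N)%:Z <= m -> (L'.+1 - N)%:Z <= l -> 2^-1 * e ^+ 8 <= q m l.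
  move=> hm hl; rewrite /q (_ : 2^-1 * e ^+ 8 = (2^-1 * e ^+ 4) * (e ^+ 2) ^+ 2); last by ring.
  have Q1 : e * Q%:~R <= m%:~R.
    by rewrite /Q -pmulrn (le_trans eQ)// pmulrn ler_int.
  have Q2 : e * Q%:~R <= l%:~R.
    by rewrite /Q -pmulrn (le_trans eQ)// pmulrn ler_int.
  have eQ0 : 0 <= e * Q%:~R by rewrite mulr_ge0 ?(ltW Q0).
  rewrite ler_pM ?mulr_ge0 ?invr_ge0 ?exprn_ge0// ler_pXn2r ?nnegrE ?exprn_ge0//.
    rewrite ler_pdivlMr ?exprn_gt0// -exprMn expr2 intrM ler_pM//.
  rewrite divr_ge0 ?exprn_ge0 ?(ltW Q0)// intrM mulr_ge0//.
    exact: le_trans Q1.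
  exact: le_trans Q2.
rewrite /meeting_bound; case: (leP (u z) (w z)) => _; apply: qle; rewrite /u /w /Q;
  by move: z1 z2 NL'; move: (z.1.1) (z.2.1) (L') (n0) (N); clear; lia.
Qed.

End Stages.

Lemma differ_within_altered n0 xi0 (l : nat) z :
  altered_within n0 xi0 l z.1 -> altered_within n0 xi0 l z.2 ->
  differ_within n0 (- l%:Z) l%:Z z.
Proof.
move=> a1 a2 i d; rewrite -ler_norml.
have [h|h] := eqVneq (z.1.2 i) (xi0 i); last by apply: a1; exact/eqP.
by apply: a2 => h2; apply: d; rewrite h h2.
Qed.

Lemma altered_within_le n0 xi0 (l m : nat) x : (l <= m)%N ->
  altered_within n0 xi0 l x -> altered_within n0 xi0 m x.
Proof. by move=> lm ax i /ax h; apply: le_trans h _; rewrite lez_nat. Qed.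

(** * The smallest radius *)

Section UnitRadius.
Variables (n0 : int) (xi0 : lamps).
Hypothesis HB : forall x, `|x.1 - n0| <= 1 -> altered_within n0 xi0 0 x -> B x.

Let dir x : bool := x.1 < n0.
Let back x := move_to (dir x) (xi0 x.1) x.

Let back_pos x : `|x.1 - n0| <= 1 -> x.1 != n0 -> (back x).1 = n0.
Proof. by rewrite /back /move_to /dir /=; case: ltP; lia. Qed.

Let back_altered x : altered_within n0 xi0 0 x -> altered_within n0 xi0 0 (back x).
Proof.
by move=> ax i; rewrite /back /move_to /= set_lampE; case: eqP => [->|_ /ax].
Qed.

Let value_center z : z.1.1 = n0 -> z.2.1 = n0 ->
  altered_within n0 xi0 0 z.1 -> altered_within n0 xi0 0 z.2 -> 8^-1 <= value z.
Proof.
move=> z1 z2 a1 a2.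
have B1 : B z.1 by apply: HB; rewrite ?z1 ?subrr.
have B2 : B z.2 by apply: HB; rewrite ?z2 ?subrr.
have := value_step true true false B1 B2.
rewrite /coupled_step z1 z2 eqxx.
have -> : move_to true false z.2 = move_to true false z.1.
  rewrite /move_to z1 z2; congr pair; apply/lamps_eqP => i.
  rewrite !set_lampE; case: eqP => // ni.
  have out x : altered_within n0 xi0 0 x -> x.2 i = xi0 i.
    by move=> ax; apply: contrapT => /ax; lia.
  by rewrite !out.
rewrite value_coupled ?div1r//; apply: HB; first by rewrite /move_to /= z1; lia.
move=> i; rewrite /move_to /= set_lampE z1; case: eqP => [->|_ /a1 //].
by rewrite subrr.
Qed.

(** At most three prescribed marks, each of probability 1/8, lead to success: the walkers return to
    [n0], restoring the lamps which they leave, and a joint move equalises the lamp at [n0]. *)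
Lemma value_unit_radius z : `|z.1.1 - n0| <= 1 -> `|z.2.1 - n0| <= 1 ->
  altered_within n0 xi0 0 z.1 -> altered_within n0 xi0 0 z.2 -> 8^-1 ^+ 3 <= value z.
Proof.
move=> z1 z2 a1 a2; have B1 := HB z1 a1; have B2 := HB z2 a2.
have [e12|n12] := eqVneq z.1.1 z.2.1.
  have [e1|n1] := eqVneq z.1.1 n0.
    have := value_center e1 _ a1 a2; rewrite -e12 => /(_ e1); lra.
  have n2 : z.2.1 != n0 by rewrite -e12.
  have := value_step true (dir z.1) (xi0 z.1.1) B1 B2.
  rewrite /coupled_step ifT; last exact/eqP.
  have -> : move_to (dir z.1) (xi0 z.1.1) z.2 = back z.2 by rewrite /back /dir e12.
  have := @value_center (back z.1, back z.2) (back_pos z1 n1) (back_pos z2 n2)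
    (back_altered a1) (back_altered a2).
  by rewrite /back; lra.
have half z' : `|z'.2.1 - n0| <= 1 -> z'.1.1 = n0 ->
    altered_within n0 xi0 0 z'.1 -> altered_within n0 xi0 0 z'.2 -> 8^-1 ^+ 2 <= value z'.
  move=> h2 h1 b1 b2.
  have C1 : B z'.1 by apply: HB; rewrite ?h1 ?subrr.
  have C2 : B z'.2 by exact: HB.
  have [e2|n2] := eqVneq z'.2.1 n0; first by have := value_center h1 e2 b1 b2; lra.
  have := value_step false (dir z'.2) (xi0 z'.2.1) C1 C2.
  rewrite /coupled_step h1 eq_sym (negbTE n2).
  have := @value_center (z'.1, back z'.2) h1 (back_pos h2 n2) b1 (back_altered b2).
  by rewrite /back; lra.
have [e1|n1] := eqVneq z.1.1 n0; first by have := half z z2 e1 a1 a2; lra.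
have := value_step true (dir z.1) (xi0 z.1.1) B1 B2.
rewrite /coupled_step (negbTE n12).
have := half (back z.1, z.2) z2 (back_pos z1 n1) (back_altered a1) a2.
by rewrite /back; lra.
Qed.

End UnitRadius.

End Value.
End Coupling.

(** * Size of the region and choice of the constants *)

Section UniformCoupling.
Variable R : realType.
Local Notation G := (lamplighter R).

Lemma gdist_walks (x0 x : G) p xi : path lamp_adj x0 p -> last x0 p = (x.1, xi) ->
  (forall i, xi i = x.2 i) -> (gdist x0 x <= size p)%N.
Proof.
move=> xp lp xix; have := @gdist_le R G x0 p xp; rewrite lp (lamps_eqP xix).
by case: (x).
Qed.

(* Sweep the whole of [- L, L] by going first to the end which is on the other
   side of the target. *)
Lemma gdist_altered (n0 n : int) (xi0 xi : lamps) (L : nat) : (1 < L)%N ->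
  `|n - n0| <= L%:Z -> altered_within n0 xi0 L (n, xi) ->
  (@gdist R G (n0, xi0) (n, xi) <= 4 * L)%N.
Proof.
move=> L1 nL ax; have [e [e1 em]] : exists e : int, (e = 1 \/ e = -1) /\
    e * (n - n0) <= 0.
  by have [h|h] := leP (n - n0) 0; [exists 1|exists (-1)]; split; auto; lia.
have ne1 : - e = 1 \/ - e = -1 by case: e1 => ->; auto.
(* After [3 * L] steps the lamplighter is at the far end, whose lamp is set only by leaving it,
   hence [0 < k]. If the target is this end, two more steps are spent, and [3 * L + 2 <= 4 * L] uses
   [1 < L]. *)
have [k [l [kl kl4 k0]]] : exists k l : nat, [/\
    k%:Z - l%:Z = e * (n - n0) + L%:Z, (3 * L + k + l <= 4 * L)%N & (0 < k)%N].
  have h0 : 0 <= e * (n - n0) + L%:Z by case: e1 => ->; lia.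
  move: (e * _) em h0 => m em h0; have [h|h] := leP (m + L%:Z) 0.
    by exists 1%N, 1%N; split; lia.
  by exists (absz (m + L%:Z)), 0%N; split; lia.
have [p1 [xi1 [w1 l1 s1 h1]]] := lamp_walk L n0 xi0 xi e1.
have [p2 [xi2 [w2 l2 s2 h2]]] := lamp_walk (2 * L) (n0 + e * L%:Z) xi1 xi ne1.
have [p3 [xi3 [w3 l3 s3 h3]]] := lamp_walk k (n0 + e * L%:Z + - e * (2 * L)%:Z) xi2 xi e1.
have [p4 [xi4 [w4 l4 s4 h4]]] :=
  lamp_walk l (n0 + e * L%:Z + - e * (2 * L)%:Z + e * k%:Z) xi3 xi ne1.
apply: (@leq_trans (size (p1 ++ p2 ++ p3 ++ p4))); last first.
  by rewrite !size_cat s1 s2 s3 s4; lia.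
apply: (@gdist_walks (n0, xi0) (n, xi) _ xi4).
- by rewrite !cat_path w1 l1 w2 l2 w3 l3 w4.
- rewrite !last_cat l1 l2 l3 l4; congr pair.
  by move: kl; case: e1 => -> /=; clear; lia.
move=> i /=; rewrite h4; case: ifP => // c4; rewrite h3; case: ifP => // c3.
rewrite h2; case: ifP => // c2; rewrite h1; case: ifP => // c1.
apply: contrapT => d; have {ax} /= := ax i (fun h => d (esym h)).
by move: c1 c2 c3 c4 kl k0 nL em; case: e1 => ->; clear; lia.
Qed.

Lemma gdist_altered0 (n0 n : int) (xi0 xi : lamps) : `|n - n0| <= 1 ->
  altered_within n0 xi0 0 (n, xi) -> (@gdist R G (n0, xi0) (n, xi) <= 2)%N.
Proof.
move=> nL ax; have a0 i : i <> n0 -> xi i = xi0 i.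
  by move=> ni; apply: contrapT => /ax; lia.
have [nn0|nn0] := eqVneq n n0.
  have [p1 [xi1 [w1 l1 s1 h1]]] := lamp_walk 1 n0 xi0 xi (or_introl erefl).
  have [p2 [xi2 [w2 l2 s2 h2]]] := lamp_walk 1 (n0 + 1 * 1%:Z) xi1 xi (or_intror erefl).
  rewrite (_ : 2 = size (p1 ++ p2))%N; last by rewrite size_cat s1 s2.
  apply: (@gdist_walks (n0, xi0) (n, xi) _ xi2).
  - by rewrite cat_path w1 l1 w2.
  - by rewrite last_cat l1 l2 nn0 /=; congr pair; lia.
  move=> i /=; rewrite h2; case: ifP => // c2; rewrite h1; case: ifP => // c1.
  by rewrite a0//; move=> h; move: c1; rewrite h; clear; lia.
have e1 : n - n0 = 1 \/ n - n0 = -1 by move: nL nn0; clear; lia.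
have [p1 [xi1 [w1 l1 s1 h1]]] := lamp_walk 1 n0 xi0 xi e1.
apply: (@leq_trans (size p1)); last by rewrite s1.
apply: (@gdist_walks (n0, xi0) (n, xi) _ xi1) => //.
  by rewrite l1 /=; congr pair; clear; lia.
move=> i /=; rewrite h1; case: ifP => // c1.
by rewrite a0//; move=> h; move: c1; rewrite h subrr mulr0.
Qed.

(** Altering a lamp requires a step away from its site, which gains one unit: [N.-1] is 0 when
    [N = 1], so in that case only the central lamp can be altered. *)
Lemma gball_altered (x0 y : G) (r : R) : gball x0 r y -> 1 <= r ->
  let N := Num.truncn r in
  `|y.1 - x0.1| <= N%:Z /\ altered_within x0.1 x0.2 N.-1 y.
Proof.
move=> yr r1 N; have [p [xp yp sp]] := @gdistP R G x0 y.
have sN : (size p <= N)%N.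
  by rewrite /N truncn_ge_nat ?sp//; apply: le_trans r1.
have [h1 h2] := lamp_path_invariant xp; rewrite yp in h1 h2; split.
  by apply: le_trans h1 _; rewrite lez_nat.
move=> i /h2[_ _] /=; move: (`|i - x0.1|) => a; move: sN; move: (size p) (N).
by clear; lia.
Qed.

Lemma value_lower_bound (K : R) : 4 < K -> exists2 p : R, 0 < p &
  forall (x0 : G) (r : R), 1 <= r -> forall y1 y2, gball x0 r y1 -> gball x0 r y2 ->
  p < value (gball x0 (K * r)) (y1, y2).
Proof.
(* With [j <= e * N], the radii [N], [N + j] and [N + 2 * j] serve for the start, the meeting and
   the sweeps; the choice of [e] gives [4 * (N + 2 * j) <= 4 * (1 + 2 * e) * N <= K * r]. *)
move=> K4; pose e := Num.min 1 ((K - 4) / 8).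
have e0 : 0 < e by rewrite lt_min ltr01 divr_gt0// subr_gt0.
have e1 : e <= 1 by rewrite ge_min lexx.
have eK : 4 * (1 + 2 * e) <= K.
  have : e <= (K - 4) / 8 by rewrite ge_min lexx orbT.
  by lra.
(* The ratios required by [value_ge_pow] are at least [(j + 1) / (2 * N + 3 * j + 2)], where
   [j + 1 > e * N] and the denominator is at most [7 * N]; hence [e / 8]. The other entry is for the
   smallest radius, and halving makes the inequality strict. *)
exists (Num.min (2^-1 * (e / 8) ^+ 8) (8^-1 ^+ 3) / 2).
  by rewrite divr_gt0// lt_min !mulr_gt0 ?exprn_gt0 ?divr_gt0 ?invr_gt0.
move=> x0 r r1 y1 y2 /gball_altered/(_ r1)[z1 a1] /gball_altered/(_ r1)[z2 a2].
set N := Num.truncn r in z1 a1 z2 a2.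
have N0 : (0 < N)%N by rewrite /N truncn_ge_nat//; apply: le_trans r1.
have Nr : N%:R <= r by rewrite truncn_le (le_trans _ r1).
set m := Num.min _ _; have mE : m = Num.min _ _ := erefl.
have m0 : 0 < m by rewrite /m lt_min !mulr_gt0 ?exprn_gt0 ?divr_gt0 ?invr_gt0.
suff : m <= value (gball x0 (K * r)) (y1, y2) by lra.
pose j := Num.truncn (e * N%:R).
have N1 : 1 <= N%:R :> R by rewrite ler1n.
have jN : j%:R <= e * N%:R by rewrite truncn_le mulr_ge0// ltW.
have jN' : e * N%:R < j.+1%:R by exact: truncnS_gt.
have ej : e * j%:R <= j%:R by rewrite ler_piMl.
(* The first case is [N = 1] and [j = 0], where [gdist_altered] does not apply. *)
clearbody m j N; have [h1|L2] := leqP (N + 2 * j) 1.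
  have N1' : N = 1%N by move: h1 N0; clear; lia.
  apply: (@le_trans _ _ (8^-1 ^+ 3)); first by rewrite mE ge_min lexx orbT.
  rewrite N1' /= in z1 z2 a1 a2.
  apply: (@value_unit_radius _ _ x0.1 x0.2) => //.
  move=> x xx ax; rewrite /gball /=; apply: (@le_trans _ _ 2).
    by case: x0 x {z1 a1 z2 a2} xx ax => n0 xi0 [n xi]; rewrite ler_nat; exact: gdist_altered0.
  by nra.
apply: (@le_trans _ _ (2^-1 * (e / 8) ^+ 8)); first by rewrite mE ge_min lexx.
have NS : (N.-1 <= N + j)%N by clear; lia.
have NS2 : (N.-1 <= N + 2 * j)%N by clear; lia.
apply: (@value_ge_pow _ _ x0.1 x0.2 (N + 2 * j) (N + j) _ _ _ N).
- by clear; lia.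
- by move: N0; clear; lia.
- move=> x xx ax; rewrite /gball /=; apply: (@le_trans _ _ (4 * (N + 2 * j))%:R).
    by case: x0 x {z1 a1 z2 a2} xx ax => n0 xi0 [n xi] ? ?; rewrite ler_nat; apply: gdist_altered.
  rewrite !(natrM, natrD); nra.
- by rewrite divr_ge0// ltW.
- rewrite (_ : ((N + 2 * j).+1 - (N + j))%N = j.+1); last by clear; lia.
  rewrite !(natrD, natrM); move: jN'; rewrite -natr1.
  move: (ler0n R j); move: (j%:R : R) (N%:R : R) jN ej N1 e0 e1; move: (e); clear => *; lra.
- rewrite (_ : ((N + j).+1 - N)%N = j.+1); last by clear; lia.
  rewrite -[(N + j).+1%:R]natr1 natrD; move: jN'; rewrite -natr1.
  move: (ler0n R j); move: (j%:R : R) (N%:R : R) jN ej N1 e0 e1; move: (e); clear => *; lra.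
- by clear; lia.
- exact: z1.
- exact: z2.
- exact: altered_within_le a1.
- exact: altered_within_le a2.
- by apply: (@differ_within_altered x0.1 x0.2); exact: altered_within_le NS _.
Qed.

Lemma lamplighter_uniform_coupling (K : R) : 4 < K -> uniform_coupling G K.
Proof.
move=> K4; have [p p0 H] := value_lower_bound K4; exists p => // x0 r r1 y1 y2 b1 b2.
have rK : r <= K * r by rewrite ler_peMl; lra.
have B1 : gball x0 (K * r) y1 by exact: le_trans rK.
have B2 : gball x0 (K * r) y2 by exact: le_trans rK.
exists _, coins, (fair R), (@history R), (process coupled_step fst (y1, y2)),
  (process coupled_step snd (y1, y2)); split.
- exact: history_filtration.
- exact: (ctsrw_process (proj := fst) (y1, y2) (@avg_coupled_step_fst R)).
- exact: (ctsrw_process (proj := snd) (y1, y2) (@avg_coupled_step_snd R)).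
- by rewrite coupling_before_exit// lte_fin; exact: H.
Qed.

End UniformCoupling.

Theorem theorem3 (R : realType) :
  (forall K : R, 4 < K -> uniform_coupling (lamplighter R) K) /\
  ((forall K : R, 1 < K -> K < 3 -> ~ oscillation_inequality (lamplighter R) K)
   /\ ~ elliptic_harnack (lamplighter R)).
Proof.
split; first exact: lamplighter_uniform_coupling.
split; first exact: not_oscillation_inequality.
exact: not_elliptic_harnack.
Qed.
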